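(* Let $\mathcal{K}_0\hookrightarrow\mathcal{K}_1\hookrightarrow\cdots\hookrightarrow\mathcal{K}_m\hookrightarrow\mathcal{L}$ be a filtration of simplicial complexes, where $\mathcal{L}$ is $q$-non-branching and each $\mathcal{K}_i$ $(1\le i\le m)$ contains exactly one more $q$-simplex than $\mathcal{K}_{i-1}$. Then the sequence of matrix pairs $\left\{\big(B_{q+1}^{\mathcal{L},\mathcal{K}_i},W_{q+1}^{\mathcal{L},\mathcal{K}_i}\big)\right\}_{i=0}^m$ and the sequence of matrix products $\left\{(W_q^{\mathcal{K}_i})^{-1/2}B_{q+1}^{\mathcal{L},\mathcal{K}_i}(W_{q+1}^{\mathcal{L},\mathcal{K}_i})^{1/2}\right\}_{i=0}^m$ can be computed in $$O\left((n_q^{\mathcal{L}}-n_q^{\mathcal{K}_m}+m)\cdot\alpha(n_{q+1}^{\mathcal{L}})+(m+1)\cdot(n_{q+1}^{\mathcal{L}}+n_q^{\mathcal{K}_m})\right)$$ arithmetic operations, where $\alpha(\cdot)$ is the inverse Ackermann function.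
   Context: Simplicial complexes are finite; $n_q^X$ is the number of $q$-simplices of $X$. $\mathcal{L}$ is $q$-non-branching if every $q$-simplex of $\mathcal{L}$ is a face of at most two $(q+1)$-simplices of $\mathcal{L}$. Simplices of $\mathcal{L}$ are oriented and ordered (subcomplexes inherit orientations); $B_{q+1}^{\mathcal{L}}$ is the matrix of the boundary operator $\partial_{q+1}^{\mathcal{L}}$ (rows: $q$-simplices, columns: $(q+1)$-simplices). Complexes carry positive weights on simplices; $W_p^X$ is the diagonal matrix of weights of $p$-simplices of $X$. For a subcomplex $\mathcal{K}\hookrightarrow\mathcal{L}$ let $I_q^{\mathcal{K}}$ be the set of row indices of $q$-simplices of $\mathcal{K}$ and let $D$ be the submatrix of $B_{q+1}^{\mathcal{L}}$ formed by the rows not in $I_q^{\mathcal{K}}$. Let $C_0$ be the set of indices of zero columns of $D$ (all columns if $D$ has no rows). On the remaining column indices form the graph in which two columns are adjacent if some row of $D$ is non-zero in both. A connected component $C$ of this graph is regulable if every non-zero row of $D(:,C)$ has exactly two non-zero entries and the columns of $D(:,C)$ can be multiplied by signs $\pm1$ so that every non-zero row has one entry $1$ and one entry $-1$. Let $C_1,\dots,C_r$ be the regulable components, and for each $j$ let $\varepsilon_j\in\{\pm1\}^{C_j}$ be such a choice of signs, so that $D(:,C_j)\varepsilon_j=0$. Put $b_j=B_{q+1}^{\mathcal{L}}(I_q^{\mathcal{K}},C_j)\,\varepsilon_j$ and $s_j=\sum_{k\in C_j}1/W_{q+1}^{\mathcal{L}}(k,k)$. Then $B_{q+1}^{\mathcal{L},\mathcal{K}}$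 is the matrix obtained by concatenating $B_{q+1}^{\mathcal{L}}(I_q^{\mathcal{K}},C_0)$ with the columns $b_1,\dots,b_r$, and $W_{q+1}^{\mathcal{L},\mathcal{K}}$ is the diagonal matrix $W_{q+1}^{\mathcal{L}}(C_0,C_0)\oplus\mathrm{diag}(s_1^{-1},\dots,s_r^{-1})$. The input is $B_{q+1}^{\mathcal{L}}$ in compressed sparse row format, the indices of the $q$-simplices of the $\mathcal{K}_i$ (ordered so that the simplex added at step $i$ comes last), and the diagonal weight matrices; matrices are output in sparse form, and taking a square root counts as one arithmetic operation. *)

(* Defs.v *)
From HB Require Import structures.
From mathcomp Require Import all_boot all_order all_algebra.
From mathcomp Require Import reals.

Set Implicit Arguments.
Unset Strict Implicit.
Unset Printing Implicit Defensive.

Import Order.TTheory GRing.Theory Num.Theory.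

Local Open Scope ring_scope.

(** * Simplicial complexes and boundary matrices *)

Section Complexes.
Variable V : finType.
Implicit Types (X : {set {set V}}) (s t : {set V}).

Definition is_complex X : Prop :=
  set0 \notin X /\
  forall s t, s \in X -> t \subset s -> t != set0 -> t \in X.

Definition simplices (q : nat) X : {set {set V}} := [set s in X | #|s| == q.+1].

Definition nsimplices (q : nat) X : nat := #|simplices q X|.

Definition non_branching (q : nat) X : Prop :=
  forall s, s \in simplices q X ->
    (#|[set t in simplices q.+1 X | s \subset t]| <= 2)%N.

(* An orientation of a simplex is represented by one of the orderings of its
   vertices; two orderings define the same orientation when they differ by an
   even permutation. *)
Definition is_orientation X (o : {set V} -> seq V) : Prop :=
  forall s, s \in X -> perm_eq (o s) (enum s).

(* The number of inversions of the ordering [v] with respect to the ordering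
   [u] of the same vertices: its parity is the sign of the permutation taking
   [u] to [v]. *)
Definition inversions (u v : seq V) : nat :=
  let p := [seq index x u | x <- v] in
  (\sum_(j < size p) \sum_(i < j) (nth 0 p j < nth 0 p i))%N.

Definition omit (i : nat) (u : seq V) : seq V := take i u ++ drop i.+1 u.

(* The coefficient of [s] in the boundary
   d [v_0, ..., v_p] = \sum_i (-1)^i [v_0, ..., v_{i-1}, v_{i+1}, ..., v_p],
   where [v_0, ..., v_p] is the oriented simplex [t]. *)
Definition boundary_coef (R : pzRingType) (o : {set V} -> seq V) s t : R :=
  \sum_(i < size (o t) | [set x in omit i (o t)] == s)
     (-1) ^+ (i + inversions (o s) (omit i (o t))).

Definition boundary_mx (R : pzRingType) (o : {set V} -> seq V)
    (rows cols : seq {set V}) : 'M[R]_(size rows, size cols) :=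
  \matrix_(i, j) boundary_coef R o (nth set0 rows i) (nth set0 cols j).

End Complexes.

(** * The pair (B^{L,K}, W^{L,K}) *)

Section PersistentPair.
Variables (R : rcfType) (n p : nat).
(* [B] is the boundary matrix of L, [w] the diagonal of the weight matrix of
   the (q+1)-simplices, and [I] the list of the rows of the q-simplices of K;
   the submatrix D consists of the rows that do not belong to [I]. *)
Variables (B : 'M[R]_(n, p)) (w : 'rV[R]_p) (I : seq 'I_n).
Implicit Types (C : {set 'I_p}) (eps : {ffun 'I_p -> bool}).

Definition zero_cols : {set 'I_p} :=
  [set k | [forall x, (x \notin I) ==> (B x k == 0)]].

Definition col_adj : rel 'I_p := fun k l =>
  [exists x, [&& x \notin I, B x k != 0 & B x l != 0]].

Definition components : {set {set 'I_p}} :=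
  equivalence_partition (connect col_adj) (~: zero_cols).

Definition nonzero_row C (x : 'I_n) : bool :=
  (x \notin I) && [exists k in C, B x k != 0].

(* The sign attached to the column k is (-1)^(eps k); only the values of
   [eps] on C matter. *)
Definition sign_choice C eps : bool :=
  [forall x, nonzero_row C x ==>
    (#|[set k in C | B x k * (-1) ^+ eps k == 1]| == 1%N) &&
    (#|[set k in C | B x k * (-1) ^+ eps k == -1]| == 1%N)].

Definition regulable C : bool :=
  [forall x, nonzero_row C x ==> (#|[set k in C | B x k != 0]| == 2%N)] &&
  [exists eps, sign_choice C eps].

Definition reg_components : {set {set 'I_p}} :=
  [set C in components | regulable C].

Local Notation c := #|zero_cols|.
Local Notation r := #|reg_components|.

(* An enumeration C_1, ..., C_r of the regulable components, together with a
   choice of signs for each of them. *)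
Definition is_choice (Cs : 'I_r -> {set 'I_p})
    (eps : 'I_r -> {ffun 'I_p -> bool}) : Prop :=
  [/\ injective Cs, forall j, Cs j \in reg_components
    & forall j, sign_choice (Cs j) (eps j)].

Variables (Cs : 'I_r -> {set 'I_p}) (eps : 'I_r -> {ffun 'I_p -> bool}).

Definition pers_boundary : 'M[R]_(size I, c + r) :=
  row_mx (\matrix_(a, k) B (tnth (in_tuple I) a) (enum_val k))
         (\matrix_(a, j) \sum_(k in Cs j)
             B (tnth (in_tuple I) a) k * (-1) ^+ eps j k).

Definition pers_weights : 'rV[R]_(c + r) :=
  row_mx (\row_k w 0 (enum_val k))
         (\row_j (\sum_(k in Cs j) (w 0 k)^-1)^-1).

(* [wK] is the diagonal of the weight matrix of the q-simplices of K. *)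
Definition pers_product (wK : 'rV[R]_(size I)) : 'M[R]_(size I, c + r) :=
  diag_mx (map_mx (fun x => (Num.sqrt x)^-1) wK) *m pers_boundary
    *m diag_mx (map_mx Num.sqrt pers_weights).

End PersistentPair.

(** * Compressed sparse row format *)

(* The stored entries of row i are those at the positions ptr i, ...,
   ptr (i+1) - 1 of [col] and [val]. They are exactly the non-zero entries of
   the row, in any order. *)
Definition is_csr (R : pzRingType) (a b : nat) (M : 'M[R]_(a, b))
    (ptr col : nat -> nat) (val : nat -> R) : Prop :=
  forall i : 'I_a,
  [/\ (ptr i <= ptr i.+1)%N,
      perm_eq [seq col e | e <- index_iota (ptr i) (ptr i.+1)]
              [seq nat_of_ord j | j <- enum 'I_b & M i j != 0]
    & forall (e : nat) (j : 'I_b),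
        (ptr i <= e < ptr i.+1)%N -> col e = j -> val e = M i j].

Definition is_csr_input (R : pzRingType) (a b : nat) (M : 'M[R]_(a, b))
    (ptr col : seq nat) (val : seq R) : Prop :=
  [/\ size ptr = a.+1, nth 0%N ptr 0 = 0%N,
      size col = nth 0%N ptr a, size val = nth 0%N ptr a
    & is_csr M (nth 0%N ptr) (nth 0%N col) (nth 0 val)].

(** * The machine model *)

(* A random access machine over the reals. It has index (natural number) and
   real variables, and index and real arrays, all named by natural numbers.
   Indices can only be added, subtracted and compared, there is no conversion
   between reals and indices, and every constant, memory access, operation,
   test and assignment takes one unit of time. *)

Inductive iexp : Type :=
| IConst of nat
| IVar of nat
| IGet of nat & iexp
| IAdd of iexp & iexp
| ISub of iexp & iexp.  (* truncated subtraction *)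

Inductive rexp : Type :=
| RConst of nat
| RVar of nat
| RGet of nat & iexp
| RAdd of rexp & rexp
| RSub of rexp & rexp
| RMul of rexp & rexp
| RDiv of rexp & rexp
| RSqrt of rexp.

Inductive bexp : Type :=
| ILe of iexp & iexp
| RLe of rexp & rexp
| BNot of bexp
| BAnd of bexp & bexp.

Inductive cmd : Type :=
| Skip
| ISet of nat & iexp
| RSet of nat & rexp
| IPut of nat & iexp & iexp    (* array, position, value *)
| RPut of nat & iexp & rexp
| Seq of cmd & cmd
| If of bexp & cmd & cmd
| While of bexp & cmd.

Fixpoint icost (e : iexp) : nat :=
  match e with
  | IConst _ | IVar _ => 1%N
  | IGet _ e1 => (icost e1).+1
  | IAdd e1 e2 | ISub e1 e2 => (icost e1 + icost e2).+1%N
  end.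

Fixpoint rcost (e : rexp) : nat :=
  match e with
  | RConst _ | RVar _ => 1%N
  | RGet _ e1 => (icost e1).+1
  | RAdd e1 e2 | RSub e1 e2 | RMul e1 e2 | RDiv e1 e2 =>
      (rcost e1 + rcost e2).+1%N
  | RSqrt e1 => (rcost e1).+1
  end.

Fixpoint bcost (e : bexp) : nat :=
  match e with
  | ILe e1 e2 => (icost e1 + icost e2).+1%N
  | RLe e1 e2 => (rcost e1 + rcost e2).+1%N
  | BNot e1 => (bcost e1).+1
  | BAnd e1 e2 => (bcost e1 + bcost e2).+1%N
  end.

Section Semantics.
Variable R : rcfType.

Record state : Type := State {
  ivar : nat -> nat;
  rvar : nat -> R;
  iarr : nat -> nat -> nat;
  rarr : nat -> nat -> R }.

Definition upd (T : Type) (f : nat -> T) (x : nat) (v : T) : nat -> T :=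
  fun y => if y == x then v else f y.

Definition upd2 (T : Type) (f : nat -> nat -> T) (a x : nat) (v : T) :
    nat -> nat -> T :=
  upd f a (upd (f a) x v).

Fixpoint ieval (s : state) (e : iexp) : nat :=
  match e with
  | IConst k => k
  | IVar x => ivar s x
  | IGet a e1 => iarr s a (ieval s e1)
  | IAdd e1 e2 => (ieval s e1 + ieval s e2)%N
  | ISub e1 e2 => (ieval s e1 - ieval s e2)%N
  end.

Fixpoint reval (s : state) (e : rexp) : R :=
  match e with
  | RConst k => k%:R
  | RVar x => rvar s x
  | RGet a e1 => rarr s a (ieval s e1)
  | RAdd e1 e2 => reval s e1 + reval s e2
  | RSub e1 e2 => reval s e1 - reval s e2
  | RMul e1 e2 => reval s e1 * reval s e2
  | RDiv e1 e2 => reval s e1 / reval s e2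
  | RSqrt e1 => Num.sqrt (reval s e1)
  end.

Fixpoint beval (s : state) (e : bexp) : bool :=
  match e with
  | ILe e1 e2 => (ieval s e1 <= ieval s e2)%N
  | RLe e1 e2 => reval s e1 <= reval s e2
  | BNot e1 => ~~ beval s e1
  | BAnd e1 e2 => beval s e1 && beval s e2
  end.

(* [exec c s s' t]: from the state [s], the program [c] terminates in the
   state [s'] after [t] operations. *)
Inductive exec : cmd -> state -> state -> nat -> Prop :=
| exec_skip s : exec Skip s s 1%N
| exec_iset x e s :
    exec (ISet x e) s
      (State (upd (ivar s) x (ieval s e)) (rvar s) (iarr s) (rarr s))
      (icost e).+1
| exec_rset x e s :
    exec (RSet x e) s
      (State (ivar s) (upd (rvar s) x (reval s e)) (iarr s) (rarr s))
      (rcost e).+1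
| exec_iput a e1 e2 s :
    exec (IPut a e1 e2) s
      (State (ivar s) (rvar s)
         (upd2 (iarr s) a (ieval s e1) (ieval s e2)) (rarr s))
      (icost e1 + icost e2).+1%N
| exec_rput a e1 e2 s :
    exec (RPut a e1 e2) s
      (State (ivar s) (rvar s) (iarr s)
         (upd2 (rarr s) a (ieval s e1) (reval s e2)))
      (icost e1 + rcost e2).+1%N
| exec_seq c1 c2 s s1 s2 t1 t2 :
    exec c1 s s1 t1 -> exec c2 s1 s2 t2 -> exec (Seq c1 c2) s s2 (t1 + t2)%N
| exec_if_true b c1 c2 s s1 t :
    beval s b -> exec c1 s s1 t -> exec (If b c1 c2) s s1 (bcost b + t).+1%N
| exec_if_false b c1 c2 s s1 t :
    ~~ beval s b -> exec c2 s s1 t -> exec (If b c1 c2) s s1 (bcost b + t).+1%N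
| exec_while_true b c s s1 s2 t1 t2 :
    beval s b -> exec c s s1 t1 -> exec (While b c) s1 s2 t2 ->
    exec (While b c) s s2 (bcost b + t1 + t2).+1%N
| exec_while_false b c s :
    ~~ beval s b -> exec (While b c) s s (bcost b).+1.

(** * Input and output conventions *)

(* Index variables 0, 1, 2, 3: numbers of rows and columns of B, length of
   [idx], and m. Index arrays 0, 1, 2: row pointers and column indices of B,
   and [idx]. Real arrays 0, 1, 2: stored values of B, diagonal [wt] of the
   weight matrix of the (q+1)-simplices, and [wq], the concatenation of the
   diagonals of the weight matrices of the q-simplices of K_0, ..., K_m. The
   rest of the memory is zero. *)
Definition input_state (nrows ncols m : nat) (ptr col : seq nat) (val : seq R)
    (idx : seq nat) (wt wq : seq R) : state :=
  State (nth 0%N [:: nrows; ncols; size idx; m])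
        (fun _ => 0)
        (fun a => nth 0%N (nth [::] [:: ptr; col; idx] a))
        (fun a => nth 0 (nth [::] [:: val; wt; wq] a)).

(* The results for all i share a few arrays, in which position i of a header
   array points to the data of the i-th result.
   Index array 3: number of columns of B^{L,K_i}.
   Index array 4: headers of the row pointers, stored in index array 5, of
   B^{L,K_i}; its column indices are in index array 6, its values in real
   array 3.
   Index array 7: headers of the diagonals of W^{L,K_i}, in real array 4.
   Index array 8: headers of the row pointers, stored in index array 9, of the
   product; its column indices are in index array 10, its values in real
   array 5. *)
Definition outputs_pair (s : state) (i a b : nat)
    (M : 'M[R]_(a, b)) (D : 'M[R]_b) : Prop :=
  [/\ iarr s 3 i = b,
      is_csr M (fun x => iarr s 5 (iarr s 4 i + x)%N) (iarr s 6) (rarr s 3)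
    & forall j : 'I_b, rarr s 4 (iarr s 7 i + j)%N = D j j].

Definition outputs_product (s : state) (i a b : nat) (M : 'M[R]_(a, b)) :
    Prop :=
  is_csr M (fun x => iarr s 9 (iarr s 8 i + x)%N) (iarr s 10) (rarr s 5).

End Semantics.

(** * The inverse Ackermann function *)

(* The Ackermann-Peter function. *)
Fixpoint ack (a : nat) : nat -> nat :=
  fix ack_a (b : nat) : nat :=
    match a, b with
    | 0%N, _ => b.+1
    | a'.+1, 0%N => ack a' 1%N
    | a'.+1, b'.+1 => ack a' (ack_a b')
    end.

Lemma ltn_ack a b : (b < ack a b)%N.
Proof.
elim: a b => [|a IHa] b; first by case: b => [|b] /=.
elim: b => [|b IHb] /=; first exact: ltn_trans (IHa 1%N).
exact: leq_ltn_trans IHb (IHa _).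
Qed.

Lemma inv_ack_ex n : exists k, (0 < k)%N && (n <= ack k k)%N.
Proof. by exists n.+1; rewrite /= (leq_trans _ (ltnW (ltn_ack n.+1 n.+1))). Qed.

(* alpha(n) = min {k >= 1 : n <= A(k,k)} *)
Definition inv_ack (n : nat) : nat := ex_minn (inv_ack_ex n).

(* Main.v *)
Require Import Defs.
From mathcomp Require Import all_boot all_order all_algebra.
From mathcomp Require Import reals.
From mathcomp Require Import ring lra zify.

(** Since alpha >= 1, it suffices to spend O(n_q^L + n_{q+1}^L) operations once
    and O(n_{q+1}^L + n_q^{K_m}) operations per step, so no union-find structure
    is needed.  The program keeps, for the rows outside K_i, a representative
    [comp k] of the component of every column k, a sign [sgn k], a flag [bad]
    marking the components that cannot be regulated, and a flag [tch] marking
    the non-zero columns.  A component has at most one balancing choice of signs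
    up to a global sign, so adding a row that the current signs do not balance
    excludes all choices: this makes the data maintainable row by row (record
    [labelling]).  For K_m the rows are added in the order of a breadth-first
    search, where a row only ever merges a single new column into the current
    component; going from K_i to K_{i-1} adds one row, and relabelling all
    columns is affordable.  By non-branching every row has at most two entries,
    so each result is written in time linear in n_{q+1}^L + n_q^{K_i}. *)

Set Implicit Arguments.
Unset Strict Implicit.
Unset Printing Implicit Defensive.

Import Order.TTheory GRing.Theory Num.Theory.

Local Open Scope ring_scope.

(** * Labelled components *)

(** Shrinking [K] adds rows to D, so down the filtration components only merge, an excluded
    component stays excluded and a non-zero column stays non-zero; in the other direction all of
    this would have to be undone. The results therefore appear in the order of K_m, ..., K_0, each
    written in the shared arrays above the earlier ones. The linear preprocessing fits the bound
    because n_q^L is the sum of n_q^L - n_q^{K_m}, charged to the summand with alpha, and n_q^{K_m},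
    charged to the other summand. Columns of C_0 are treated as one-element components with sign 1:
    the signed sum over such a class is the column itself, and the inverse of its reciprocal weight
    is its weight, so a single formula serves both blocks of the result. The enumeration of the
    regulable components and their signs are existentially quantified in the goal, which leaves the
    program free to list roots in increasing order and to use the signs it has computed. *)

Definition is_sign (R : pzRingType) (e : R) : Prop := e = 1 \/ e = -1.

Section Labelling.
Variables (R : rcfType) (n p : nat) (B : 'M[R]_(n, p)).
Hypothesis B_sign : forall x k, B x k != 0 -> is_sign (B x k).
Implicit Types (a b c d : R) (E : pred 'I_n) (x : 'I_n) (j k l : 'I_p).

Definition adj_rows E : rel 'I_p :=
  fun k l => [exists x, [&& E x, B x k != 0 & B x l != 0]].

(** The condition names a cancelling partner instead of counting entries 1 and -1. When a row has at
    most two entries the two formulations agree, and a row with a single entry refutes this one at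
    once. The signs are real values indexed by [nat], so that [eps] can be the sign array in
    memory. *)
Definition balanced E (comp : nat -> nat) k (eps : nat -> R) : Prop :=
  forall x j, E x -> comp j = comp k -> B x j != 0 ->
  exists l, [/\ l != j, B x l != 0 & B x j * eps j + B x l * eps l = 0].

(** The functions on [nat] are arrays of the machine, and [bad] is consulted at roots only.
    [lab_adj] and [lab_conn] together say that the classes of [comp] are exactly the connected
    components. [lab_sgn1] makes a column of C_0 enter the result without a sign change. *)
Record labelling E (comp bad tch : nat -> nat) (sgn : nat -> R) : Prop :=
  Labelling {
    lab_lt : forall k, (comp k < p)%N;
    lab_idem : forall k, comp (comp k) = comp k;
    lab_sgn : forall k, is_sign (sgn k);
    lab_tch : forall k, tch k = [exists x, E x && (B x k != 0)] :> nat;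
    lab_sgn1 : forall k, tch k = 0%N -> sgn k = 1;
    lab_adj : forall x k l, E x -> B x k != 0 -> B x l != 0 -> comp k = comp l;
    lab_conn : forall k l, comp k = comp l -> connect (adj_rows E) k l;
    lab_good : forall k, bad (comp k) = 0%N -> balanced E comp k sgn;
    (* Any balancing choice of signs on a component agrees with [sgn] up to a
       global sign, so an inconsistent row excludes all of them. *)
    lab_uniq : forall k (eps : nat -> R),
      (forall j, is_sign (eps j)) -> balanced E comp k eps ->
      bad (comp k) = 0%N /\
      (forall j, comp j = comp k -> eps j * sgn j = eps k * sgn k) }.

Definition add_row E x : pred 'I_n := fun y => E y || (y == x).

Lemma is_signM a b : is_sign a -> is_sign b -> is_sign (a * b).
Proof.
by move=> [->|->] [->|->]; rewrite ?mulrNN ?mul1r ?mulr1; [left|right|right|left].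
Qed.

Lemma is_signN a : is_sign a -> is_sign (- a).
Proof. by move=> [->|->]; rewrite ?opprK; [right|left]. Qed.

Lemma is_sign_sqr a : is_sign a -> a * a = 1.
Proof. by move=> [->|->]; rewrite ?mulrNN mulr1. Qed.

Lemma adj_rows_sub E x : subrel (connect (adj_rows E)) (connect (adj_rows (add_row E x))).
Proof.
apply: connect_sub => k l /existsP[y /and3P[Ey yk yl]].
by apply: connect1; apply/existsP; exists y; rewrite /add_row Ey yk yl.
Qed.

Lemma adj_rows_sym E : connect_sym (adj_rows E).
Proof.
by apply: sym_connect_sym => k l; apply: eq_existsb => x; rewrite [(_ != _) && _]andbC.
Qed.

(** Zero rows influence no field, so [E] may change freely on them. This accounts for the rows that
    a search along column entries never reaches. *)
Lemma labelling_ext E E' comp bad tch sgn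
  (comp' bad' tch' : nat -> nat) (sgn' : nat -> R) :
  labelling E comp bad tch sgn -> (forall x k, B x k != 0 -> E x = E' x) ->
  (forall k : 'I_p, comp' k = comp k) -> (forall k : 'I_p, bad' k = bad k) ->
  (forall k : 'I_p, tch' k = tch k) -> (forall k : 'I_p, sgn' k = sgn k) ->
  labelling E' comp' bad' tch' sgn'.
Proof.
case=> Hlt Hid Hsg Ht Hs1 Ha Hc Hg Hu EE ec eb et es.
have eb' k : bad' (comp' k) = bad (comp k).
  (* The agreement hypotheses concern column indices only; [lab_lt] turns the root [comp k] into
     one. *)
  by rewrite ec -[comp k]/(nat_of_ord (Ordinal (Hlt k))) eb.
split.
- by move=> k; rewrite ec.
- by move=> k; rewrite ec -[comp k in LHS]/(nat_of_ord (Ordinal (Hlt k))) ec Hid.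
- by move=> k; rewrite es.
- move=> k; rewrite et Ht; congr nat_of_bool; apply: eq_existsb => x.
  by case: (boolP (B x k == 0)) => xk; rewrite ?andbF // (EE x k).
- by move=> k; rewrite et es; apply: Hs1.
- by move=> x k l Ex xk xl; rewrite !ec; apply: (Ha x) => //; rewrite (EE x k).
- move=> k l; rewrite !ec => /Hc; apply: connect_sub => k' l' H.
  apply: connect1; case/existsP: H => x /and3P[Ex xk xl].
  by apply/existsP; exists x; rewrite -(EE x k') // Ex xk.
- move=> k; rewrite eb' => /Hg H x j Ex; rewrite !ec => ecj xj; rewrite -(EE x j) // in Ex.
  have := H _ _ Ex ecj xj.
  by case=> l [? ? ?]; exists l; rewrite !es.
- move=> k eps Se bal; rewrite eb'.
  have [|b u] := Hu k eps Se.
    move=> x j Ex ecj xj; apply: bal => //; first by rewrite -(EE x j).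
    by rewrite !ec.
  by split=> // j; rewrite !ec !es => /u.
Qed.

Lemma labelling_init E (comp bad tch : nat -> nat) (sgn : nat -> R) :
  (forall x k, E x -> B x k = 0) ->
  (forall k : 'I_p, comp k = k) -> (forall k : 'I_p, bad k = 0%N) ->
  (forall k : 'I_p, tch k = 0%N) -> (forall k : 'I_p, sgn k = 1) ->
  labelling E comp bad tch sgn.
Proof.
move=> E0 ec eb et es; split.
- by move=> k; rewrite ec.
- by move=> k; rewrite ec ec.
- by move=> k; rewrite es; left.
- move=> k; rewrite et; case: existsP => // -[x /andP[Ex]].
  by rewrite E0 // eqxx.
- by move=> k _; rewrite es.
- by move=> x k l Ex; rewrite E0 // eqxx.
- by move=> k l; rewrite !ec => /val_inj ->.
- by move=> k _ x j Ex _; rewrite E0 // eqxx.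
- move=> k eps _ _; rewrite ec eb; split => // j; rewrite !ec.
  by move/val_inj->.
Qed.

Lemma labelling_row0 E x comp bad tch sgn :
  (forall k, B x k = 0) -> labelling E comp bad tch sgn ->
  labelling (add_row E x) comp bad tch sgn.
Proof.
move=> x0 [Hlt Hid Hsg Ht Hs1 Ha Hc Hg Hu].
have EE y k : add_row E x y -> B y k != 0 -> E y.
  by case/orP => // /eqP->; rewrite x0 eqxx.
split=> //.
- move=> k; rewrite Ht; congr nat_of_bool; apply/existsP/existsP => -[y].
    by move=> /andP[Ey yk]; exists y; rewrite /add_row Ey yk.
  by move=> /andP[Ey yk]; exists y; rewrite yk (EE _ _ Ey yk).
- by move=> y k l Ey yk; apply: Ha => //; apply: EE yk.
- by move=> k l /Hc; apply: adj_rows_sub.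
- by move=> k /Hg H y j Ey cj yj; apply: H => //; apply: EE yj.
- move=> k eps Se bal; apply: Hu => // y j Ey; apply: bal.
  by rewrite /add_row Ey.
Qed.

Lemma tch_add_row E x (tch : nat -> nat) k :
  tch k = [exists y, E y && (B y k != 0)] :> nat ->
  [exists y, add_row E x y && (B y k != 0)] =
    (if B x k != 0 then 1%N else tch k) :> nat.
Proof.
move=> Ht; case: ifP => xk.
  suff -> : [exists y, add_row E x y && (B y k != 0)] by [].
  by apply/existsP; exists x; rewrite /add_row eqxx orbT xk.
rewrite Ht; congr nat_of_bool; apply: eq_existsb => y; rewrite /add_row.
by case: (y =P x) => [->|_]; rewrite ?orbF // xk !andbF.
Qed.

(** No choice of signs cancels a lone entry, so the component of [k] is excluded for good. *)
Lemma labelling_row1 E x k comp bad tch sgn (bad' tch' : nat -> nat) :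
  B x k != 0 -> (forall l, B x l != 0 -> l = k) ->
  labelling E comp bad tch sgn ->
  (forall j : 'I_p, bad' (comp j) = if comp j == comp k then 1%N else bad (comp j)) ->
  (forall j : 'I_p, tch' j = if j == k then 1%N else tch j) ->
  labelling (add_row E x) comp bad' tch' sgn.
Proof.
move=> xk xu [Hlt Hid Hsg Ht Hs1 Ha Hc Hg Hu] eb et.
have ex l : (B x l != 0) = (l == k) by apply/idP/eqP => [/xu|->].
split=> //.
- by move=> j; rewrite et (tch_add_row _ (Ht j)) ex.
- by move=> j; rewrite et; case: ifP => // _ /Hs1.
- move=> y j l /orP[Ey|/eqP->]; first exact: Ha.
  by rewrite !ex => /eqP-> /eqP->.
- by move=> j l /Hc; apply: adj_rows_sub.
- move=> j; rewrite eb; case: ifP => // /eqP ne /Hg H y i /orP[|/eqP->].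
    exact: H.
  by rewrite ex => eij /eqP ik; case: ne; rewrite -eij ik.
- move=> j eps Se bal.
  have ne : comp j <> comp k.
    move=> ejk; case: (bal x k); rewrite /add_row ?eqxx ?orbT // => l [].
    by rewrite ex => /negP.
  rewrite eb; case: eqP => // _; apply: Hu => // y i Ey; apply: bal.
  by rewrite /add_row Ey.
Qed.

Section Row2.
Variables (E : pred 'I_n) (x : 'I_n) (k l : 'I_p).
Variables (comp bad tch : nat -> nat) (sgn : nat -> R).
Hypotheses (xk : B x k != 0) (xl : B x l != 0) (kl : k != l).
Hypothesis xkl : forall j, B x j != 0 -> j = k \/ j = l.
Hypothesis lab : labelling E comp bad tch sgn.

Let ex j : (B x j != 0) = (j == k) || (j == l).
Proof.
by apply/idP/orP => [/xkl[->|->]|[/eqP->|/eqP->] //]; rewrite eqxx; [left|right].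
Qed.

(** The row closes a cycle. The signs on the component are already forced up to a global factor, so
    either [sgn] balances the new row or nothing does. *)
Lemma labelling_row2_same (bad' tch' : nat -> nat) :
  comp k = comp l ->
  (forall j : 'I_p, bad' (comp j) =
     if (comp j == comp k) && (B x k * sgn k + B x l * sgn l != 0) then 1%N
     else bad (comp j)) ->
  (forall j : 'I_p, tch' j = if (j == k) || (j == l) then 1%N else tch j) ->
  labelling (add_row E x) comp bad' tch' sgn.
Proof.
case: lab => Hlt Hid Hsg Ht Hs1 Ha Hc Hg Hu ekl eb et.
split=> //.
- by move=> j; rewrite et (tch_add_row _ (Ht j)) ex.
- by move=> j; rewrite et; case: ifP => // _ /Hs1.
- move=> y i j /orP[Ey|/eqP->]; first exact: Ha.
  by rewrite !ex => /orP[/eqP->|/eqP->] /orP[/eqP->|/eqP->].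
- by move=> i j /Hc; apply: adj_rows_sub.
- move=> j; rewrite eb; case: ifP => // ne b0 y i /orP[|/eqP->].
    exact: Hg.
  move=> eij; rewrite ex => ikl.
  have ejk : comp j = comp k by case/orP: ikl eij => /eqP-> <-.
  move: ne; rewrite ejk eqxx /= => /negbFE/eqP bal.
  case/orP: ikl => /eqP->; [exists l|exists k]; split => //.
  + by rewrite eq_sym.
  + by rewrite addrC.
- move=> j eps Se bal.
  have bal' : balanced E comp j eps.
    by move=> y i Ey; apply: bal; rewrite /add_row Ey.
  case: (Hu _ _ Se bal') => b0 un; split=> //.
  rewrite eb b0; case: ifP => // /andP[/eqP ejk /negP[]].
  case: (bal x k); rewrite /add_row ?eqxx ?orbT // => i [ik].
  rewrite ex (negbTE ik) /= => /eqP-> balx.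
  have e1 := un k (esym ejk); have e2 := un l (etrans (esym ekl) (esym ejk)).
  (* On this component [sgn] is [eps] times the constant [eps j * sgn j], so the balance of the row
     passes from [eps] to [sgn], against the test that set the flag. *)
  have H (i' : 'I_p) : eps i' * sgn i' = eps j * sgn j ->
      sgn i' = (eps j * sgn j) * eps i'.
    by move=> <-; rewrite mulrAC (is_sign_sqr (Se i')) mul1r.
  rewrite (H k e1) (H l e2) ![_ * (_ * sgn j * _)]mulrCA -mulrDr balx mulr0.
  by [].
Qed.

(** Flipping the whole component of [l] by one factor keeps its old rows balanced. Since entries and
    signs are their own inverses, the factor that also balances the new row must be
    [- (B x k * sgn k * B x l * sgn l)]. Adding the flags makes the union bad as soon as one part
    is. *)
Lemma labelling_row2_diff (comp' bad' tch' : nat -> nat) (sgn' : nat -> R) :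
  comp k <> comp l ->
  (forall j : 'I_p, comp' j = if comp j == comp l then comp k else comp j) ->
  (forall j : 'I_p, bad' (comp j) =
     if comp j == comp k then (bad (comp k) + bad (comp l))%N
     else bad (comp j)) ->
  (forall j : 'I_p, tch' j = if (j == k) || (j == l) then 1%N else tch j) ->
  (forall j : 'I_p, sgn' j = if comp j == comp l then
       sgn j * - (B x k * sgn k * B x l * sgn l) else sgn j) ->
  labelling (add_row E x) comp' bad' tch' sgn'.
Proof.
case: lab => Hlt Hid Hsg Ht Hs1 Ha Hc Hg Hu nkl ec eb et es.
have ckl : connect (adj_rows (add_row E x)) k l.
  apply: connect1; apply/existsP; exists x.
  by rewrite /add_row eqxx orbT xk xl.
have eck : comp' k = comp k by rewrite ec; case: eqP.
have ecl : comp' l = comp k by rewrite ec eqxx.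
set sig := - _ in es.
have Bk : is_sign (B x k) by apply: B_sign.
have Bl : is_sign (B x l) by apply: B_sign.
have Ssig : is_sign sig by apply: is_signN; do !apply: is_signM.
have sub y : E y -> add_row E x y by rewrite /add_row => ->.
have bal_old (j i : 'I_p) eps : comp' j = comp' i -> balanced (add_row E x) comp' i eps ->
    balanced E comp j eps.
  move=> eji bal y i' Ey eij; apply: bal; first exact: sub.
  by rewrite -eji !ec eij.
have balx (i : 'I_p) eps : comp' i = comp k -> balanced (add_row E x) comp' i eps ->
    B x k * eps k + B x l * eps l = 0.
  move=> ei bal; case: (bal x k); rewrite /add_row ?eqxx ?orbT //.
    by rewrite eck.
  by move=> j [jk]; rewrite ex (negbTE jk) /= => /eqP->.
have balsgn : B x k * sgn' k + B x l * sgn' l = 0.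
  rewrite !es eqxx; case: eqP => // _; rewrite /sig.
  rewrite [sgn l * - _]mulrN [_ * - _]mulrN [sgn l * _]mulrCA.
  rewrite (is_sign_sqr (Hsg l)) mulr1 [B x l * _]mulrCA.
  by rewrite (is_sign_sqr Bl) mulr1 subrr.
split.
- by move=> j; rewrite ec; case: ifP.
- move=> j; rewrite [comp' j]ec; case: ifP => jl.
    by rewrite -[comp k]/(nat_of_ord (Ordinal (Hlt k))) ec /= !Hid; case: eqP.
  by rewrite -[comp j]/(nat_of_ord (Ordinal (Hlt j))) ec /= !Hid jl.
- by move=> j; rewrite es; case: ifP => // _; apply: is_signM.
- by move=> j; rewrite et (tch_add_row _ (Ht j)) ex.
- move=> j; rewrite et es; case: ifP => // /norP[jk jl] t0.
  (* A column other than [l] in the flipped component is joined to [l] by a path, hence already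
     touched; [l] itself is touched by the new row. *)
  case: eqP => [ejl|_]; last exact: Hs1.
  suff : j == l by rewrite (negbTE jl).
  move/connectP: (Hc _ _ ejl) => [[|i s] /=]; first by move=> _ ->.
  case/andP=> /existsP[y /and3P[Ey yj _]] _ _.
  move: t0; rewrite Ht; case: existsP => // -[]; by exists y; rewrite Ey.
- move=> y i j /orP[Ey|/eqP->] Hi Hj.
    by rewrite !ec (Ha y i j).
  move: Hi Hj; rewrite !ex => /orP[/eqP->|/eqP->] /orP[/eqP->|/eqP->] //;
    by rewrite eck ecl.
- have H (i : 'I_p) : comp i = comp l -> connect (adj_rows (add_row E x)) k i.
    by move=> e; apply: connect_trans ckl _; apply: adj_rows_sub; apply: Hc.
  have H' (i : 'I_p) : comp k = comp i -> connect (adj_rows (add_row E x)) k i.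
    by move=> e; apply: adj_rows_sub; apply: Hc.
  move=> i j; rewrite !ec; case: eqP => [ei|_]; case: eqP => [ej|_] e.
  + apply: (@connect_trans _ _ k); last exact: H.
    by rewrite adj_rows_sym; apply: H.
  + apply: (@connect_trans _ _ k); last exact: H'.
    by rewrite adj_rows_sym; apply: H.
  + apply: (@connect_trans _ _ k); last exact: H.
    by rewrite adj_rows_sym; apply: H'.
  + by apply: adj_rows_sub; apply: Hc.
- move=> j.
  have gen (i : 'I_p) : bad (comp i) = 0%N -> balanced E comp i sgn'.
    move=> b0 y i' Ey eii yi'.
    have [j' [jn yj' bal]] := Hg i b0 y i' Ey eii yi'.
    exists j'; split=> //; rewrite !es -(Ha y i' j') //.
    by case: ifP => // _; rewrite !mulrA -mulrDl bal mul0r.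
  rewrite [comp' j]ec => b0 y i Hy; rewrite !ec => eij yi.
  have hb : bad (comp i) = 0%N.
    move: eij b0; case: eqP => [eil|nil]; case: eqP => [ejl|njl].
    + by rewrite eil eb eqxx => _ /eqP; rewrite addn_eq0 => /andP[_ /eqP].
    + by rewrite eil => <-; rewrite eb eqxx => /eqP;
        rewrite addn_eq0 => /andP[_ /eqP].
    + move=> ->; rewrite eb eqxx => /eqP.
      by rewrite addn_eq0 => /andP[/eqP].
    + move=> ->; rewrite eb; case: eqP => // -> /eqP.
      by rewrite addn_eq0 => /andP[/eqP].
  case/orP: Hy => [Ey|/eqP eyx]; first exact: (gen i).
  move: yi; rewrite eyx ex => /orP[/eqP->|/eqP->].
    by exists l; rewrite eq_sym.
  by exists k; split => //; rewrite addrC.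
- move=> j eps Se bal; rewrite [in bad' _]ec.
  case: (boolP (comp' j == comp k)) => [/eqP ejk|njk].
  + have [b1 u1] := Hu k eps Se (bal_old k j eps (etrans eck (esym ejk)) bal).
    have [b2 u2] := Hu l eps Se (bal_old l j eps (etrans ecl (esym ejk)) bal).
    have -> : bad' (if comp j == comp l then comp k else comp j) = 0%N.
      rewrite -ec ejk eb eqxx b1 b2 //.
    split=> //.
    have {}balx := balx j eps ejk bal.
    (* A balancing [eps] agrees with the old signs on each part up to one factor per part. The new
       row relates these two factors by exactly the flip [sig], so a single factor remains. *)
    have H (i : 'I_p) : comp' i = comp k -> eps i * sgn' i = eps k * sgn k.
      rewrite ec es; case: eqP => [eil _|nil eik]; last exact: u1.
      rewrite mulrA (u2 i eil) /sig.
      move/eqP: balx; rewrite addrC addr_eq0 => /eqP balx.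
      transitivity (- (B x l * eps l) * B x k * sgn k * (sgn l * sgn l)).
        by ring.
      rewrite balx (is_sign_sqr (Hsg l)) opprK.
      transitivity (B x k * B x k * (eps k * sgn k)); first by ring.
      by rewrite (is_sign_sqr Bk) mul1r.
    by move=> i e; rewrite !H // e.
  + have [b1 u1] := Hu j eps Se (bal_old j j eps erefl bal).
    move: njk; rewrite ec.
    case: (comp j =P comp l) => [|njl njk]; first by rewrite eqxx.
    rewrite eb (negbTE njk); split=> // i; rewrite !ec !es.
    rewrite [comp j == comp l](introF eqP njl).
    case: (comp i == comp l) => [ejk|eij]; last exact: u1.
    by rewrite -ejk eqxx in njk.
Qed.
End Row2.
End Labelling.

Lemma map_val_enum_ord p (P : pred nat) :
  map val (enum [set k : 'I_p | P k]) = [seq k <- iota 0 p | P k].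
Proof.
rewrite -val_enum_ord filter_map; congr map.
by rewrite {1}/enum_mem -enumT; apply: eq_filter => k; exact: in_set.
Qed.

(** The block structure of [pers_boundary] forces C_0 to come first, in the increasing order of
    [enum_val]. Regulable components are represented by their roots. *)
Definition result_order (p : nat) (comp bad tch : nat -> nat) : seq nat :=
  [seq k <- iota 0 p | tch k == 0%N] ++
  [seq k <- iota 0 p | [&& tch k != 0%N, comp k == k & bad k == 0%N]].

(** * Zero columns in a labelling *)

Section Untouched.
Variables (R : rcfType) (n p : nat) (B : 'M[R]_(n, p)) (E : pred 'I_n).
Variables (comp bad tch : nat -> nat) (sgn : nat -> R).
Hypothesis lab : labelling B E comp bad tch sgn.
Implicit Types (x : 'I_n) (j k l : 'I_p).

(** A path leaving [k] would begin with a row of [E] that is non-zero at [k]. *)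
Lemma lab_untouched k j : tch k = 0%N -> comp j = comp k -> j = k.
Proof.
move=> t0 /esym /(lab_conn lab)/connectP[[|i s] /=]; first by move=> _ ->.
case/andP=> /existsP[y /and3P[Ey yk _]] _ _.
move: t0; rewrite (lab_tch lab); case: existsP => // -[].
by exists y; rewrite Ey.
Qed.

Lemma lab_untouched_comp k : tch k = 0%N -> comp k = k.
Proof.
move=> t0; have /(congr1 val) /= := @lab_untouched k (Ordinal (lab_lt lab k)) t0 (lab_idem lab k).
by [].
Qed.

(** Constant signs balance an untouched column vacuously, and by [lab_uniq] the existence of any
    balancing choice clears the flag. *)
Lemma lab_untouched_bad k : tch k = 0%N -> bad k = 0%N.
Proof.
move=> t0; rewrite -(lab_untouched_comp t0).
have [//||//] := @lab_uniq _ _ _ _ _ _ _ _ _ lab k (fun => 1); first by left.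
move=> x j Ex /(lab_untouched t0) -> xk.
move: t0; rewrite (lab_tch lab); case: existsP => // -[].
by exists x; rewrite Ex.
Qed.

Lemma lab_touched k j : comp j = comp k -> (tch j == 0%N) = (tch k == 0%N).
Proof.
move=> e; apply/eqP/eqP => t0.
  by rewrite (lab_untouched t0 (esym e)).
by rewrite (lab_untouched t0 e).
Qed.

Local Notation ord := (result_order p comp bad tch).

Lemma mem_result_order i :
  (i \in ord) = [&& (i < p)%N, comp i == i & bad i == 0%N].
Proof.
rewrite mem_cat !mem_filter mem_iota add0n /=.
case: ltnP => ip; rewrite ?andbF //= !andbT.
case: eqP => //= t0.
by rewrite (lab_untouched_comp (k := Ordinal ip) t0) (lab_untouched_bad (k := Ordinal ip) t0) !eqxx.
Qed.

Lemma uniq_result_order : uniq ord.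
Proof.
rewrite cat_uniq !filter_uniq ?iota_uniq // andbT /=.
by apply/hasPn => k; rewrite !mem_filter => /andP[/and3P[/negbTE-> _ _] _].
Qed.

End Untouched.

(** * The persistent pair read off a labelling *)

Section Result.
Variables (R : rcfType) (n p : nat) (B : 'M[R]_(n, p)) (I : seq 'I_n).
Hypothesis B_sign : forall x k, B x k != 0 -> is_sign (B x k).
Hypothesis B_row : forall x, (#|[set k | B x k != 0%R]| <= 2)%N.
Variables (comp bad tch : nat -> nat) (sgn : nat -> R).
Let E : pred 'I_n := fun x => x \notin I.
Hypothesis lab : labelling B E comp bad tch sgn.
Implicit Types (x : 'I_n) (j k l : 'I_p).

Local Notation ord := (result_order p comp bad tch).

Lemma zero_colsE : zero_cols B I = [set k : 'I_p | tch k == 0%N].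
Proof.
apply/setP => k; rewrite !inE (lab_tch lab) eqb0 negb_exists.
by apply: eq_forallb => x; rewrite negb_and negbK -implybE.
Qed.

Lemma zero_col_untouched k : k \in zero_cols B I -> tch k = 0%N.
Proof. by rewrite zero_colsE inE => /eqP. Qed.

Lemma card_zero_cols :
  #|zero_cols B I| = size [seq k <- iota 0 p | tch k == 0%N].
Proof.
by rewrite zero_colsE -(map_val_enum_ord p (fun k : nat => tch k == 0%N)) size_map cardE.
Qed.

Definition comp_class (i : nat) : {set 'I_p} := [set l : 'I_p | comp l == i].

Lemma connect_comp k l : connect (col_adj B I) k l = (comp k == comp l).
Proof.
apply/idP/eqP => [|e]; last exact: (lab_conn lab).
move=> /connectP[s ps ->]; elim: s k ps => //= i s IH k /andP[ki /IH <-].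
by case/existsP: ki => x /and3P[Ex xk xi]; apply: (lab_adj lab Ex).
Qed.

Lemma componentsE :
  components B I = [set comp_class (comp k) | k : 'I_p in ~: zero_cols B I].
Proof.
apply: eq_in_imset => k; rewrite zero_colsE in_setC inE => nz.
apply/setP => l; rewrite !inE connect_comp andbC [comp k == _]eq_sym; case: eqP => // e.
by rewrite (lab_touched lab e) nz.
Qed.

Lemma sign_exp k : (-1) ^+ (sgn k == -1) = sgn k :> R.
Proof.
case: (lab_sgn lab k) => ->; rewrite ?eqxx ?expr1 //.
by case: eqP => [|_]; [lra|rewrite expr0].
Qed.

Lemma row_other x k l j : k != l -> B x k != 0 -> B x l != 0 -> B x j != 0 ->
  j = k \/ j = l.
Proof.
move=> kl xk xl xj; case: (eqVneq j k) => [|jk]; first by left.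
case: (eqVneq j l) => [|jl]; first by right.
suff /subset_leq_card/leq_trans/(_ (B_row x)) :
    j |: [set k; l] \subset [set i | B x i != 0].
  by rewrite cardsU1 cards2 !inE kl (negbTE jk) (negbTE jl).
by apply/subsetP => i; rewrite !inE => /or3P[] /eqP->.
Qed.

Let sign_neq : (1 == -1 :> R) = false.
Proof. by apply/eqP; lra. Qed.

Definition lab_eps : {ffun 'I_p -> bool} := [ffun k => sgn (nat_of_ord k) == -1].

(** In a balanced row the two products of entry and sign are signs with sum zero, hence 1 and -1 in
    some order; [B_row] leaves room for no third entry. *)
Lemma lab_sign_choice k : bad (comp k) = 0%N ->
  sign_choice B I (comp_class (comp k)) lab_eps /\
  regulable B I (comp_class (comp k)).
Proof.
move=> b0.
have two x : nonzero_row B I (comp_class (comp k)) x ->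
  exists j l, [/\ j != l, comp j = comp k, comp l = comp k &
    [/\ B x j != 0, B x l != 0, B x j * sgn j = 1 & B x l * sgn l = -1]].
  case/andP => xI /existsP[j]; rewrite inE => /andP[/eqP ej xj].
  have [l [lj xl bal]] := lab_good lab b0 xI ej xj.
  have el : comp l = comp k by rewrite -ej; apply: (lab_adj lab xI).
  case: (is_signM (B_sign xj) (lab_sgn lab j)) => e; rewrite e in bal.
    have {}bal : B x l * sgn l = -1 by apply/eqP; rewrite -addr_eq0 addrC bal.
    by exists j, l; split=> //; rewrite eq_sym.
  have {}bal : B x l * sgn l = 1 by apply/eqP; rewrite -subr_eq0 addrC bal.
  by exists l, j.
have sc : sign_choice B I (comp_class (comp k)) lab_eps.
  apply/forallP=> x; apply/implyP => /two[j [l [jl ej el [xj xl sj sl]]]].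
  apply/andP; split; apply/cards1P; [exists j|exists l];
    apply/setP => i; rewrite !inE ffunE sign_exp.
    apply/idP/eqP => [/andP[ei xi]|->]; last by rewrite sj ej !eqxx.
    have xi0 : B x i != 0.
      by apply: contraTneq xi => ->; rewrite mul0r eq_sym oner_eq0.
    case: (row_other jl xj xl xi0) => // eil; move: xi.
    by rewrite eil sl eq_sym sign_neq.
  apply/idP/eqP => [/andP[ei xi]|->]; last by rewrite sl el !eqxx.
  have xi0 : B x i != 0.
    by apply: contraTneq xi => ->; rewrite mul0r eq_sym oppr_eq0 oner_eq0.
  case: (row_other jl xj xl xi0) => // eil; move: xi.
  by rewrite eil sj sign_neq.
split=> //; apply/andP; split; last by apply/existsP; exists lab_eps.
apply/forallP=> x; apply/implyP => /two[j [l [jl ej el [xj xl sj sl]]]].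
rewrite (_ : [set i in _ | _] = [set j; l]) ?cards2 ?jl //.
apply/setP=> i; rewrite !inE; apply/andP/orP => [[_ xi]|].
  by case: (row_other jl xj xl xi) => ->; rewrite eqxx; [left|right].
by case=> /eqP->; rewrite ?ej ?el.
Qed.

(** Here [lab_uniq] is indispensable: the signs that make the component regulable are arbitrary and
    need not be the stored ones, yet they must clear the flag. *)
Lemma regulable_good k : regulable B I (comp_class (comp k)) -> bad (comp k) = 0%N.
Proof.
case/andP=> _ /existsP[eps /forallP sc].
(* Boolean signs on columns are turned into real signs on [nat]; 1 is a default outside the range of
   columns. *)
pose e (i : nat) : R := if insub i is Some k' then (-1) ^+ eps k' else 1.
have ee j : e j = (-1) ^+ eps j by rewrite /e valK.
have Se (j : 'I_p) : is_sign (e j).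
  by rewrite ee; case: (eps j); rewrite ?expr1; [right|left].
have [] // := lab_uniq lab Se (k := k).
move=> x j Ex ej xj.
have nz : nonzero_row B I (comp_class (comp k)) x.
  by apply/andP; split=> //; apply/existsP; exists j; rewrite inE ej eqxx.
move: (implyP (sc x) nz) => /andP[/cards1P[j1 s1] /cards1P[j2 s2]].
have m1 : j1 \in [set j1] by rewrite inE.
have m2 : j2 \in [set j2] by rewrite inE.
move: m1 m2; rewrite -{1}s1 -{1}s2 !inE -!ee.
move=> /andP[c1 /eqP v1] /andP[c2 /eqP v2].
have n1 : B x j1 != 0 by apply/eqP=> e0; move: v1; rewrite e0; lra.
have n2 : B x j2 != 0 by apply/eqP=> e0; move: v2; rewrite e0; lra.
have j12 : j1 != j2 by apply/eqP => e12; move: v1; rewrite e12; lra.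
case: (row_other j12 n1 n2 xj) => ->; [exists j2|exists j1].
  by rewrite eq_sym; split=> //; lra.
by split=> //; lra.
Qed.

Let rep_pred (k : nat) := [&& tch k != 0%N, comp k == k & bad k == 0%N].

Lemma reg_componentsE :
  reg_components B I = [set comp_class k | k : 'I_p in [set k : 'I_p | rep_pred k]].
Proof.
apply/setP => C; rewrite inE; apply/andP/imsetP.
  rewrite componentsE => -[/imsetP[k]].
  rewrite zero_colsE !inE => nz -> /regulable_good b0.
  exists (Ordinal (lab_lt lab k)) => //=.
  rewrite inE /rep_pred /= (lab_idem lab) b0 !eqxx !andbT.
  by rewrite (@lab_touched _ _ _ _ _ _ _ _ _ lab k (Ordinal (lab_lt lab k))) //= (lab_idem lab).
case=> k; rewrite inE => /and3P[nz /eqP ek /eqP b0] ->.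
rewrite -ek in b0; have [_ rg] := lab_sign_choice b0.
rewrite -ek; split=> //; rewrite componentsE; apply/imsetP; exists k => //.
by rewrite zero_colsE !inE.
Qed.

Lemma card_reg_components :
  #|reg_components B I| = size [seq k <- iota 0 p | rep_pred k].
Proof.
rewrite reg_componentsE card_in_imset.
  by rewrite -map_val_enum_ord size_map cardE.
move=> k l; rewrite !inE => /and3P[_ /eqP ek _] /and3P[_ /eqP el _] /setP/(_ k).
by rewrite !inE ek eqxx => /esym/eqP e; apply: val_inj.
Qed.

Lemma size_result_order :
  size ord = (#|zero_cols B I| + #|reg_components B I|)%N.
Proof. by rewrite size_cat card_zero_cols card_reg_components. Qed.

Definition result_Cs (j : 'I_#|reg_components B I|) : {set 'I_p} :=
  comp_class (nth 0%N ord (#|zero_cols B I| + j)).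

Lemma nth_result_order_rep (j : 'I_#|reg_components B I|) :
  exists k : 'I_p, rep_pred k /\ nth 0%N ord (#|zero_cols B I| + j) = k.
Proof.
rewrite /result_order nth_cat -card_zero_cols ltnNge leq_addr addKn /=.
have jl : (j < size [seq k <- iota 0 p | rep_pred k])%N.
  by rewrite -card_reg_components.
have := mem_nth 0%N jl; rewrite mem_filter mem_iota => /andP[h /andP[_ lt]].
by exists (Ordinal lt).
Qed.

Lemma result_is_choice : is_choice result_Cs (fun => lab_eps).
Proof.
split.
- move=> j j'; rewrite /result_Cs.
  have lt i : (i < #|reg_components B I| -> #|zero_cols B I| + i < size ord)%N.
    by rewrite size_result_order ltn_add2l.
  have [k [/and3P[_ /eqP ek _] e1]] := nth_result_order_rep j.
  have [k' [/and3P[_ /eqP ek' _] e2]] := nth_result_order_rep j'.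
  rewrite e1 e2 => /setP/(_ k); rewrite !inE ek eqxx => /esym/eqP.
  rewrite -e1 -e2 => /eqP.
  rewrite nth_uniq ?uniq_result_order ?lt // eqn_add2l => /eqP.
  exact: val_inj.
- move=> j; rewrite /result_Cs; have [k [h ->]] := nth_result_order_rep j.
  by rewrite reg_componentsE; apply: imset_f; rewrite inE.
- move=> j; rewrite /result_Cs.
  have [k [/and3P[_ /eqP ek /eqP b] ->]] := nth_result_order_rep j.
  by rewrite -ek; apply: (proj1 (lab_sign_choice _)); rewrite ek.
Qed.

Lemma nth_result_order_zero (j : 'I_#|zero_cols B I|) :
  nth 0%N ord j = enum_val j :> nat.
Proof.
rewrite /result_order nth_cat -card_zero_cols ltn_ord -map_val_enum_ord.
rewrite -zero_colsE (nth_map (enum_val j)) -?cardE //.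
by rewrite -enum_val_nth.
Qed.

Lemma comp_eq_zero_col (j : 'I_#|zero_cols B I|) k :
  (comp k == nth 0%N ord j) = (k == enum_val j).
Proof.
have t0 := zero_col_untouched (enum_valP j).
rewrite nth_result_order_zero -(lab_untouched_comp lab t0).
by apply/eqP/eqP => [|->//]; apply: lab_untouched lab _ _ _.
Qed.

(** Both blocks obey one formula because the class of a column of C_0 is that column alone, with
    sign 1. *)
Lemma pers_boundary_result a (j : 'I_(#|zero_cols B I| + #|reg_components B I|)) :
  pers_boundary result_Cs (fun => lab_eps) a j =
  \sum_(k < p | comp k == nth 0%N ord j) B (tnth (in_tuple I) a) k * sgn k.
Proof.
rewrite /pers_boundary mxE; case: (split_ordP j) => j' -> /=; rewrite mxE.
  rewrite (eq_bigl (pred1 (enum_val j'))) => [|k]; last exact: comp_eq_zero_col.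
  rewrite big_pred1_eq (lab_sgn1 lab) ?mulr1 //.
  exact: zero_col_untouched (enum_valP j').
apply: eq_big => [k|k _]; first by rewrite inE.
by rewrite ffunE sign_exp.
Qed.

(** For a column of C_0 the sum has one term, and the double inverse gives back its weight. *)
Lemma pers_weights_result (w : 'rV[R]_p) (j : 'I_(#|zero_cols B I| + #|reg_components B I|)) :
  pers_weights w result_Cs 0 j =
  (\sum_(k < p | comp k == nth 0%N ord j) (w 0 k)^-1)^-1.
Proof.
rewrite /pers_weights mxE; case: (split_ordP j) => j' -> /=; rewrite mxE.
  rewrite (eq_bigl (pred1 (enum_val j'))) => [|k]; last exact: comp_eq_zero_col.
  by rewrite big_pred1_eq invrK.
by congr (_ ^-1); apply: eq_bigl => k; rewrite inE.
Qed.

End Result.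

(** * A program logic with running times *)

(* The tags 0, 1, 2, 3 stand for index variables, real variables, index arrays
   and real arrays. *)
Fixpoint writes (c : cmd) : seq (nat * nat) :=
  match c with
  | Skip => [::]
  | ISet x _ => [:: (0, x)]
  | RSet x _ => [:: (1, x)]
  | IPut a _ _ => [:: (2, a)]
  | RPut a _ _ => [:: (3, a)]
  | Seq c1 c2 => writes c1 ++ writes c2
  | If _ c1 c2 => writes c1 ++ writes c2
  | While _ c1 => writes c1
  end%N.

(** A syntactic bound for loop-free code. Adding the two branches of a conditional, instead of
    taking their maximum, changes constants only. *)
Fixpoint max_cost (c : cmd) : nat :=
  match c with
  | Skip => 1
  | ISet _ e => (icost e).+1
  | RSet _ e => (rcost e).+1
  | IPut _ e1 e2 => (icost e1 + icost e2).+1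
  | RPut _ e1 e2 => (icost e1 + rcost e2).+1
  | Seq c1 c2 => max_cost c1 + max_cost c2
  | If b c1 c2 => (bcost b + (max_cost c1 + max_cost c2)).+1
  | While _ _ => 0
  end%N.

Definition ilt (e1 e2 : iexp) : bexp := ILe (IAdd e1 (IConst 1)) e2.

Definition incr (x : nat) : cmd := ISet x (IAdd (IVar x) (IConst 1)).

Definition for_loop (x y : nat) (c : cmd) : cmd :=
  Seq (ISet x (IConst 0)) (While (ilt (IVar x) (IVar y)) (Seq c (incr x))).

Section Logic.
Variable R : rcfType.
Local Notation state := (state R).
Implicit Types (s : state) (c : cmd) (P Q : state -> Prop).

Definition run c s (T : nat) Q : Prop :=
  exists s' t, [/\ exec c s s' t, (t <= T)%N & Q s'].

Definition set_ivar s x v : state :=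
  State (upd (ivar s) x v) (rvar s) (iarr s) (rarr s).

Definition set_rvar s x v : state :=
  State (ivar s) (upd (rvar s) x v) (iarr s) (rarr s).

Definition put_iarr s a i v : state :=
  State (ivar s) (rvar s) (upd2 (iarr s) a i v) (rarr s).

Definition put_rarr s a i v : state :=
  State (ivar s) (rvar s) (iarr s) (upd2 (rarr s) a i v).

(** Being false on [While] confines [wp] to loop-free code, where [max_cost] bounds the time
    ([run_wp]). Loops go through [run_while] and [run_for]. *)
Fixpoint wp c Q s : Prop :=
  match c with
  | Skip => Q s
  | ISet x e => Q (set_ivar s x (ieval s e))
  | RSet x e => Q (set_rvar s x (reval s e))
  | IPut a e1 e2 => Q (put_iarr s a (ieval s e1) (ieval s e2))
  | RPut a e1 e2 => Q (put_rarr s a (ieval s e1) (reval s e2))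
  | Seq c1 c2 => wp c1 (wp c2 Q) s
  | If b c1 c2 => if beval s b then wp c1 Q s else wp c2 Q s
  | While _ _ => False
  end.

Lemma wp_skip Q s : wp Skip Q s = Q s. Proof. by []. Qed.

Lemma wp_iset x e Q s : wp (ISet x e) Q s = Q (set_ivar s x (ieval s e)).
Proof. by []. Qed.

Lemma wp_rset x e Q s : wp (RSet x e) Q s = Q (set_rvar s x (reval s e)).
Proof. by []. Qed.

Lemma wp_iput a e1 e2 Q s :
  wp (IPut a e1 e2) Q s = Q (put_iarr s a (ieval s e1) (ieval s e2)).
Proof. by []. Qed.

Lemma wp_rput a e1 e2 Q s :
  wp (RPut a e1 e2) Q s = Q (put_rarr s a (ieval s e1) (reval s e2)).
Proof. by []. Qed.

Lemma wp_seq c1 c2 Q s : wp (Seq c1 c2) Q s = wp c1 (wp c2 Q) s.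
Proof. by []. Qed.

Lemma wp_if b c1 c2 Q s :
  wp (If b c1 c2) Q s = if beval s b then wp c1 Q s else wp c2 Q s.
Proof. by []. Qed.

Lemma read_set_ivar s x v :
  ((forall y, ivar (set_ivar s x v) y = if y == x then v else ivar s y) *
   (forall y, rvar (set_ivar s x v) y = rvar s y) *
   (forall a, iarr (set_ivar s x v) a = iarr s a) *
   (forall a, rarr (set_ivar s x v) a = rarr s a))%type.
Proof. by []. Qed.

Lemma read_set_rvar s x v :
  ((forall y, ivar (set_rvar s x v) y = ivar s y) *
   (forall y, rvar (set_rvar s x v) y = if y == x then v else rvar s y) *
   (forall a, iarr (set_rvar s x v) a = iarr s a) *
   (forall a, rarr (set_rvar s x v) a = rarr s a))%type.
Proof. by []. Qed.

Lemma read_put_iarr s a i v :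
  ((forall y, ivar (put_iarr s a i v) y = ivar s y) *
   (forall y, rvar (put_iarr s a i v) y = rvar s y) *
   (forall b, iarr (put_iarr s a i v) b =
      if b == a then upd (iarr s a) i v else iarr s b) *
   (forall b, rarr (put_iarr s a i v) b = rarr s b))%type.
Proof. by []. Qed.

Lemma read_put_rarr s a i v :
  ((forall y, ivar (put_rarr s a i v) y = ivar s y) *
   (forall y, rvar (put_rarr s a i v) y = rvar s y) *
   (forall b, iarr (put_rarr s a i v) b = iarr s b) *
   (forall b, rarr (put_rarr s a i v) b =
      if b == a then upd (rarr s a) i v else rarr s b))%type.
Proof. by []. Qed.

Definition read_write := (read_set_ivar, read_set_rvar, read_put_iarr, read_put_rarr).

(** The frame condition is derived from the syntax of the program ([exec_same]), so invariants need
    only mention the cells that a loop changes. *)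
Definition same_outside c s s' : Prop :=
  [/\ forall x, (0%N, x) \notin writes c -> ivar s' x = ivar s x,
      forall x, (1%N, x) \notin writes c -> rvar s' x = rvar s x,
      forall a, (2%N, a) \notin writes c -> iarr s' a = iarr s a
    & forall a, (3%N, a) \notin writes c -> rarr s' a = rarr s a].

(** For a concrete program the side condition is a closed boolean, settled by evaluation. *)
Lemma same_ivar c s s' x : same_outside c s s' ->
  ((0%N, x) \notin writes c) = true -> ivar s' x = ivar s x.
Proof. by case=> H _ _ _ /H. Qed.

Lemma same_rvar c s s' x : same_outside c s s' ->
  ((1%N, x) \notin writes c) = true -> rvar s' x = rvar s x.
Proof. by case=> _ H _ _ /H. Qed.

Lemma same_iarr c s s' a : same_outside c s s' ->
  ((2%N, a) \notin writes c) = true -> iarr s' a = iarr s a.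
Proof. by case=> _ _ H _ /H. Qed.

Lemma same_rarr c s s' a : same_outside c s s' ->
  ((3%N, a) \notin writes c) = true -> rarr s' a = rarr s a.
Proof. by case=> _ _ _ H /H. Qed.

Lemma same_trans c s1 s2 s3 :
  same_outside c s1 s2 -> same_outside c s2 s3 -> same_outside c s1 s3.
Proof.
by move=> [a1 a2 a3 a4] [b1 b2 b3 b4]; split=> x h;
  rewrite ?b1 ?a1 ?b2 ?a2 ?b3 ?a3 ?b4 ?a4.
Qed.

Lemma same_sub c c' s s' : {subset writes c <= writes c'} ->
  same_outside c s s' -> same_outside c' s s'.
Proof.
move=> sub [a1 a2 a3 a4]; split=> x h;
  by [apply: a1; apply: contra h; apply: sub
     |apply: a2; apply: contra h; apply: sub
     |apply: a3; apply: contra h; apply: sub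
     |apply: a4; apply: contra h; apply: sub].
Qed.

Lemma upd_neq (T : Type) (f : nat -> T) x v y : y != x -> upd f x v y = f y.
Proof. by rewrite /upd => /negbTE->. Qed.

Lemma upd_eq (T : Type) (f : nat -> T) x v : upd f x v x = v.
Proof. by rewrite /upd eqxx. Qed.

Lemma exec_same c s s' t : exec c s s' t -> same_outside c s s'.
Proof.
elim=> {c s s' t} //.
- by move=> x e s; split=> // y; rewrite inE xpair_eqE /= => h; apply: upd_neq.
- by move=> x e s; split=> // y; rewrite inE xpair_eqE /= => h; apply: upd_neq.
- by move=> a e1 e2 s; split=> // y; rewrite inE xpair_eqE /= => h; apply: upd_neq.
- by move=> a e1 e2 s; split=> // y; rewrite inE xpair_eqE /= => h; apply: upd_neq.
- move=> c1 c2 s s1 s2 t1 t2 _ H1 _ H2; apply: (@same_trans _ _ s1).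
    by apply: same_sub H1 => y; rewrite /= mem_cat => ->.
  by apply: same_sub H2 => y; rewrite /= mem_cat orbC => ->.
- move=> b c1 c2 s s1 t _ _; apply: same_sub => y.
  by rewrite /= mem_cat => ->.
- move=> b c1 c2 s s1 t _ _; apply: same_sub => y.
  by rewrite /= mem_cat orbC => ->.
- move=> b c s s1 s2 t1 t2 _ _ H1 _ H2.
  exact: same_trans H1 H2.
Qed.

Lemma run_same c s T Q :
  run c s T Q -> run c s T (fun s' => Q s' /\ same_outside c s s').
Proof.
move=> [s' [t [ex le q]]]; exists s', t; split=> //; split=> //.
exact: exec_same ex.
Qed.

Lemma run_weaken c s T T' Q Q' :
  run c s T Q -> (T <= T')%N -> (forall s', Q s' -> Q' s') -> run c s T' Q'.
Proof.
move=> [s' [t [ex le q]]] leT sub; exists s', t; split=> //; last exact: sub.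
exact: leq_trans le leT.
Qed.

Lemma wp_sub c Q Q' s : (forall s', Q s' -> Q' s') -> wp c Q s -> wp c Q' s.
Proof.
elim: c Q Q' s => /=; try by move=> *; eauto.
move=> b c1 IH1 c2 IH2 Q Q' s sub.
by case: (beval s b); [apply: IH1|apply: IH2].
Qed.

Lemma wp_same c Q s :
  wp c Q s -> wp c (fun s' => Q s' /\ same_outside c s s') s.
Proof.
have prim c1 Q1 s1 s' t : exec c1 s1 s' t -> Q1 s' -> Q1 s' /\ same_outside c1 s1 s'.
  by move=> /exec_same.
elim: c Q s => //=.
- by move=> x e Q s; apply: prim; apply: exec_iset.
- by move=> x e Q s; apply: prim; apply: exec_rset.
- by move=> a e1 e2 Q s; apply: prim; apply: exec_iput.
- by move=> a e1 e2 Q s; apply: prim; apply: exec_rput.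
- move=> c1 IH1 c2 IH2 Q s /IH1; apply: wp_sub => s1 [/IH2 + sm1].
  apply: wp_sub => s2 [q sm2]; split=> //; apply: (@same_trans _ _ s1).
    by apply: same_sub sm1 => z; rewrite /= mem_cat => ->.
  by apply: same_sub sm2 => z; rewrite /= mem_cat orbC => ->.
move=> b c1 IH1 c2 IH2 Q s; case: (beval s b) => [/IH1|/IH2];
  apply: wp_sub => s1 [q sm]; split=> //; apply: same_sub sm => z;
  by rewrite /= mem_cat => ->; rewrite ?orbT.
Qed.

Lemma run_seq c1 c2 s T1 T2 Q1 Q :
  run c1 s T1 Q1 -> (forall s', Q1 s' -> run c2 s' T2 Q) ->
  run (Seq c1 c2) s (T1 + T2) Q.
Proof.
move=> [s1 [t1 [ex1 le1 q1]]] /(_ s1 q1)[s2 [t2 [ex2 le2 q2]]].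
exists s2, (t1 + t2)%N; split=> //; last exact: leq_add.
exact: exec_seq ex1 ex2.
Qed.

Lemma run_wp c s Q : wp c Q s -> run c s (max_cost c) Q.
Proof.
elim: c s Q => //=.
- by move=> s Q q; exists s, 1%N; split=> //; apply: exec_skip.
- by move=> x e s Q q; do 2!eexists; split; first exact: exec_iset.
- by move=> x e s Q q; do 2!eexists; split; first exact: exec_rset.
- by move=> a e1 e2 s Q q; do 2!eexists; split; first exact: exec_iput.
- by move=> a e1 e2 s Q q; do 2!eexists; split; first exact: exec_rput.
- by move=> c1 IH1 c2 IH2 s Q /IH1 H; apply: run_seq H _ => s' /IH2.
- move=> b c1 IH1 c2 IH2 s Q; case: ifPn => hb.
    move=> /IH1[s' [t [ex le q]]]; exists s', (bcost b + t).+1; split=> //.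
      exact: exec_if_true.
    by rewrite ltnS leq_add2l (leq_trans le) // leq_addr.
  move=> /IH2[s' [t [ex le q]]]; exists s', (bcost b + t).+1; split=> //.
    exact: exec_if_false.
  by rewrite ltnS leq_add2l (leq_trans le) // leq_addl.
Qed.

Lemma run_if b c1 c2 s T Q :
  (beval s b -> run c1 s T Q) -> (~~ beval s b -> run c2 s T Q) ->
  run (If b c1 c2) s (bcost b + T).+1 Q.
Proof.
case: (boolP (beval s b)) => hb H1 H2.
  have [s' [t [ex le q]]] := H1 isT.
  exists s', (bcost b + t).+1; split=> //; first exact: exec_if_true.
  by rewrite ltnS leq_add2l.
have [s' [t [ex le q]]] := H2 isT.
exists s', (bcost b + t).+1; split=> //; first exact: exec_if_false.
by rewrite ltnS leq_add2l.
Qed.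

(** The potential [mu] counts passes, so one potential can pay for a whole traversal. Each pass also
    receives the frame relative to the initial state. *)
Lemma run_while b c (T : nat) (mu : state -> nat) (inv : state -> Prop) s0 :
  inv s0 ->
  (forall s, same_outside c s0 s -> inv s -> beval s b ->
     run c s T (fun s' => inv s' /\ (mu s' < mu s)%N)) ->
  run (While b c) s0 ((bcost b + T).+1 * mu s0 + (bcost b).+1)
    (fun s' => [/\ inv s', ~~ beval s' b & same_outside c s0 s']).
Proof.
move=> inv0 step.
suff gen k s : (mu s < k)%N -> inv s -> same_outside c s0 s ->
    run (While b c) s ((bcost b + T).+1 * mu s + (bcost b).+1)
      (fun s' => [/\ inv s', ~~ beval s' b & same_outside c s0 s']).
  exact: (gen (mu s0).+1).
elim: k s => // k IH s ltk invs sm.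
case: (boolP (beval s b)) => hb; last first.
  exists s, (bcost b).+1; split=> //; first exact: exec_while_false.
  exact: leq_addl.
have [s1 [t1 [ex1 le1 [inv1 dec]]]] := step s sm invs hb.
have sm1 := same_trans sm (exec_same ex1).
have [|s2 [t2 [ex2 le2 q2]]] := IH s1 _ inv1 sm1.
  by apply: leq_trans dec _; rewrite -ltnS.
exists s2, (bcost b + t1 + t2).+1; split=> //.
  exact: exec_while_true ex1 ex2.
move: (mu s) (mu s1) dec le1 le2 => M M1 dec le1 le2.
have : ((bcost b + T).+1 * M1.+1 <= (bcost b + T).+1 * M)%N.
  by rewrite leq_mul2l dec orbT.
lia.
Qed.

Lemma run_loop b c (mu : state -> nat) (inv : state -> Prop) s0 :
  inv s0 ->
  (forall s, same_outside c s0 s -> inv s -> beval s b ->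
     wp c (fun s' => inv s' /\ (mu s' < mu s)%N) s) ->
  run (While b c) s0 ((bcost b + max_cost c).+1 * mu s0 + (bcost b).+1)
    (fun s' => [/\ inv s', ~~ beval s' b & same_outside c s0 s']).
Proof. by move=> inv0 step; apply: run_while inv0 _ => *; apply/run_wp/step. Qed.

(** The invariant for [j] is required of the state whose counter is already [j], which hides the
    increment from the body. The constant 10 is 5 for the test, 4 for the increment and 1 for the
    iteration; the initialisation and the failing test cost 8 and fit into the additional pass. *)
Lemma run_for x y c (inv : nat -> state -> Prop) s0 :
  (0%N, x) \notin writes c -> (0%N, y) \notin writes c -> x != y ->
  inv 0%N (set_ivar s0 x 0%N) ->
  (forall s j, same_outside (for_loop x y c) s0 s -> ivar s x = j ->
     (j < ivar s0 y)%N -> inv j s ->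
     wp c (fun s' => inv j.+1 (set_ivar s' x j.+1)) s) ->
  run (for_loop x y c) s0 ((max_cost c + 10) * (ivar s0 y).+1)
    (fun s' => inv (ivar s0 y) s' /\ same_outside (for_loop x y c) s0 s').
Proof.
move=> xc yc xy inv0 step; apply: run_same; set N := ivar s0 y.
pose s1 := set_ivar s0 x 0%N.
pose I s := [/\ inv (ivar s x) s, ivar s y = N, (ivar s x <= N)%N
              & same_outside (for_loop x y c) s0 s].
have sm01 : same_outside (for_loop x y c) s0 s1.
  split=> // z; rewrite /= inE negb_or xpair_eqE /= => /andP[h _].
  by rewrite upd_neq.
have I1 : I s1 by rewrite /I /s1 /= upd_eq upd_neq // eq_sym.
have body s : same_outside (Seq c (incr x)) s1 s -> I s ->
    beval s (ilt (IVar x) (IVar y)) ->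
    run (Seq c (incr x)) s (max_cost c + 4)
      (fun s' => I s' /\ (N - ivar s' x < N - ivar s x)%N).
  move=> _ [invs yN xN sm] /=; rewrite addn1 yN => lt.
  have := run_wp (step s _ sm erefl lt invs) => /run_same H.
  apply: run_seq H _ => s' [inv' sm'].
  apply: (@run_weaken _ _ (max_cost (incr x)) _
    (fun s'' => s'' = set_ivar s' x (ivar s x).+1)) => //.
    by apply: run_wp => /=; rewrite (same_ivar sm') ?xc // addn1.
  move=> _ ->; rewrite /I /= upd_eq upd_neq 1?eq_sym // (same_ivar sm') ?yc //.
  split; last by lia.
  split=> //.
  apply: same_trans sm _.
  have [h1 h2 h3 h4] := sm'.
  split=> z; rewrite /= inE negb_or mem_cat negb_or.
  + by rewrite xpair_eqE /= => /and3P[zx zc _]; rewrite upd_neq // h1.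
  + by move=> /and3P[_ zc _]; rewrite h2.
  + by move=> /and3P[_ zc _]; rewrite h3.
  + by move=> /and3P[_ zc _]; rewrite h4.
have := run_while I1 body; rewrite /= upd_eq subn0.
set T := (_ + _)%N => loop.
apply: (@run_weaken _ _ (2 + T)) => [||s' H]; last exact: H.
  apply: run_seq; first by apply: (@run_wp (ISet x (IConst 0)) s0 (fun s => s = s1)).
  move=> s' -> ; apply: run_weaken loop _ _ => // s2 [[H yN xN _] + _].
  rewrite addn1 yN -leqNgt => le; suff <- : ivar s2 x = N by [].
  by apply/eqP; rewrite eqn_leq xN.
by rewrite /T; nia.
Qed.

End Logic.

Arguments wp : simpl never.
Arguments upd : simpl never.
Arguments upd2 : simpl never.
Arguments set_ivar : simpl never.
Arguments set_rvar : simpl never.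
Arguments put_iarr : simpl never.
Arguments put_rarr : simpl never.

#[global] Opaque set_ivar set_rvar put_iarr put_rarr.

Ltac wp_step :=
  rewrite ?wp_seq; first
  [ rewrite wp_iset | rewrite wp_rset | rewrite wp_iput | rewrite wp_rput
  | rewrite wp_if | rewrite wp_skip ];
  cbn [ieval reval beval ilt incr]; rewrite ?read_write /=.

(** * The program *)

(* Positions 0-3 of the index variables, 0-10 of the index arrays and 0-5 of
   the real arrays are prescribed by the input and output conventions. *)
Module Names.
Notation i_n := 0%N (only parsing).
Notation i_p := 1%N (only parsing).
Notation i_N := 2%N (only parsing).
Notation i_m := 3%N (only parsing).
Notation i_j := 4%N (only parsing).
Notation i_x := 5%N (only parsing).
Notation i_e := 6%N (only parsing).
Notation i_head := 7%N (only parsing).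
Notation i_tail := 8%N (only parsing).
Notation i_root := 9%N (only parsing).
Notation i_k := 10%N (only parsing).
Notation i_f := 11%N (only parsing).
Notation i_g := 12%N (only parsing).
Notation i_l := 13%N (only parsing).
Notation i_i := 14%N (only parsing).
Notation i_nI := 15%N (only parsing).
Notation i_off := 16%N (only parsing).
Notation i_h := 17%N (only parsing).
Notation i_wb := 18%N (only parsing).
Notation i_nz := 19%N (only parsing).
Notation i_c := 20%N (only parsing).
Notation i_c1 := 21%N (only parsing).
Notation i_c2 := 22%N (only parsing).
Notation i_t := 23%N (only parsing).

Notation a_ptr := 0%N (only parsing).
Notation a_col := 1%N (only parsing).
Notation a_idx := 2%N (only parsing).
Notation a_ncols := 3%N (only parsing).
Notation a_hB := 4%N (only parsing).
Notation a_pB := 5%N (only parsing).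
Notation a_cB := 6%N (only parsing).
Notation a_hW := 7%N (only parsing).
Notation a_hP := 8%N (only parsing).
Notation a_pP := 9%N (only parsing).
Notation a_cP := 10%N (only parsing).
Notation a_mark := 11%N (only parsing).
Notation a_first := 12%N (only parsing).
Notation a_next := 13%N (only parsing).
Notation a_row := 14%N (only parsing).
Notation a_comp := 15%N (only parsing).
Notation a_bad := 16%N (only parsing).
Notation a_tch := 17%N (only parsing).
Notation a_vis := 18%N (only parsing).
Notation a_queue := 19%N (only parsing).
Notation a_num := 20%N (only parsing).

Notation r_val := 0%N (only parsing).
Notation r_w := 1%N (only parsing).
Notation r_wq := 2%N (only parsing).
Notation r_B := 3%N (only parsing).
Notation r_W := 4%N (only parsing).
Notation r_P := 5%N (only parsing).
Notation r_sgn := 6%N (only parsing).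

Notation x_sig := 0%N (only parsing).
Notation x_v1 := 1%N (only parsing).
Notation x_v2 := 2%N (only parsing).
Notation x_s := 3%N (only parsing).

End Names.
Import Names.

Fixpoint seqs (cs : seq cmd) : cmd :=
  match cs with
  | [::] => Skip
  | [:: c] => c
  | c :: cs' => Seq c (seqs cs')
  end.

Definition ieq (e1 e2 : iexp) : bexp := BAnd (ILe e1 e2) (ILe e2 e1).

Definition rnonzero (e : rexp) : bexp :=
  BNot (BAnd (RLe e (RConst 0)) (RLe (RConst 0) e)).

Definition mark_rows : cmd :=
  for_loop i_j i_N (IPut a_mark (IGet a_idx (IVar i_j)) (IConst 1)).

Definition init_labels : cmd :=
  for_loop i_j i_p (Seq (IPut a_comp (IVar i_j) (IVar i_j))
                        (RPut r_sgn (IVar i_j) (RConst 1))).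

(* The entries of each column form a linked list, whose links are stored
   shifted by one, 0 being the end of the list. *)
Definition link_entries : cmd :=
  seqs [:: ISet i_x (IConst 0); ISet i_e (IConst 0);
    While (ilt (IVar i_x) (IVar i_n))
      (If (ilt (IVar i_e) (IGet a_ptr (IAdd (IVar i_x) (IConst 1))))
         (seqs [:: IPut a_row (IVar i_e) (IVar i_x);
            IPut a_next (IVar i_e) (IGet a_first (IGet a_col (IVar i_e)));
            IPut a_first (IGet a_col (IVar i_e)) (IAdd (IVar i_e) (IConst 1));
            incr i_e])
         (incr i_x))].

(** This is what the algorithm retains of the complexes: boundary coefficients are signs, and
    non-branching bounds the entries of a row by two. *)
Record valid_input (R : rcfType) (n p : nat) (B : 'M[R]_(n, p))
    (idx : seq 'I_n) (ptr col : nat -> nat) (val : nat -> R) : Prop :=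
  ValidInput {
    valid_csr : is_csr B ptr col val;
    valid_ptr0 : ptr 0 = 0%N;
    valid_sign : forall x k, B x k != 0 -> is_sign (B x k);
    valid_row : forall x, (#|[set k | B x k != 0%R]| <= 2)%N;
    valid_idx : uniq idx }.

(** * Stored rows with at most two entries, and column lists *)

Section Input.
Variables (R : rcfType) (n p m : nat) (B : 'M[R]_(n, p)) (idx : seq 'I_n).
Variables (ptr col : nat -> nat) (val wt wqs : nat -> R).
Hypothesis valid : valid_input B idx ptr col val.
Implicit Types (s : state R) (x : 'I_n) (j k l : 'I_p).

Definition input_ok s : Prop :=
  [/\ [/\ ivar s i_n = n, ivar s i_p = p, ivar s i_N = size idx & ivar s i_m = m],
      [/\ iarr s a_ptr = ptr, iarr s a_col = col
        & iarr s a_idx = nth 0%N [seq nat_of_ord x | x <- idx]]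
    & [/\ rarr s r_val = val, rarr s r_w = wt & rarr s r_wq = wqs]].

Definition writes_input : seq (nat * nat) :=
  [:: (0, i_n); (0, i_p); (0, i_N); (0, i_m); (2, a_ptr); (2, a_col);
      (2, a_idx); (3, r_val); (3, r_w); (3, r_wq)]%N.

Lemma input_ok_same c s s' : same_outside c s s' ->
  (all (fun z => z \notin writes c) writes_input) = true ->
  input_ok s -> input_ok s'.
Proof.
case=> h0 h1 h2 h3 /= /and5P[e0 e1 e2 e3 /and5P[e4 e5 e6 e7 /and3P[e8 e9 _]]].
by case=> -[? ? ? ?] [? ? ?] [? ? ?]; split; split; rewrite ?h0 ?h2 ?h3.
Qed.

(** Entries of a row may be stored in any order, so in the last shape [k] is the column stored first
    and not necessarily the smaller one. *)
Inductive csr_shape x : Prop :=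
| CsrShape0 of ptr x.+1 = ptr x & (forall k, B x k = 0)
| CsrShape1 k of ptr x.+1 = (ptr x).+1 & col (ptr x) = k & val (ptr x) = B x k
    & B x k != 0 & (forall l, B x l != 0 -> l = k)
| CsrShape2 k l of ptr x.+1 = (ptr x).+2 & k != l
    & (col (ptr x) = k /\ col (ptr x).+1 = l)
    & (val (ptr x) = B x k /\ val (ptr x).+1 = B x l)
    & (B x k != 0 /\ B x l != 0) & (forall j, B x j != 0 -> j = k \/ j = l).

Lemma csrP x : csr_shape x.
Proof.
have [le pe vals] := valid_csr valid x.
have sz := perm_size pe; rewrite !size_map size_iota in sz.
have := valid_row valid x; rewrite cardsE cardE.
have -> : size (enum [pred k | B x k != 0]) = size [seq j <- enum 'I_p | B x j != 0].
  by rewrite {1}/enum_mem -enumT; congr size; apply: eq_filter.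
move: pe sz vals; set t := [seq j <- _ | _] => pe sz vals.
have mt j : (j \in t) = (B x j != 0) by rewrite mem_filter mem_enum andbT.
have ut : uniq t by rewrite filter_uniq // enum_uniq.
have e1 : ptr x.+1 = (ptr x + size t)%N by rewrite -sz subnKC.
clearbody t; case: t pe {sz} vals e1 mt ut => [|k [|l [|//]]] pe vals e1 mt ut _.
- apply: CsrShape0; first by rewrite e1 addn0.
  by move=> k; apply/eqP; rewrite -[_ == _]negbK -mt.
- move: pe vals; rewrite e1 addn1 /index_iota subSnn => /perm_mem/(_ (col (ptr x))).
  rewrite /= !inE eqxx => /esym/eqP e vals.
  apply: (@CsrShape1 x k) => //; first by rewrite e1 addn1.
  + by apply: vals => //; rewrite leqnn /=.
  + by rewrite -mt mem_head.
  + by move=> l; rewrite -mt inE => /eqP.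
have {ut}kl : k != l by move: ut; rewrite /= inE andbT.
have [xk xl] : B x k != 0 /\ B x l != 0 by rewrite -!mt !inE !eqxx orbT.
have sh j : B x j != 0 -> j = k \/ j = l.
  by rewrite -mt !inE => /orP[] /eqP; [left|right].
have e2 : ptr x.+1 = (ptr x).+2 by rewrite e1 addn2.
move: pe; rewrite e2 /index_iota -addn2 addKn /= => pe.
have m0 := perm_mem pe (col (ptr x)); rewrite !inE eqxx in m0.
have m1 := perm_mem pe (col (ptr x).+1); rewrite !inE eqxx orbT in m1.
have := perm_uniq pe; rewrite /= !inE !andbT [nat_of_ord k == l](negbTE kl).
move=> d; have {m0 m1} : (col (ptr x) = k /\ col (ptr x).+1 = l) \/
    (col (ptr x) = l /\ col (ptr x).+1 = k).
  move/esym/orP: m0 d => [] /eqP-> ; move/esym/orP: m1 => [] /eqP->;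
    rewrite ?eqxx //; by [left|right].
have v e (j : 'I_p) : (ptr x <= e < (ptr x).+2)%N -> col e = j -> val e = B x j.
  by rewrite -e2; apply: vals.
case=> -[c0 c1].
  by apply: (@CsrShape2 x k l) => //; split=> //; apply: v => //; lia.
apply: (@CsrShape2 x l k) => //; first by rewrite eq_sym.
  by split; apply: v => //; lia.
by move=> j /sh[]->; [right|left].
Qed.



Local Notation nnz := (ptr n).

Lemma ptr_mono a b : (a <= b)%N -> (b <= n)%N -> (ptr a <= ptr b)%N.
Proof.
move=> ab bn; rewrite -(subnKC ab); move: (b - a)%N (subnKC ab) => d.
elim: d b {ab} bn => [|d IH] b bn; first by rewrite addn0.
rewrite addnS => e; apply: leq_trans (IH (a + d)%N _ erefl) _; first by lia.
have lt : (a + d < n)%N by lia.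
by have [] := valid_csr valid (Ordinal lt).
Qed.

(** Non-branching makes the stored input linear in the number of rows, on which the time of the
    preprocessing rests. *)
Lemma nnz_le : (nnz <= 2 * n)%N.
Proof.
have H a : (a <= n)%N -> (ptr a <= 2 * a)%N.
  elim: a => [|a IH] lt; first by rewrite (valid_ptr0 valid).
  by have := IH (ltnW lt); case: (csrP (Ordinal lt)) => /= [->|k ->|k l ->]; lia.
exact: H.
Qed.

Definition in_row (e x : nat) : bool := (ptr x <= e < ptr x.+1)%N.

Lemma in_row_inj e x (y : 'I_n) : in_row e x -> in_row e y -> x = y.
Proof.
have H (a b : 'I_n) : in_row e a -> in_row e b -> ~~ (a < b)%N.
  move=> /andP[_ h1] /andP[h2 _]; apply/negP => ab.
  by have := ptr_mono ab (ltnW (ltn_ord b)); lia.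
move=> hx hy; apply/val_inj/eqP; rewrite eqn_leq leqNgt H //= leqNgt H //.
Qed.

Lemma in_row_nnz e x : in_row e x -> (e < nnz)%N.
Proof. by case/andP=> _ /leq_trans; apply; apply: ptr_mono. Qed.

(* The other stored entry of the row, or [e] itself if there is none. *)
Definition partner (x e : nat) : nat := (ptr x + ptr x.+1 - (e + 1))%N.

(** [partner] reflects the interval of positions of the row: this swaps the ends of an interval of
    length two and fixes an interval of length one. *)
Lemma partnerP x e : in_row e x -> exists k : 'I_p,
  [/\ col e = k, val e = B x k, B x k != 0 &
   (partner x e = e /\ (forall l, B x l != 0 -> l = k)) \/
   (partner x e <> e /\ exists l : 'I_p,
     [/\ col (partner x e) = l, val (partner x e) = B x l, B x l != 0, k != l
       & forall j, B x j != 0 -> j = k \/ j = l])].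
Proof.
rewrite /in_row /partner; case: (csrP x).
- by move=> -> _; lia.
- move=> k -> ck vk xk u h; have -> : e = ptr x by lia.
  exists k; split=> //; left; split=> //; lia.
move=> k l -> kl [ck cl] [vk vl] [xk xl] u h.
have [->|->] : e = ptr x \/ e = (ptr x).+1 by lia.
  exists k; split=> //; right; split; first by lia.
  by exists l; rewrite (_ : (_ - _)%N = (ptr x).+1) //; lia.
exists l; split=> //; right; split; first by lia.
exists k; rewrite (_ : (_ - _)%N = ptr x); last by lia.
by split=> //; [rewrite eq_sym|move=> j /u[]; [right|left]].
Qed.

Lemma row_entry x k : B x k != 0 -> exists e, in_row e x /\ col e = k.
Proof.
rewrite /in_row; case: (csrP x).
- by move=> _ ->; rewrite eqxx.
- by move=> k' -> ck _ _ u /u->; exists (ptr x); split=> //; lia.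
move=> k' l -> _ [ck cl] _ _ u /u[]->; [exists (ptr x)|exists (ptr x).+1];
  split=> //; lia.
Qed.

(** The specification of the linked lists: the last position below [e] that holds column [k],
    shifted by one so that 0 means none. Following the links visits positions in decreasing
    order. *)
Fixpoint last_entry (k e : nat) : nat :=
  if e is e'.+1 then if col e' == k then e else last_entry k e' else 0%N.

Lemma last_entry_le (k e : nat) : (last_entry k e <= e)%N.
Proof. by elim: e => //= e IH; case: ifP => // _; apply: leqW. Qed.

Lemma last_entry_col (k e e' : nat) : last_entry k e = e'.+1 -> col e' = k.
Proof. by elim: e => //= e IH; case: eqP => // h [<-]. Qed.

Lemma last_entry_max (k e e' : nat) : (e' < e)%N -> col e' = k -> (e' < last_entry k e)%N.
Proof.
elim: e => //= e IH; rewrite ltnS leq_eqVlt => /orP[/eqP-> ->|lt ck].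
  by rewrite eqxx.
case: ifP => _; first exact: leqW.
exact: IH.
Qed.

Lemma mark_rowsP s : input_ok s -> (forall x, iarr s a_mark x = 0%N) ->
  run mark_rows s ((max_cost (IPut a_mark (IGet a_idx (IVar i_j)) (IConst 1)) + 10) * (size idx).+1)
    (fun s' => (forall x, iarr s' a_mark x = (x \in idx)) /\
               same_outside mark_rows s s').
Proof.
move=> inp m0; have eN : ivar s i_N = size idx by case: inp => -[].
have := @run_for _ i_j i_N (IPut a_mark (IGet a_idx (IVar i_j)) (IConst 1))
  (fun b s' => forall x, iarr s' a_mark x = (x \in take b idx)) s.
rewrite eN; case=> //.
- by move=> x; rewrite take0 in_nil read_write m0.
- move=> s1 b sm ej lt inv.
  have [_ [_ _ ei] _] := input_ok_same sm erefl inp.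
  wp_step => x; rewrite ?read_write /= /upd ej ei (nth_map x) //
    (take_nth x) // mem_rcons inE -val_eqE /=.
  by case: eqP => // _; apply: inv.
move=> s' [t [ex le [inv sm]]]; exists s', t; split=> //; split=> //.
by move=> x; rewrite inv take_size.
Qed.

Lemma init_labelsP s : input_ok s ->
  run init_labels s ((max_cost (Seq (IPut a_comp (IVar i_j) (IVar i_j))
                        (RPut r_sgn (IVar i_j) (RConst 1))) + 10) * p.+1)
    (fun s' => (forall j, iarr s' a_comp j = j /\ rarr s' r_sgn j = 1) /\
               same_outside init_labels s s').
Proof.
move=> inp; have eN : ivar s i_p = p by case: inp => -[].
have := @run_for _ i_j i_p (Seq (IPut a_comp (IVar i_j) (IVar i_j))
                        (RPut r_sgn (IVar i_j) (RConst 1)))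
  (fun b s' => forall j, (j < b)%N -> iarr s' a_comp j = j /\ rarr s' r_sgn j = 1) s.
rewrite eN; case=> //.
- move=> s1 b sm ej lt inv.
  do 2!wp_step; move=> x lex; rewrite ?read_write /= /upd ej.
  by case: eqP => [->|ne] //; apply: inv; lia.
move=> s' [t [ex le [inv sm]]]; exists s', t; split=> //; split=> // j.
exact: inv.
Qed.

Definition linked s : Prop :=
  [/\ forall e, (e < nnz)%N -> exists x, iarr s a_row e = x /\ in_row e x,
      forall e, (e < nnz)%N -> iarr s a_next e = last_entry (col e) e
    & forall k : nat, iarr s a_first k = last_entry k nnz].

Lemma link_entriesP s : input_ok s -> (forall k : nat, iarr s a_first k = 0%N) ->
  run link_entries s (300 * n.+1)
    (fun s' => linked s' /\ same_outside link_entries s s').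
Proof.
move=> inp f0; apply: run_same.
pose s1 := set_ivar (set_ivar s i_x 0%N) i_e 0%N.
have inp1 : input_ok s1 by rewrite /input_ok !read_write.
have [[en _ _ _] [ep ec _] _] := inp1.
pose inv (s' : state R) := [/\ (ivar s' i_x <= n)%N,
  (ptr (ivar s' i_x) <= ivar s' i_e)%N /\
  (if (ivar s' i_x < n)%N then (ivar s' i_e <= ptr (ivar s' i_x).+1)%N
    else ivar s' i_e == nnz),
  forall e, (e < ivar s' i_e)%N -> exists x, iarr s' a_row e = x /\ in_row e x,
  forall e, (e < ivar s' i_e)%N -> iarr s' a_next e = last_entry (col e) e
  & forall k : nat, iarr s' a_first k = last_entry k (ivar s' i_e)].
have inv1 : inv s1.
  rewrite /inv !read_write /= (valid_ptr0 valid); split=> //; split=> //.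
  by case: ltnP => //; rewrite leqn0 => /eqP ->; rewrite (valid_ptr0 valid).
(* Every pass advances either the row or the entry, and by [nnz_le] the initial value is at most
   three times [n]. *)
pose mu (s' : state R) := ((n - ivar s' i_x) + (nnz - ivar s' i_e))%N.
have H := @run_loop _ (ilt (IVar i_x) (IVar i_n)) _ mu inv s1 inv1.
rewrite /link_entries [seqs _]/=.
apply: (@run_weaken _ _ _ (2 + (2 + _)%N)%N); last by move=> s' Q; exact: Q.
  apply: run_seq; first by apply: (@run_wp _ (ISet _ _)); exact: erefl.
  move=> _ <-.
  apply: run_seq; first by apply: (@run_wp _ (ISet _ _)); exact: erefl.
  move=> _ <-.
  apply: run_weaken (H _ _) _ _.
- move=> s2 sm [xn [pe pe'] hr hn hf] /=.
  have [[en2 _ _ _] [ep2 ec2 _] _] := input_ok_same sm erefl inp1.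
  rewrite en2 addn1 => ltX; rewrite ltX in pe'; wp_step; rewrite ep2 !addn1.
  move: xn pe hr hn hf ltX pe'.
  move EX: (ivar s2 i_x) => X; move EF: (ivar s2 i_e) => F.
  move=> xn pe hr hn hf ltX pe'.
  have rowX : (F < ptr X.+1)%N -> in_row F X by rewrite /in_row pe.
  case: ltnP => [ltF|leF]; do 4?wp_step; rewrite /mu /inv !read_write /= EX EF ?ec2 !addn1;
    last first.
    have eF : F = ptr X.+1 by apply/eqP; rewrite eqn_leq pe' leF.
    split; last by lia.
    split=> //; split=> //.
    case: ltnP => lt2; last first.
      by rewrite eF (_ : X.+1 = n) //; apply/eqP; rewrite eqn_leq ltX lt2.
    by rewrite eF; apply: ptr_mono.
  have rX := rowX ltF.
  have Fn := in_row_nnz (x := Ordinal ltX) rX.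
  split; last by lia.
  rewrite /upd; split=> //.
  + by rewrite ltX; split=> //; apply: leqW.
  + move=> e; rewrite ltnS leq_eqVlt => /orP[/eqP->|lt].
      by rewrite eqxx; exists (Ordinal ltX).
    by rewrite (ltn_eqF lt); apply: hr.
  + move=> e; rewrite ltnS leq_eqVlt => /orP[/eqP->|lt].
      by rewrite eqxx hf.
    by rewrite (ltn_eqF lt); apply: hn.
  + by move=> k; rewrite /= [col F == k]eq_sym; case: eqP.
- exact: leqnn.
move=> s2 [[xn [pe pe'] hr hn hf] /= nlt sm].
have [[en2 _ _ _] _ _] := input_ok_same sm erefl inp1.
move: nlt pe'; rewrite en2 addn1 -leqNgt => le.
rewrite ltnNge le /= => /eqP ee.
  by rewrite ee in hr hn hf.
by rewrite /mu !read_write /=; have := nnz_le; lia.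
Qed.

End Input.

(** * Breadth-first search over the rows outside the largest complex *)

Definition push (e : iexp) : cmd :=
  seqs [:: IPut a_vis e (IConst 1); IPut a_queue (IVar i_tail) e; incr i_tail].

Definition rentry (f k : nat) : rexp := RMul (RGet r_val (IVar f)) (RGet r_sgn (IVar k)).

Definition visit_entry : cmd :=
  seqs [:: ISet i_g (ISub (IAdd (IGet a_ptr (IVar i_x)) (IGet a_ptr (IAdd (IVar i_x) (IConst 1))))
                          (IAdd (IVar i_f) (IConst 1)));
    ISet i_l (IGet a_col (IVar i_g));
    IPut a_tch (IVar i_k) (IConst 1);
    IPut a_tch (IVar i_l) (IConst 1);
    If (ieq (IVar i_f) (IVar i_g))
      (IPut a_bad (IGet a_comp (IVar i_k)) (IConst 1))
      (If (ILe (IGet a_vis (IVar i_l)) (IConst 0))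
         (seqs [:: IPut a_comp (IVar i_l) (IGet a_comp (IVar i_k));
            RPut r_sgn (IVar i_l)
              (RSub (RConst 0) (RMul (rentry i_f i_k) (RGet r_val (IVar i_g))));
            push (IVar i_l)])
         (If (rnonzero (RAdd (rentry i_f i_k) (rentry i_g i_l)))
            (IPut a_bad (IGet a_comp (IVar i_k)) (IConst 1))
            Skip))].

(** The nested traversals of roots, queue and column list are flattened into one loop, so that a
    single potential bounds the whole search. The cursor [i_e] is a shifted link, and 0 means that
    the current list is exhausted. *)
Definition search_step : cmd :=
  If (ILe (IConst 1) (IVar i_e))
    (seqs [:: ISet i_f (ISub (IVar i_e) (IConst 1));
       ISet i_x (IGet a_row (IVar i_f));
       If (ILe (IGet a_mark (IVar i_x)) (IConst 0)) visit_entry Skip;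
       ISet i_e (IGet a_next (IVar i_f))])
    (If (ilt (IVar i_head) (IVar i_tail))
       (seqs [:: ISet i_k (IGet a_queue (IVar i_head)); incr i_head;
          ISet i_e (IGet a_first (IVar i_k))])
       (seqs [:: If (ILe (IGet a_vis (IVar i_root)) (IConst 0)) (push (IVar i_root)) Skip;
          incr i_root])).

(* Breadth-first search: in this order every row that joins two components
   joins the current one to a single new column, so that relabelling takes
   constant time. *)
Definition search : cmd :=
  seqs [:: ISet i_e (IConst 0); ISet i_head (IConst 0); ISet i_tail (IConst 0);
    ISet i_root (IConst 0);
    While (BNot (BAnd (ILe (IVar i_e) (IConst 0))
                   (BAnd (ILe (IVar i_tail) (IVar i_head)) (ILe (IVar i_p) (IVar i_root)))))
      search_step].

Lemma mkseq_upd (T : Type) (f : nat -> T) a v b : (b <= a)%N ->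
  mkseq (upd f a v) b = mkseq f b.
Proof.
move=> ba; apply/eq_in_map => i; rewrite mem_iota add0n => /andP[_ lt].
by rewrite upd_neq //; apply/eqP; lia.
Qed.

Lemma mkseqS (T : Type) (f : nat -> T) a : mkseq f a.+1 = rcons (mkseq f a) (f a).
Proof. by rewrite /mkseq -addn1 iotaD map_cat cats1. Qed.

Section Search.
Variables (R : rcfType) (n p m : nat) (B : 'M[R]_(n, p)) (idx : seq 'I_n).
Variables (ptr col : nat -> nat) (val wt wqs : nat -> R).
Hypothesis valid : valid_input B idx ptr col val.
Implicit Types (s : state R) (x : 'I_n) (j k l : 'I_p) (E : pred 'I_n).

Local Notation in_row := (in_row ptr).
Local Notation last_entry := (last_entry col).
Local Notation nnz := (ptr n).

Definition finished E j : Prop := forall x, x \notin idx -> B x j != 0 -> E x.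

(** Lists run towards smaller positions, so the part of a list still ahead of the cursor consists of
    the positions below [e]. *)
Definition pending E (e : nat) j : Prop := forall x, x \notin idx -> B x j != 0 ->
  E x \/ exists e0, [/\ (e0 < e)%N, in_row e0 x & col e0 = j].

(** The decisive field is [si_fin]: a visited column either carries the current label [cur] or has
    all its rows processed. A new row between two visited columns thus has both ends in the current
    component. In [si_done] the only column removed from the queue that may be unfinished is [k0],
    whose list is being read. *)
Record search_inv E (cur : nat) (comp bad tch vis queue : nat -> nat)
    (sgn : nat -> R) (e k0 head tail root : nat) : Prop := SearchInv {
  si_lab : labelling B E comp bad tch sgn;
  si_act : forall x, E x -> x \notin idx;
  si_head : (head <= tail)%N;
  si_rootp : (root <= p)%N;
  si_uniq : uniq (mkseq queue tail);
  si_lt : forall i, i \in mkseq queue tail -> (i < p)%N;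
  si_vis : forall j, vis j = (nat_of_ord j \in mkseq queue tail);
  si_root : forall j, (j < root)%N -> nat_of_ord j \in mkseq queue tail;
  si_tch : forall j, tch j != 0%N -> nat_of_ord j \in mkseq queue tail;
  si_fin : forall j, nat_of_ord j \in mkseq queue tail -> comp j = cur \/ finished E j;
  si_done : forall j, nat_of_ord j \in mkseq queue head ->
    finished E j \/ (k0 = j /\ pending E e j);
  si_e : (0 < e)%N -> exists k, [/\ k0 = k, nat_of_ord k \in mkseq queue tail,
    (e <= nnz)%N & col e.-1 = k] }.

Lemma finished_sub E E' j : (forall x, E x -> E' x) -> finished E j -> finished E' j.
Proof. by move=> sub fin x xi xj; apply/sub/fin. Qed.

Lemma pending0 E j : pending E 0 j -> finished E j.
Proof. by move=> pd x xi xj; case: (pd x xi xj) => // -[e0 []]. Qed.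

Lemma pending_next E x f k :
  in_row f x -> col f = k -> E x \/ x \in idx ->
  pending E f.+1 k -> pending E (last_entry k f) k.
Proof.
move=> fx fk Ex pd y yi yk; case: (pd y yi yk) => [|[e0 [lt ey ek]]]; first by left.
move: lt; rewrite ltnS leq_eqVlt => /orP[/eqP e0f|lt].
  have xy := in_row_inj valid fx (y := y); rewrite -e0f in xy.
  have {}xy := xy ey; subst y; left; case: Ex => //.
  by rewrite (negbTE yi).
by right; exists e0; split=> //; apply: last_entry_max.
Qed.

Section Step.
Variables (E : pred 'I_n) (cur : nat) (comp bad tch vis queue : nat -> nat).
Variables (sgn : nat -> R) (e k0 head tail root : nat).
Hypothesis inv : search_inv E cur comp bad tch vis queue sgn e k0 head tail root.

Let e_next (k : 'I_p) f :
  nat_of_ord k \in mkseq queue tail -> (f < nnz)%N ->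
  (0 < last_entry k f)%N ->
  [/\ (last_entry k f <= nnz)%N & col (last_entry k f).-1 = k].
Proof.
move=> kq ltf; case E0 : (last_entry k f) => [|e0] // _; split.
  by rewrite -E0 (leq_trans (last_entry_le _ _ _)) // ltnW.
exact: last_entry_col E0.
Qed.

Lemma search_skip f x : e = f.+1 -> in_row f x -> x \in idx ->
  search_inv E cur comp bad tch vis queue sgn
    (last_entry (col f) f) k0 head tail root.
Proof.
move=> ef fx xi; case: inv => Hlab Hact Hh Hr Hu Hlt Hv Hro Ht Hf Hd He.
have [|k [e1 kq le ck]] := He; first by rewrite ef.
rewrite ef /= in le ck; split=> //.
  move=> j /Hd[|[kj pd]]; [by left|right].
  have ekj : k = j by apply: val_inj; rewrite /= -e1.
  split=> //; rewrite ef in pd; rewrite ck ekj.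
  by apply: pending_next pd; [exact: fx|rewrite ck ekj|right].
by move=> lt0; exists k; rewrite ck in lt0 *; have [] := e_next kq le lt0.
Qed.

Lemma search_visit f x l comp' bad' tch' sgn' vis' queue' tail' k :
  e = f.+1 -> in_row f x -> x \notin idx -> k0 = k ->
  labelling B (add_row E x) comp' bad' tch' sgn' ->
  (forall j, tch' j != 0%N -> [\/ tch j != 0%N, j = k | j = l]) ->
  ([/\ vis' = vis, queue' = queue, tail' = tail, comp' = comp
    & nat_of_ord l \in mkseq queue tail] \/
   [/\ vis' = upd vis l 1%N, queue' = upd queue tail l, tail' = tail.+1,
       comp' = upd comp l (comp k) & nat_of_ord l \notin mkseq queue tail]) ->
  (B x k != 0 /\ B x l != 0) ->
  search_inv (add_row E x) cur comp' bad' tch' vis' queue' sgn'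
    (last_entry (col f) f) k0 head tail' root.
Proof.
move=> ef fx xi e0 lab' tt cases [xk xl].
case: inv => Hlab Hact Hh Hr Hu Hlt Hv Hro Ht Hf Hd He.
have [|k' [e1 kq le ck]] := He; first by rewrite ef.
have ekk : k' = k by apply: val_inj; rewrite /= -e1.
subst k'; rewrite ef /= in le ck.
have act' y : add_row E x y -> y \notin idx by case/orP=> [/Hact|/eqP->].
have sub y : E y -> add_row E x y by rewrite /add_row => ->.
have done' q j : mkseq q head = mkseq queue head ->
    nat_of_ord j \in mkseq q head ->
    finished (add_row E x) j \/ k0 = j /\ pending (add_row E x) (last_entry (col f) f) j.
  move=> -> /Hd[fin|[kj pd]]; [by left; apply: finished_sub fin|right].
  have ekj : k = j by apply: val_inj; rewrite /= -e1.
  split=> //; rewrite ef in pd; rewrite ck ekj.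
  apply: pending_next fx _ _ _; rewrite ?ck ?ekj //.
    by left; rewrite /add_row eqxx orbT.
  move=> y yi yj; case: (pd y yi yj) => [/sub|h]; by [left|right].
have en q : {subset mkseq queue tail <= q} -> (0 < last_entry (col f) f)%N ->
   exists k1, [/\ k0 = k1, nat_of_ord k1 \in q,
      (last_entry (col f) f <= nnz)%N & col (last_entry (col f) f).-1 = k1].
  by move=> sq lt0; exists k; rewrite ck in lt0 *; have [] := e_next kq le lt0;
    split=> //; apply: sq.
case: cases => [[-> -> -> ec lq]|[-> -> -> ec lq]].
  split=> //.
  - by move=> j /tt[/Ht|->|->].
  - move=> j /Hf[|fin]; [by left; rewrite ec|right; exact: finished_sub fin].
  - by move=> j; apply: done'.
  - by move=> lt0; apply: en.
have mq : mkseq (upd queue tail l) tail.+1 = rcons (mkseq queue tail) l.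
  by rewrite mkseqS mkseq_upd // upd_eq.
split; rewrite ?mq //.
- exact: leqW.
- by rewrite rcons_uniq lq.
- by move=> i; rewrite mem_rcons inE => /orP[/eqP->|/Hlt].
- move=> j; rewrite mem_rcons inE /upd; case: eqP => //= _; exact: Hv.
- by move=> j /Hro h; rewrite mem_rcons inE h orbT.
- move=> j; rewrite mem_rcons inE => /tt[/Ht->|->|->]; rewrite ?kq ?eqxx ?orbT //.
- move=> j; rewrite mem_rcons inE ec /upd; case: eqP => [jl _|_ /= /Hf[|fin]].
  (* Were [k] finished, the row [x] would have been processed earlier and would have touched [l],
     which would then be in the queue. *)
  + left; case: (Hf k kq) => // /(_ x xi xk) Ex.
    case/negP: lq; apply: Ht; rewrite (lab_tch Hlab) eqb0 negbK.
    by apply/existsP; exists x; rewrite Ex.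
  + by left.
  + right; exact: finished_sub fin.
- by move=> j; apply: done'; rewrite mkseq_upd.
- by move=> lt0; apply: en => // i; rewrite mem_rcons inE orbC => ->.
Qed.

Lemma search_pop : e = 0%N -> (head < tail)%N ->
  search_inv E cur comp bad tch vis queue sgn
    (last_entry (queue head) nnz) (queue head) head.+1 tail root.
Proof.
move=> e0 ht; case: inv => Hlab Hact Hh Hr Hu Hlt Hv Hro Ht Hf Hd He.
have kq : queue head \in mkseq queue tail by rewrite map_f // mem_iota.
split=> //.
- move=> j; rewrite mkseqS mem_rcons inE => /orP[/eqP ej|].
    (* Every stored position lies below [nnz], so at the head of its list all rows of the column are
       pending. *)
    right; rewrite -ej; split=> // x xi xj; right.
    have [e' [ex ec]] := row_entry valid xj.
    exists e'; split=> //; apply: last_entry_max; last by rewrite ec.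
    exact: (in_row_nnz valid ex).
  by case/Hd => [|[_]]; [left|rewrite e0 => /pending0; left].
- case E0 : (last_entry _ _) => [|e1] // _.
  exists (Ordinal (Hlt _ kq)); split=> //=; first by rewrite -E0 last_entry_le.
  exact: last_entry_col E0.
Qed.

Lemma search_root_skip : (root < p)%N -> root \in mkseq queue tail ->
  search_inv E cur comp bad tch vis queue sgn e k0 head tail root.+1.
Proof.
move=> lt rq; case: inv => Hlab Hact Hh Hr Hu Hlt Hv Hro Ht Hf Hd He; split=> //.
by move=> j; rewrite ltnS leq_eqVlt => /orP[/eqP->|/Hro].
Qed.

(** With the queue exhausted every visited column is finished, so the current label may be replaced
    by that of the new root, which is untouched and hence its own label. *)
Lemma search_root_push : e = 0%N -> (tail <= head)%N -> (root < p)%N ->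
  root \notin mkseq queue tail ->
  search_inv E root comp bad tch (upd vis root 1%N) (upd queue tail root) sgn
    e k0 head tail.+1 root.+1.
Proof.
move=> e0 th lt rq; case: inv => Hlab Hact Hh Hr Hu Hlt Hv Hro Ht Hf Hd He.
have {}th : head = tail by apply/eqP; rewrite eqn_leq Hh.
have mq : mkseq (upd queue tail root) tail.+1 = rcons (mkseq queue tail) root.
  by rewrite mkseqS mkseq_upd // upd_eq.
have fin j : nat_of_ord j \in mkseq queue tail -> finished E j.
  by rewrite -th => /Hd[|[_]] //; rewrite e0 => /pending0.
split; rewrite ?mq //.
- by rewrite th.
- by rewrite rcons_uniq rq.
- by move=> i; rewrite mem_rcons inE => /orP[/eqP->|/Hlt].
- move=> j; rewrite mem_rcons inE /upd; case: eqP => //= _; exact: Hv.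
- move=> j; rewrite mem_rcons inE ltnS leq_eqVlt => /orP[->//|/Hro->].
  by rewrite orbT.
- by move=> j /Ht h; rewrite mem_rcons inE h orbT.
- move=> j; rewrite mem_rcons inE => /orP[/eqP ej|/fin]; last by right.
  left; rewrite -ej; apply: (lab_untouched_comp Hlab).
  by apply/eqP; apply: contraNT rq => /Ht; rewrite ej.
- move=> j; rewrite mkseq_upd ?th // => /fin; by left.
- by rewrite e0.
Qed.

(** All columns have been roots or were reached earlier, so every row outside [idx] with an entry is
    in [E]; zero rows are supplied by [labelling_ext]. *)
Lemma search_end : e = 0%N -> (tail <= head)%N -> (p <= root)%N ->
  labelling B (fun x => x \notin idx) comp bad tch sgn.
Proof.
move=> e0 th pr; case: inv => Hlab Hact Hh Hr Hu Hlt Hv Hro Ht Hf Hd He.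
have {}th : head = tail by apply/eqP; rewrite eqn_leq Hh.
have fin j : finished E j.
  have : nat_of_ord j \in mkseq queue head.
    by rewrite th; apply: Hro; apply: leq_trans pr.
  by move=> /Hd[|[_]] //; rewrite e0 => /pending0.
apply: (labelling_ext Hlab) => // x k xk.
by apply/idP/idP => [/Hact|xi] //; apply: (fin k).
Qed.
End Step.
End Search.

Section SearchProgram.
Variables (R : rcfType) (n p m : nat) (B : 'M[R]_(n, p)) (idx : seq 'I_n).
Variables (ptr col : nat -> nat) (val wt wqs : nat -> R).
Hypothesis valid : valid_input B idx ptr col val.
Implicit Types (s : state R) (x : 'I_n) (j k l : 'I_p) (E : pred 'I_n).

Local Notation nnz := (ptr n).
Local Notation input_ok := (input_ok p m idx ptr col val wt wqs).

Definition search_state s : Prop := exists E cur,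
  search_inv B idx ptr col E cur (iarr s a_comp) (iarr s a_bad) (iarr s a_tch)
    (iarr s a_vis) (iarr s a_queue) (rarr s r_sgn) (ivar s i_e) (ivar s i_k)
    (ivar s i_head) (ivar s i_tail) (ivar s i_root).

Definition occurrences (k e : nat) : nat := \sum_(i < e) (col i == k).

Lemma occurrencesS (k e : nat) :
  occurrences k e.+1 = (occurrences k e + (col e == k))%N.
Proof. exact: big_ord_recr. Qed.

Lemma occurrences_mono (k a b : nat) : (a <= b)%N ->
  (occurrences k a <= occurrences k b)%N.
Proof.
move=> ab; rewrite -(subnKC ab); elim: (b - a)%N => [|d IH]; first by rewrite addn0.
by rewrite addnS occurrencesS; apply: leq_trans IH _; apply: leq_addr.
Qed.

Lemma sum_occurrences e : (\sum_(j < p) occurrences j e <= e)%N.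
Proof.
rewrite /occurrences exchange_big /= -[leqRHS]card_ord -sum1_card.
apply: leq_sum => i _.
case: (ltnP (col i) p) => lt; last first.
  rewrite big1 // => j _; apply/eqP; rewrite eqb0; apply/eqP => e0.
  by move: (ltn_ord j); rewrite -e0; lia.
rewrite (bigD1 (Ordinal lt)) //= eqxx big1 ?addn0 // => j.
by rewrite -val_eqE /= eq_sym => /negbTE ->.
Qed.

(** A column still to be taken from the queue is charged its list plus one. Removing it moves the
    list to the middle term, and the extra unit pays for the removal. Appending to the queue is
    free, and the last term pays for the roots. *)
Definition search_measure s : nat :=
  (\sum_(j < p | nat_of_ord j \notin mkseq (iarr s a_queue) (ivar s i_head))
     (occurrences j nnz).+1 + occurrences (ivar s i_k) (ivar s i_e)
   + (p - ivar s i_root))%N.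

Definition marked s : Prop := forall x, iarr s a_mark x = (x \in idx).

Lemma search_measure_head s s' :
  iarr s' a_queue = iarr s a_queue -> ivar s' i_head = ivar s i_head ->
  ivar s' i_k = ivar s i_k -> ivar s' i_root = ivar s i_root ->
  (occurrences (ivar s i_k) (ivar s' i_e) < occurrences (ivar s i_k) (ivar s i_e))%N ->
  (search_measure s' < search_measure s)%N.
Proof. by rewrite /search_measure => -> -> -> ->; rewrite ltn_add2r ltn_add2l. Qed.

Lemma search_stepP s : input_ok s -> linked n ptr col s -> marked s ->
  search_state s ->
  beval s (BNot (BAnd (ILe (IVar i_e) (IConst 0))
           (BAnd (ILe (IVar i_tail) (IVar i_head)) (ILe (IVar i_p) (IVar i_root))))) ->
  wp search_step (fun s' => search_state s' /\ (search_measure s' < search_measure s)%N) s.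
Proof.
move=> [[en ep _ _] [eptr ecol _] [eval _ _]] [hrow hnext hfirst] mk [E [cur inv]].
cbn [beval ieval]; rewrite ep => cond.
rewrite /search_step /visit_entry /push /rentry /ieq /rnonzero; cbn [seqs].
wp_step; case: (posnP (ivar s i_e)) => [e0|egt].
  rewrite e0 in cond inv.
  have hq := si_head inv.
  wp_step; rewrite addn1; case: ltnP => ht.
    have kq : iarr s a_queue (ivar s i_head) \in mkseq (iarr s a_queue) (ivar s i_tail).
      by rewrite map_f // mem_iota.
    have kp := si_lt inv kq.
    do 3!wp_step.
    rewrite hfirst addn1; split.
      exists E, cur; rewrite !read_write /=; exact: (search_pop valid inv).
    rewrite /search_measure !read_write /= e0.
    set k := iarr s a_queue (ivar s i_head) in kq kp *.
    have -> : occurrences (ivar s i_k) 0 = 0%N by rewrite /occurrences big_ord0.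
    have un : uniq (mkseq (iarr s a_queue) (ivar s i_head).+1).
      have := si_uniq inv; rewrite -(subnKC ht) {1}/mkseq iotaD map_cat cat_uniq.
      by case/and3P.
    rewrite mkseqS rcons_uniq -/k in un; case/andP: un => kn _.
    rewrite [X in (_ < X + _ + _)%N](bigD1 (Ordinal kp)) //=.
    rewrite addn0 ltn_add2r mkseqS -/k.
    rewrite (eq_bigl (fun j : 'I_p =>
      (nat_of_ord j \notin mkseq (iarr s a_queue) (ivar s i_head)) &&
      (j != Ordinal kp))); last first.
      by move=> j; rewrite mem_rcons inE negb_or andbC.
    rewrite addnC -addSn leq_add2r ltnS.
    by apply: occurrences_mono; apply: last_entry_le.
  have eh : ivar s i_head = ivar s i_tail by apply/eqP; rewrite eqn_leq hq ht.
  have hr : (ivar s i_root < p)%N by move: cond; rewrite ht /= -ltnNge.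
  have dec : (p - (ivar s i_root).+1 < p - ivar s i_root)%N by lia.
  do 2?wp_step; rewrite (si_vis inv (Ordinal hr)) /=.
  case: (boolP (_ \in _)) => rq; do 4?wp_step; rewrite !addn1; split.
  - by exists E, cur; rewrite !read_write /= e0; apply: search_root_skip.
  - by rewrite /search_measure !read_write /= e0 ltn_add2l.
  - exists E, (ivar s i_root); rewrite !read_write /= e0.
    exact: (search_root_push inv erefl ht hr rq).
  - rewrite /search_measure !read_write /= e0 mkseq_upd ?eh //.
    by rewrite ltn_add2l.
have [k [ek kq le ck]] := si_e inv egt.
have ef : ivar s i_e = (ivar s i_e - 1).+1 by lia.
move: ck le; rewrite -subn1; set f := (ivar s i_e - 1)%N in ef * => ck le.
have fn : (f < nnz)%N by lia.
have [x [ex fx]] := hrow f fn.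
have decf : (occurrences k (last_entry col (col f) f) < occurrences k (ivar s i_e))%N.
  rewrite ef ck occurrencesS ck eqxx addn1 ltnS.
  by apply: occurrences_mono; apply: last_entry_le.
wp_step; rewrite -/f; wp_step; rewrite ex; wp_step; rewrite mk.
case: (boolP (x \in idx)) => xi /=.
  wp_step; wp_step; rewrite (hnext f fn); split.
    exists E, cur; rewrite !read_write /=.
    exact: (search_skip valid inv ef fx xi).
  by apply: search_measure_head; rewrite !read_write //= ek.
have [k1 [ck1 vf xk H]] := partnerP valid fx.
have {ck1}ekk : k1 = k by apply: val_inj; rewrite /= -ck1 ck.
subst k1; have lab := si_lab inv.
wp_step; rewrite eptr [(x + 1)%N]addn1 -/(partner ptr x f).
wp_step; rewrite ecol.
wp_step; rewrite ek.
wp_step.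
wp_step; rewrite -eqn_leq.
case: H => [[pg u]|[pg [l [cg vg xl kl u]]]].
  rewrite pg eqxx ck; wp_step; rewrite ek.
  wp_step; rewrite (hnext f fn); split.
    exists (add_row E x), cur; rewrite !read_write /=.
    apply: (search_visit valid inv (x := x) (k := k) (l := k)) => //.
    + apply: labelling_row1 xk u lab _ _.
      * by move=> j; rewrite /upd.
      * by move=> j; rewrite /upd -val_eqE /=; case: eqP.
    + move=> j; rewrite /upd; case: (nat_of_ord j =P k) => [/ord_inj->|_] h; first by constructor 2.
      by constructor 1.
    + by left.
  by apply: search_measure_head; rewrite !read_write //= ek.
rewrite [f == _]eq_sym (introF eqP pg) cg.
wp_step; rewrite (si_vis inv l).
have tt : forall j, upd (upd (iarr s a_tch) k 1%N) l 1%N j =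
    (if (j == k) || (j == l) then 1%N else iarr s a_tch j).
  by move=> j; rewrite /upd -!val_eqE orbC /=; case: eqP.
have tt' j : upd (upd (iarr s a_tch) k 1%N) l 1%N j != 0%N ->
    [\/ iarr s a_tch j != 0%N, j = k | j = l].
  rewrite tt; case: (j =P k) => [-> _|_ /=]; first by constructor 2.
  by case: (j =P l) => [-> _|_ h]; [constructor 3|constructor 1].
case: (boolP (nat_of_ord l \in _)) => lq /=.
  (* If [x] is already processed its columns are in one component. Otherwise neither column is
     finished, so both carry the label [cur]. *)
  have ckl : iarr s a_comp k = iarr s a_comp l.
    case: (boolP [exists y, E y && (y == x)]) => [/existsP[y /andP[Ey /eqP yx]]|nEx].
      by rewrite yx in Ey; apply: (lab_adj lab Ey).
    have nE : ~ E x by move=> Ex; case/existsP: nEx; exists x; rewrite Ex eqxx.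
    case: (si_fin inv kq) => [->|/(_ x xi xk)//].
    by case: (si_fin inv lq) => [->|/(_ x xi xl)//].
  have st (bad' : nat -> nat) : (forall j, bad' (iarr s a_comp j) =
     if (iarr s a_comp j == iarr s a_comp k) &&
       (B x k * rarr s r_sgn k + B x l * rarr s r_sgn l != 0) then 1%N
     else iarr s a_bad (iarr s a_comp j)) ->
     search_inv B idx ptr col (add_row E x) cur (iarr s a_comp) bad'
       (upd (upd (iarr s a_tch) k 1%N) l 1%N) (iarr s a_vis) (iarr s a_queue)
       (rarr s r_sgn) (last_entry col (col f) f) (ivar s i_k) (ivar s i_head)
       (ivar s i_tail) (ivar s i_root).
    move=> eb; apply: (search_visit valid inv (x := x) (k := k) (l := l)) => //.
      exact: (labelling_row2_same xk xl kl u lab ckl eb tt).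
    by left.
  wp_step; rewrite eval vf vg ek -eq_le.
  case: ifP => bal; wp_step; rewrite ?ek; wp_step; rewrite (hnext f fn); split.
  + exists (add_row E x), cur; rewrite !read_write /=.
    by apply: st => j; rewrite bal andbT.
  + by apply: search_measure_head; rewrite !read_write //= ek.
  + exists (add_row E x), cur; rewrite !read_write /=.
    by apply: st => j; rewrite bal andbF.
  + by apply: search_measure_head; rewrite !read_write //= ek.
(* An unvisited column is untouched: it is a component by itself, with sign 1 and a clear flag, so
   the merge rewrites the single position [l]. *)
have tl : iarr s a_tch l = 0%N.
  by apply/eqP; apply: contraNT lq => /(si_tch inv).
have cl := lab_untouched_comp lab tl.
have nkl : iarr s a_comp k <> iarr s a_comp l.
  by move=> e0; case/eqP: kl; apply: (lab_untouched lab tl).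
wp_step; rewrite ek.
wp_step; rewrite eval vf vg ek sub0r.
do 3!wp_step; wp_step; rewrite (hnext f fn) addn1; split.
  exists (add_row E x), cur; rewrite !read_write /=.
  apply: (search_visit valid inv (x := x) (k := k) (l := l)) => //.
    apply: (labelling_row2_diff (valid_sign valid) xk xl kl u lab nkl) => j.
    + rewrite cl /upd; case: eqP => [->|nj].
        by rewrite cl eqxx.
      case: eqP => // ej; case: nj.
      by rewrite (lab_untouched lab tl (k := l) (j := j)) // cl.
    + by rewrite cl (lab_untouched_bad lab tl) addn0; case: eqP => // ->.
    + exact: tt.
    + rewrite (lab_sgn1 lab tl) mulr1 cl /upd; case: eqP => [->|nj].
        by rewrite cl eqxx (lab_sgn1 lab tl) mul1r.
      case: eqP => // ej; case: nj.
      by rewrite (lab_untouched lab tl (k := l) (j := j)) // cl.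
  by right.
rewrite /search_measure !read_write /= ek.
by rewrite mkseq_upd ?(si_head inv) // ltn_add2r ltn_add2l.
Qed.

Lemma searchP s : input_ok s -> linked n ptr col s -> marked s ->
  (forall j, iarr s a_comp j = j /\ rarr s r_sgn j = 1) ->
  (forall j, [/\ iarr s a_bad j = 0%N, iarr s a_tch j = 0%N & iarr s a_vis j = 0%N]) ->
  run search s (1000 * (n + p).+1)
    (fun s' => labelling B (fun x => x \notin idx) (iarr s' a_comp) (iarr s' a_bad)
                 (iarr s' a_tch) (rarr s' r_sgn) /\ same_outside search s s').
Proof.
move=> inp lnk mk ini ini0; apply: run_same.
pose s1 := set_ivar (set_ivar (set_ivar (set_ivar s i_e 0%N) i_head 0%N) i_tail 0%N) i_root 0%N.
have st1 : search_state s1.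
  exists pred0, 0%N; split=> //.
  - by apply: labelling_init => // j; rewrite /s1 /=; have [? ?] := ini j; have [? ? ?] := ini0 j.
  - by move=> j; have [_ _ ->] := ini0 j.
  - by move=> j; have [_ -> _] := ini0 j.
have inp1 : input_ok s1 by [].
apply: (@run_weaken _ _ _ (2 + (2 + (2 + (2 + _))))%N); last by move=> s' Q; exact: Q.
  do 4 (apply: run_seq; first by [apply: (@run_wp _ (ISet _ _)); exact: erefl]; move=> _ <-).
  apply: run_weaken.
  - apply: (@run_loop _ _ _ search_measure search_state s1 st1) => s2 sm st2.
    apply: search_stepP => //.
    + exact: input_ok_same sm erefl inp1.
    + have [h1 h2 h3] := lnk; split=> e.
      * by rewrite (same_iarr (a := a_row) sm erefl); apply: h1.
      * by rewrite (same_iarr (a := a_next) sm erefl); apply: h2.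
      * by rewrite (same_iarr (a := a_first) sm erefl); apply: h3.
    + by move=> x; rewrite (same_iarr (a := a_mark) sm erefl); apply: mk.
  - exact: leqnn.
  - move=> s2 [[E [cur inv]] + sm].
    have [[_ ep _ _] _ _] := input_ok_same sm erefl inp1.
    rewrite /= negbK ep => /and3P[e0 th pr].
    apply: (search_end inv) => //; by apply/eqP; rewrite -leqn0.
(* The lists have total length at most [nnz], hence at most [2 * n]; the units of the columns and
   the roots contribute [p] each. *)
have le : (search_measure s1 <= 2 * n + 2 * p)%N.
  rewrite /search_measure /= /occurrences big_ord0 addn0 subn0 -/(occurrences _ _).
  rewrite (eq_bigl xpredT) // -[in X in (_ <= X)%N](mul1n p).
  have := sum_occurrences nnz; have := nnz_le valid.
  rewrite (eq_bigr (fun j : 'I_p => 1 + occurrences j nnz)%N) => [|j _]; last by rewrite add1n.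
  rewrite big_split /= sum1_card card_ord; lia.
rewrite [bcost _]/= [max_cost _]/=; lia.
Qed.

End SearchProgram.

(** * Adding one row to a labelling *)

Definition relabel_prepare : cmd :=
  seqs [:: ISet i_x (IGet a_idx (ISub (IVar i_nI) (IConst 1)));
    ISet i_c1 (IConst 0); ISet i_c2 (IConst 0); RSet x_sig (RConst 1);
    If (ilt (IGet a_ptr (IVar i_x)) (IGet a_ptr (IAdd (IVar i_x) (IConst 1))))
      (seqs [:: ISet i_f (IGet a_ptr (IVar i_x));
         ISet i_g (ISub (IGet a_ptr (IAdd (IVar i_x) (IConst 1))) (IConst 1));
         ISet i_k (IGet a_col (IVar i_f));
         ISet i_l (IGet a_col (IVar i_g));
         IPut a_tch (IVar i_k) (IConst 1);
         IPut a_tch (IVar i_l) (IConst 1);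
         ISet i_c1 (IGet a_comp (IVar i_k));
         ISet i_c2 (IGet a_comp (IVar i_l));
         If (ieq (IVar i_f) (IVar i_g))
           (IPut a_bad (IVar i_c1) (IConst 1))
           (If (ieq (IVar i_c1) (IVar i_c2))
              (If (rnonzero (RAdd (rentry i_f i_k) (rentry i_g i_l)))
                 (IPut a_bad (IVar i_c1) (IConst 1))
                 Skip)
              (seqs [::
                 IPut a_bad (IVar i_c1) (IAdd (IGet a_bad (IVar i_c1)) (IGet a_bad (IVar i_c2)));
                 RSet x_sig (RSub (RConst 0)
                               (RMul (rentry i_f i_k) (rentry i_g i_l)))]))])
      Skip].

(** When the new row merges nothing, the preparation leaves equal labels in [i_c1] and [i_c2] and
    the factor 1. The loop then changes nothing and can run unconditionally. *)
Definition relabel_columns : cmd :=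
  for_loop i_j i_p
    (If (ieq (IGet a_comp (IVar i_j)) (IVar i_c2))
       (seqs [:: IPut a_comp (IVar i_j) (IVar i_c1);
          RPut r_sgn (IVar i_j) (RMul (RGet r_sgn (IVar i_j)) (RVar x_sig))])
       Skip).

Definition relabel : cmd := Seq relabel_prepare relabel_columns.

Section Relabel.
Variables (R : rcfType) (n p m : nat) (B : 'M[R]_(n, p)) (idx : seq 'I_n).
Variables (ptr col : nat -> nat) (val wt wqs : nat -> R).
Hypothesis valid : valid_input B idx ptr col val.
Implicit Types (s : state R) (x : 'I_n) (j k l : 'I_p) (E : pred 'I_n).

Local Notation input_ok := (input_ok p m idx ptr col val wt wqs).

Lemma relabel_prepareP E s x : input_ok s ->
  labelling B E (iarr s a_comp) (iarr s a_bad) (iarr s a_tch) (rarr s r_sgn) ->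
  (0 < ivar s i_nI <= size idx)%N -> x = nth x idx (ivar s i_nI).-1 ->
  wp relabel_prepare (fun s' => forall (comp' : nat -> nat) (sgn' : nat -> R),
    (forall j, comp' j = if iarr s a_comp j == ivar s' i_c2 then ivar s' i_c1
                         else iarr s a_comp j) ->
    (forall j, sgn' j = if iarr s a_comp j == ivar s' i_c2
                        then rarr s r_sgn j * rvar s' x_sig else rarr s r_sgn j) ->
    labelling B (add_row E x) comp' (iarr s' a_bad) (iarr s' a_tch) sgn') s.
Proof.
move=> [[en ep _ _] [eptr ecol eidx] [eval _ _]] lab lt ex.
have triv bad tch (c : nat) (comp' : nat -> nat) (sgn' : nat -> R) :
    labelling B (add_row E x) (iarr s a_comp) bad tch (rarr s r_sgn) ->
    (forall j : 'I_p, comp' j = if iarr s a_comp j == c then c else iarr s a_comp j) ->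
    (forall j : 'I_p, sgn' j = if iarr s a_comp j == c then rarr s r_sgn j * 1
                        else rarr s r_sgn j) ->
    labelling B (add_row E x) comp' bad tch sgn'.
  move=> lab' ec es; apply: (labelling_ext lab') => // j.
  - by rewrite ec; case: eqP.
  - by rewrite es mulr1; case: ifP.
rewrite /relabel_prepare /rentry /ieq /rnonzero; cbn [seqs].
wp_step; rewrite subn1 eidx (nth_map x) -?ex; last by lia.
do 4!wp_step; rewrite eptr [(x + 1)%N]addn1 addn1.
case: (csrP valid x).
- move=> e0 x0; rewrite e0 ltnn; wp_step => comp' sgn'; rewrite ?read_write /=.
  by apply: triv; apply: labelling_row0 lab.
- move=> k e1 ck vk xk u; rewrite e1 leqnn.
  wp_step. wp_step. rewrite eptr addn1 e1 subn1 /=.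
  wp_step; rewrite ecol ck; wp_step; rewrite ecol ck.
  do 5!wp_step; rewrite leqnn /=.
  wp_step => comp' sgn'; rewrite ?read_write /=; apply: triv.
  apply: (labelling_row1 xk u lab) => j; rewrite /upd //.
  by rewrite -val_eqE /=; case: eqP.
move=> k l e1 kl [ck cl] [vk vl] [xk xl] u; rewrite e1 leqnSn.
wp_step; rewrite eptr; wp_step; rewrite eptr addn1 e1 subn1 /=.
wp_step; rewrite ecol ck; wp_step; rewrite ecol cl.
have tt : forall j, upd (upd (iarr s a_tch) k 1%N) l 1%N j =
    (if (j == k) || (j == l) then 1%N else iarr s a_tch j).
  by move=> j; rewrite /upd -!val_eqE orbC /=; case: eqP.
do 5!wp_step; rewrite ltnn andbF.
wp_step; rewrite -eqn_leq; case: eqP => ckl.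
  wp_step; rewrite eval vk vl -eq_le; case: ifP => bal; wp_step => comp' sgn';
    rewrite ?read_write /= -ckl; apply: triv;
    apply: (labelling_row2_same xk xl kl u lab ckl) => // j.
    by rewrite bal andbT.
  by rewrite bal andbF.
wp_step; wp_step; rewrite eval vk vl sub0r => comp' sgn'.
rewrite ?read_write /= => ec es.
apply: (labelling_row2_diff (valid_sign valid) xk xl kl u lab ckl) => // j.
by rewrite es mulrA.
Qed.

Lemma relabelP E s x : input_ok s ->
  labelling B E (iarr s a_comp) (iarr s a_bad) (iarr s a_tch) (rarr s r_sgn) ->
  (0 < ivar s i_nI <= size idx)%N -> x = nth x idx (ivar s i_nI).-1 ->
  run relabel s (600 * p.+1)
    (fun s' => labelling B (add_row E x) (iarr s' a_comp) (iarr s' a_bad)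
                 (iarr s' a_tch) (rarr s' r_sgn)).
Proof.
move=> inp lab lt ex.
have := run_same (run_wp (relabel_prepareP inp lab lt ex)) => H.
have T0 : (max_cost relabel_prepare + 100 * p.+1 <= 600 * p.+1)%N.
  by rewrite [max_cost _]/=; lia.
apply: run_weaken T0 (fun s' Q => Q).
apply: run_seq H _ => s1 [H sm].
have ep : ivar s1 i_p = p by have [[]] := input_ok_same sm erefl inp.
(* Pass [b] reads and writes position [b] only, so the labels from [b] on are still the old ones;
   the two roots are held in variables and survive the overwriting. *)
pose inv b (s' : state R) :=
  (forall j, iarr s' a_comp j = if (j < b)%N && (iarr s a_comp j == ivar s1 i_c2)
     then ivar s1 i_c1 else iarr s a_comp j) /\
  (forall j, rarr s' r_sgn j = if (j < b)%N && (iarr s a_comp j == ivar s1 i_c2)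
     then rarr s r_sgn j * rvar s1 x_sig else rarr s r_sgn j).
apply: (@run_weaken _ _ _ _ _ (fun s' => inv (ivar s1 i_p) s' /\
    same_outside relabel_columns s1 s')).
- apply: run_for => //.
    by split=> j; rewrite ?read_write ?(same_iarr (a := a_comp) sm erefl)
      ?(same_rarr (a := r_sgn) sm erefl).
  move=> s2 b sm2 eb ltb [ec es]; rewrite ep in ltb.
  have eb1 := ec (Ordinal ltb); have eb2 := es (Ordinal ltb).
  rewrite /= ltnn /= in eb1 eb2.
  rewrite /ieq; cbn [seqs]; wp_step; rewrite eb eb1 -eqn_leq.
  have c2 := same_ivar (x := i_c2) sm2 erefl.
  have c1 := same_ivar (x := i_c1) sm2 erefl.
  have sg := same_rvar (x := x_sig) sm2 erefl.
  rewrite c2; case: eqP => ecb.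
    wp_step; rewrite c1 eb; wp_step; rewrite eb eb2 sg.
    rewrite /inv ?read_write /=; split=> j; rewrite /upd ltnS leq_eqVlt.
      by case: eqP => [->|_] /=; rewrite ?ecb ?eqxx ?ec.
    by case: eqP => [->|_] /=; rewrite ?ecb ?eqxx ?es.
  wp_step; rewrite /inv ?read_write /=; split=> j; rewrite ltnS leq_eqVlt.
    by case: eqP => [->|_] /=; rewrite ?ec //= eb1; case: eqP.
  by case: eqP => [->|_] /=; rewrite ?es //= eb2; case: eqP.
- by rewrite ep [max_cost _]/=; lia.
move=> s2 [[ec es] sm2].
rewrite (same_iarr (a := a_bad) sm2 erefl) (same_iarr (a := a_tch) sm2 erefl).
by apply: H => j; rewrite ?ec ?es ep ltn_ord.
Qed.
End Relabel.

(** * Rows in compressed sparse format *)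

(** The condition [is_csr] for a single row ([is_csrE] holds by conversion), so that a matrix can be
    built one entry at a time. *)
Definition row_stored (R : pzRingType) (b : nat) (F : 'I_b -> R) (lo hi : nat)
    (col : nat -> nat) (val : nat -> R) : Prop :=
  [/\ (lo <= hi)%N,
      perm_eq [seq col e | e <- index_iota lo hi]
              [seq nat_of_ord j | j <- enum 'I_b & F j != 0]
    & forall (e : nat) (j : 'I_b), (lo <= e < hi)%N -> col e = j -> val e = F j].

Section RowStored.
Variable R : pzRingType.

Lemma row_stored0 b (F : 'I_b -> R) lo col val :
  (forall j, F j = 0) -> row_stored F lo lo col val.
Proof.
move=> F0; split=> //; last by move=> e j; lia.
rewrite /index_iota subnn /= (eq_filter (a2 := pred0)) ?filter_pred0 //.
by move=> j; rewrite /= F0 eqxx.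
Qed.

Lemma eq_row_stored b (F F' : 'I_b -> R) lo hi col val col' val' :
  (forall j, F' j = F j) ->
  (forall e, (e < hi)%N -> col' e = col e) ->
  (forall e, (e < hi)%N -> val' e = val e) ->
  row_stored F lo hi col val -> row_stored F' lo hi col' val'.
Proof.
move=> eF ec ev [le pe vs]; split=> //.
  rewrite (eq_filter (a2 := fun j => F j != 0)) => [|j]; last by rewrite eF.
  rewrite (_ : [seq col' e | e <- _] = [seq col e | e <- index_iota lo hi]) //.
  by apply/eq_in_map => e; rewrite mem_index_iota => /andP[_ /ec].
by move=> e j /andP[h1 h2]; rewrite ec // ev // eF; apply: vs; rewrite h1.
Qed.

Lemma row_stored_rcons b (F F' : 'I_b -> R) lo hi col val col' val' (j0 : 'I_b) v :
  row_stored F lo hi col val -> F j0 = 0 -> v != 0 ->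
  (forall j, F' j = if j == j0 then v else F j) ->
  (forall e, (e < hi)%N -> col' e = col e) -> col' hi = j0 ->
  (forall e, (e < hi)%N -> val' e = val e) -> val' hi = v ->
  row_stored F' lo hi.+1 col' val'.
Proof.
move=> [le pe vs] F0 v0 eF ec ech ev evh.
have eseq : [seq col' e | e <- index_iota lo hi] = [seq col e | e <- index_iota lo hi].
  by apply/eq_in_map => e; rewrite mem_index_iota => /andP[_ /ec].
split; first exact: leqW.
  rewrite /index_iota subSn // -addn1 iotaD map_cat /= subnKC // cats1 ech.
  rewrite perm_rcons -/(index_iota lo hi) eseq.
  rewrite (perm_trans (y := nat_of_ord j0 :: [seq nat_of_ord j | j <- enum 'I_b & F j != 0])) //.
    by rewrite perm_cons.
  rewrite -map_cons; apply: perm_map; apply: uniq_perm.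
  - by rewrite /= filter_uniq ?enum_uniq // mem_filter F0 eqxx.
  - by rewrite filter_uniq ?enum_uniq.
  - move=> j; rewrite inE mem_filter [in RHS]mem_filter !mem_enum !andbT eF.
    by case: eqP => [->|].
move=> e j /andP[h2]; rewrite ltnS leq_eqVlt => /orP[/eqP->|h1].
  by rewrite ech evh eF => /val_inj ->; rewrite eqxx.
(* No older position holds column [j0]: only columns with a non-zero value are stored, and [F j0]
   was zero. *)
rewrite ec // ev // => cj; rewrite eF; case: eqP => [jj|_]; last by apply: vs; rewrite ?h1 ?h2.
have : nat_of_ord j \in [seq col e | e <- index_iota lo hi].
  by rewrite -cj map_f // mem_index_iota h2.
rewrite (perm_mem pe) => /mapP[j' + /val_inj e'].
by rewrite mem_filter -e' jj F0 eqxx.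
Qed.

Lemma is_csrE a b (M : 'M[R]_(a, b)) ptr col val :
  is_csr M ptr col val <->
  forall i : 'I_a, row_stored (M i) (ptr i) (ptr i.+1) col val.
Proof. by []. Qed.

Lemma eq_is_csr a b (M : 'M[R]_(a, b)) ptr col val ptr' col' val' (N : nat) :
  (forall x, (x <= a)%N -> ptr' x = ptr x) ->
  (forall x, (x <= a)%N -> (ptr x <= N)%N) ->
  (forall e, (e < N)%N -> col' e = col e) ->
  (forall e, (e < N)%N -> val' e = val e) ->
  is_csr M ptr col val -> is_csr M ptr' col' val'.
Proof.
move=> ep pN ec ev csr; apply/is_csrE => i.
rewrite !ep ?(ltnW (ltn_ord i)) //; apply: eq_row_stored (csr i) => // e lt;
  by [apply: ec; apply: leq_trans lt _; apply: pN|apply: ev; apply: leq_trans lt _; apply: pN].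
Qed.

End RowStored.

Lemma filter_iotaS (a : pred nat) b : [seq k <- iota 0 b.+1 | a k] =
  if a b then rcons [seq k <- iota 0 b | a k] b else [seq k <- iota 0 b | a k].
Proof. by rewrite -addn1 iotaD filter_cat /= add0n; case: (a b); rewrite ?cats1 ?cats0. Qed.

Lemma sum_ltnS (R : nmodType) p (P : pred 'I_p) (F : 'I_p -> R) (b : 'I_p) :
  \sum_(k < p | (k < b.+1)%N && P k) F k =
  \sum_(k < p | (k < b)%N && P k) F k + (if P b then F b else 0).
Proof.
case: (boolP (P b)) => Pb.
  rewrite (bigD1 b) /= ?ltnSn // addrC; congr (_ + _); apply: eq_bigl => k.
  rewrite ltnS ltn_neqAle -val_eqE /=.
  by case: (nat_of_ord k == b); case: (P k); case: (k <= b)%N.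
rewrite addr0; apply: eq_bigl => k; rewrite ltnS leq_eqVlt andb_orl.
by rewrite (_ : _ && _ = false) //; apply/andP => -[/eqP/ord_inj ->]; rewrite (negbTE Pb).
Qed.

(** * Numbering the columns of a result and computing its weights *)

Definition new_column : cmd :=
  seqs [:: IPut a_num (IVar i_j) (IVar i_c);
    RPut r_W (IAdd (IVar i_wb) (IVar i_c)) (RConst 0);
    incr i_c].

Definition number_zero : cmd :=
  for_loop i_j i_p (If (ILe (IGet a_tch (IVar i_j)) (IConst 0)) new_column Skip).

Definition number_good : cmd :=
  for_loop i_j i_p
    (If (BAnd (ILe (IConst 1) (IGet a_tch (IVar i_j)))
           (BAnd (ieq (IGet a_comp (IVar i_j)) (IVar i_j))
              (ILe (IGet a_bad (IVar i_j)) (IConst 0))))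
       new_column Skip).

Definition weight_at (e : iexp) : iexp := IAdd (IVar i_wb) e.

Definition sum_weights : cmd :=
  for_loop i_j i_p
    (If (ILe (IGet a_bad (IGet a_comp (IVar i_j))) (IConst 0))
       (RPut r_W (weight_at (IGet a_num (IGet a_comp (IVar i_j))))
          (RAdd (RGet r_W (weight_at (IGet a_num (IGet a_comp (IVar i_j)))))
             (RDiv (RConst 1) (RGet r_w (IVar i_j)))))
       Skip).

Definition invert_weights : cmd :=
  for_loop i_j i_c
    (RPut r_W (weight_at (IVar i_j)) (RDiv (RConst 1) (RGet r_W (weight_at (IVar i_j))))).

Definition number_columns : cmd :=
  seqs [:: ISet i_c (IConst 0); number_zero; number_good; sum_weights; invert_weights].

Section Numbering.
Variables (R : rcfType) (n p m : nat) (B : 'M[R]_(n, p)) (idx : seq 'I_n).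
Variables (ptr col : nat -> nat) (val wt wqs : nat -> R).
Hypothesis valid : valid_input B idx ptr col val.
Implicit Types (s : state R) (x : 'I_n) (j k l : 'I_p) (E : pred 'I_n).

Local Notation input_ok := (input_ok p m idx ptr col val wt wqs).

(* [ord] lists the columns numbered so far, each represented by the root of
   its component. *)
Definition numbered (W0 : nat -> R) (wb : nat) (ord : seq nat) s : Prop :=
  [/\ ivar s i_wb = wb, ivar s i_c = size ord,
      forall t, (t < size ord)%N -> iarr s a_num (nth 0%N ord t) = t,
      forall t, (t < size ord)%N -> rarr s r_W (wb + t)%N = 0
    & forall y, (y < wb)%N -> rarr s r_W y = W0 y].

Lemma numbered_set_ivar W0 wb ord s v :
  numbered W0 wb ord s -> numbered W0 wb ord (set_ivar s i_j v).
Proof. by case=> *; split=> *; rewrite ?read_write; auto. Qed.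

Lemma new_columnP W0 wb ord s b :
  numbered W0 wb ord s -> ivar s i_j = b -> b \notin ord ->
  wp new_column (fun s' => numbered W0 wb (rcons ord b) (set_ivar s' i_j b.+1)) s.
Proof.
move=> [ew ec en e0 eW] eb bn; rewrite /new_column; cbn [seqs].
do 3!wp_step; rewrite eb ec ew addn1; split; rewrite ?read_write /= ?size_rcons //.
- move=> t; rewrite ltnS leq_eqVlt nth_rcons /upd => /orP[/eqP->|lt].
    by rewrite ltnn !eqxx.
  rewrite lt; case: eqP => [e|_]; last exact: en.
  by case/negP: bn; rewrite -e mem_nth.
- move=> t; rewrite ltnS leq_eqVlt /upd eqn_add2l => /orP[/eqP->|lt].
    by rewrite eqxx.
  by case: eqP => // _; apply: e0.
- by move=> y lt; rewrite /upd; case: eqP => [e|_]; [lia|apply: eW].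
Qed.

Section Loops.
Variables (E : pred 'I_n) (comp bad tch : nat -> nat) (sgn : nat -> R).
Hypothesis lab : labelling B E comp bad tch sgn.

Definition labels_of s : Prop :=
  [/\ iarr s a_comp = comp, iarr s a_bad = bad, iarr s a_tch = tch
    & rarr s r_sgn = sgn].

Let Z b := [seq k <- iota 0 b | tch k == 0%N].
Let Gd b := [seq k <- iota 0 b | [&& tch k != 0%N, comp k == k & bad k == 0%N]].
Local Notation ord := (result_order p comp bad tch).

Lemma number_zeroP W0 wb s : input_ok s -> labels_of s -> numbered W0 wb [::] s ->
  run number_zero s (100 * p.+1) (numbered W0 wb (Z p)).
Proof.
move=> inp [ec eb et es] num0.
have [[_ ep _ _] _ _] := inp.
apply: (@run_weaken _ _ _ _ _ (fun s' => numbered W0 wb (Z (ivar s i_p)) s' /\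
  same_outside number_zero s s')).
- apply: (@run_for _ _ _ _ (fun b => numbered W0 wb (Z b))) => //.
  move=> s2 b sm eb2 ltb num.
  wp_step; rewrite eb2 (same_iarr (a := a_tch) sm erefl) et leqn0.
  rewrite /Z filter_iotaS; case h: (tch b == 0%N); last first.
    by wp_step; apply: numbered_set_ivar.
  by apply: new_columnP => //; rewrite mem_filter mem_iota ltnn !andbF.
- by rewrite ep [max_cost _]/=; lia.
by move=> s' [+ _]; rewrite ep.
Qed.

Lemma number_goodP W0 wb s : input_ok s -> labels_of s -> numbered W0 wb (Z p) s ->
  run number_good s (100 * p.+1) (numbered W0 wb ord).
Proof.
move=> inp [ec eb et es] num0.
have [[_ ep _ _] _ _] := inp.
apply: (@run_weaken _ _ _ _ _ (fun s' => numbered W0 wb (Z p ++ Gd (ivar s i_p)) s' /\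
  same_outside number_good s s')).
- apply: (@run_for _ _ _ _ (fun b => numbered W0 wb (Z p ++ Gd b))) => //.
    by rewrite cats0; exact: (numbered_set_ivar 0 num0).
  move=> s2 b sm eb2 ltb num.
  wp_step; rewrite eb2 (same_iarr (a := a_tch) sm erefl) et.
  rewrite (same_iarr (a := a_comp) sm erefl) (same_iarr (a := a_bad) sm erefl).
  rewrite ec eb -eqn_leq leqn0 lt0n /Gd filter_iotaS; case h: [&& _, _ & _]; last first.
    by wp_step; apply: numbered_set_ivar.
  rewrite -rcons_cat; apply: new_columnP => //.
  rewrite mem_cat !mem_filter !mem_iota !add0n ltnn !andbF orbF.
  by case/andP: h => /negbTE->.
- by rewrite ep [max_cost _]/=; lia.
by move=> s' [+ _]; rewrite ep.
Qed.

Definition inv_weight (P : pred 'I_p) : R := \sum_(k < p | P k) (wt k)^-1.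

Definition weighted (W0 : nat -> R) (wb : nat) (f : nat -> R) s : Prop :=
  [/\ ivar s i_wb = wb, ivar s i_c = size ord,
      forall t, (t < size ord)%N -> iarr s a_num (nth 0%N ord t) = t,
      forall t, (t < size ord)%N -> rarr s r_W (wb + t)%N = f t
    & forall y, (y < wb)%N -> rarr s r_W y = W0 y].

Lemma weighted_set_ivar W0 wb f s v :
  weighted W0 wb f s -> weighted W0 wb f (set_ivar s i_j v).
Proof. by case=> *; split=> *; rewrite ?read_write; auto. Qed.

Lemma eq_weighted W0 wb f g s : (forall t, (t < size ord)%N -> f t = g t) ->
  weighted W0 wb f s -> weighted W0 wb g s.
Proof. by move=> e [? ? ? h ?]; split=> // t lt; rewrite -e // h. Qed.

Lemma sum_weightsP W0 wb s : input_ok s -> labels_of s -> numbered W0 wb ord s ->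
  run sum_weights s (100 * p.+1)
    (weighted W0 wb (fun t => inv_weight (fun k => comp k == nth 0%N ord t))).
Proof.
move=> inp [ec eb et es] num0.
have [[_ ep _ _] _ [_ ew _]] := inp.
pose f b t := inv_weight (fun k => (k < b)%N && (comp k == nth 0%N ord t)).
apply: (@run_weaken _ _ _ _ _ (fun s' => weighted W0 wb (f (ivar s i_p)) s' /\
  same_outside sum_weights s s')).
- apply: (@run_for _ _ _ _ (fun b => weighted W0 wb (f b))) => //.
    apply: weighted_set_ivar; case: num0 => h1 h2 h3 h4 h5; split=> // t lt.
    by rewrite h4 // /f /inv_weight big1.
  move=> s2 b sm eb2 ltb [h1 h2 h3 h4 h5]; rewrite ep in ltb.
  have fS t : f b.+1 t = f b t + (if comp b == nth 0%N ord t then (wt b)^-1 else 0).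
    exact: (sum_ltnS (fun k : 'I_p => comp k == nth 0%N ord t)
      (fun k : 'I_p => (wt k)^-1) (Ordinal ltb)).
  wp_step; rewrite eb2 (same_iarr (a := a_bad) sm erefl) (same_iarr (a := a_comp) sm erefl).
  rewrite ec eb leqn0.
  have cb := lab_lt lab (Ordinal ltb); have cc := lab_idem lab (Ordinal ltb).
  (* A root is numbered for this result exactly when its flag is clear. The test on [bad] thus
     guards against stale numbers in [a_num], which is not cleared between results. *)
  have mo := mem_result_order lab (comp b); rewrite cb cc eqxx /= in mo.
  case: ifP => b0; last first.
    wp_step; apply: weighted_set_ivar; split=> // t lt; rewrite h4 // fS.
    case: eqP => [e|_]; last by rewrite addr0.
    by move: mo; rewrite b0 e mem_nth.
  rewrite b0 in mo; rewrite /weight_at.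
  have it : (index (comp b) ord < size ord)%N by rewrite index_mem.
  have nt : iarr s2 a_num (comp b) = index (comp b) ord.
    by rewrite -[in LHS](nth_index 0%N mo) h3.
  wp_step; rewrite eb2 (same_iarr (a := a_comp) sm erefl) ec nt h1.
  rewrite (same_rarr (a := r_w) sm erefl) ew h4 // div1r.
  split; rewrite ?read_write /= //.
    move=> t lt; rewrite /upd eqn_add2l fS.
    have -> : (comp b == nth 0%N ord t) = (t == index (comp b) ord).
      apply/eqP/eqP => [->|->]; last by rewrite nth_index.
      by rewrite index_uniq // uniq_result_order.
    by case: eqP => [->|_] //; rewrite addr0 h4.
  by move=> y lt; rewrite /upd; case: eqP => [e|_]; [lia|apply: h5].
- by rewrite ep [max_cost _]/=; lia.
move=> s' [+ _]; rewrite ep; apply: eq_weighted => t _.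
by rewrite /f /inv_weight; apply: eq_bigl => k; rewrite ltn_ord.
Qed.

Lemma invert_weightsP W0 wb f s : input_ok s -> weighted W0 wb f s ->
  run invert_weights s (100 * (size ord).+1) (weighted W0 wb (fun t => (f t)^-1)).
Proof.
move=> inp w0; have ec : ivar s i_c = size ord by case: w0.
pose g b t := if (t < b)%N then (f t)^-1 else f t.
apply: (@run_weaken _ _ _ _ _ (fun s' => weighted W0 wb (g (ivar s i_c)) s' /\
  same_outside invert_weights s s')).
- apply: (@run_for _ _ _ _ (fun b => weighted W0 wb (g b))) => //.
  move=> s2 b sm eb2 ltb [h1 h2 h3 h4 h5]; rewrite ec in ltb.
  rewrite /weight_at; wp_step; rewrite eb2 h1 h4 // div1r.
  split; rewrite ?read_write /= //.
    move=> t lt; rewrite /upd eqn_add2l; case: eqP => [->|ne]; first by rewrite /g ltnn ltnSn.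
    by rewrite h4 // /g ltnS [(t <= b)%N]leq_eqVlt (introF eqP ne).
  by move=> y lt; rewrite /upd; case: eqP => [e|_]; [lia|apply: h5].
- by rewrite ec [max_cost _]/=; lia.
by move=> s' [+ _]; rewrite ec; apply: eq_weighted => t lt; rewrite /g lt.
Qed.

Lemma size_result_order_le : (size ord <= p)%N.
Proof.
rewrite -[leqRHS](size_iota 0); apply: uniq_leq_size; first exact: uniq_result_order.
by move=> i; rewrite (mem_result_order lab) mem_iota add0n => /andP[].
Qed.

Lemma number_columnsP s : input_ok s -> labels_of s ->
  run number_columns s (500 * p.+1)
    (fun s' => weighted (rarr s r_W) (ivar s i_wb)
       (fun t => (inv_weight (fun k => comp k == nth 0%N ord t))^-1) s' /\
       same_outside number_columns s s').
Proof.
move=> inp labs; apply: run_same.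
have keep c s1 s2 : same_outside c s1 s2 ->
  (all (fun z => z \notin writes c)
     ((2, a_comp) :: (2, a_bad) :: (2, a_tch) :: (3, r_sgn) :: writes_input)%N) ->
  input_ok s1 /\ labels_of s1 -> input_ok s2 /\ labels_of s2.
  move=> sm /= /and5P[w1 w2 w3 w4 w5] [i1 [e1 e2 e3 e4]]; split.
    exact: input_ok_same sm w5 i1.
  by split; rewrite ?(same_iarr sm w1) ?(same_iarr sm w2) ?(same_iarr sm w3) ?(same_rarr sm w4).
set W0 := rarr s r_W; set wb := ivar s i_wb.
apply: (@run_weaken _ _ _
  (2 + (100 * p.+1 + (100 * p.+1 + (100 * p.+1 + 100 * p.+1))))%N); last by move=> s' Q; exact: Q.
  apply: (run_seq (Q1 := fun s1 =>
    numbered W0 wb [::] s1 /\ same_outside (ISet i_c (IConst 0)) s s1)).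
    apply: run_same; apply: run_wp; wp_step.
    by split=> //; rewrite ?read_write.
  move=> s1 [num1 /keep/(_ isT)/(_ (conj inp labs))[inp1 labs1]].
  apply: (run_seq (run_same (number_zeroP inp1 labs1 num1))).
  move=> s2 [num2 /keep/(_ isT)/(_ (conj inp1 labs1))[inp2 labs2]].
  apply: (run_seq (run_same (number_goodP inp2 labs2 num2))).
  move=> s3 [num3 /keep/(_ isT)/(_ (conj inp2 labs2))[inp3 labs3]].
  apply: (run_seq (run_same (sum_weightsP inp3 labs3 num3))).
  move=> s4 [num4 /keep/(_ isT)/(_ (conj inp3 labs3))[inp4 labs4]].
  apply: run_weaken (invert_weightsP inp4 num4) _ _ => //.
  by have := size_result_order_le; lia.
lia.
Qed.

End Loops.
End Numbering.

(** * Writing one row of the boundary matrix and of the product *)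

Definition emit (c v : nat) : cmd :=
  seqs [:: IPut a_cB (IVar i_nz) (IGet a_num (IVar c));
    IPut a_cP (IVar i_nz) (IGet a_num (IVar c));
    RPut r_B (IVar i_nz) (RVar v);
    RPut r_P (IVar i_nz)
      (RDiv (RMul (RVar v) (RSqrt (RGet r_W (weight_at (IGet a_num (IVar c))))))
         (RVar x_s));
    incr i_nz].

Definition emit_good (c v : nat) : cmd :=
  If (BAnd (ILe (IGet a_bad (IVar c)) (IConst 0)) (rnonzero (RVar v))) (emit c v) Skip.

(** Two entries from one component fall into the same output column and are added before being
    written. They may cancel, and [emit_good] then drops the sum, since only non-zero entries may be
    stored. *)
Definition emit_entries : cmd :=
  Seq (If (ieq (IVar i_f) (IVar i_g)) Skip
         (If (ieq (IVar i_c1) (IVar i_c2))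
            (RSet x_v1 (RAdd (RVar x_v1) (RVar x_v2)))
            (emit_good i_c2 x_v2)))
      (emit_good i_c1 x_v1).

Definition emit_row : cmd :=
  seqs [:: IPut a_pB (IAdd (IVar i_h) (IVar i_j)) (IVar i_nz);
    IPut a_pP (IAdd (IVar i_h) (IVar i_j)) (IVar i_nz);
    ISet i_x (IGet a_idx (IVar i_j));
    RSet x_s (RSqrt (RGet r_wq (IAdd (IVar i_off) (IVar i_j))));
    If (ilt (IGet a_ptr (IVar i_x)) (IGet a_ptr (IAdd (IVar i_x) (IConst 1))))
      (seqs [:: ISet i_f (IGet a_ptr (IVar i_x));
         ISet i_g (ISub (IGet a_ptr (IAdd (IVar i_x) (IConst 1))) (IConst 1));
         ISet i_k (IGet a_col (IVar i_f));
         ISet i_l (IGet a_col (IVar i_g));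
         ISet i_c1 (IGet a_comp (IVar i_k));
         ISet i_c2 (IGet a_comp (IVar i_l));
         RSet x_v1 (rentry i_f i_k);
         RSet x_v2 (rentry i_g i_l);
         emit_entries])
      Skip].

Section Rows.
Variables (R : rcfType) (n p m : nat) (B : 'M[R]_(n, p)) (idx : seq 'I_n).
Variables (ptr col : nat -> nat) (val wt wqs : nat -> R).
Hypothesis valid : valid_input B idx ptr col val.
Variables (E : pred 'I_n) (comp bad tch : nat -> nat) (sgn : nat -> R).
Hypothesis lab : labelling B E comp bad tch sgn.
Implicit Types (s : state R) (x : 'I_n) (j k l : 'I_p).

Local Notation input_ok := (input_ok p m idx ptr col val wt wqs).
Local Notation ord := (result_order p comp bad tch).

Variable D : 'I_(size ord) -> R.
Hypothesis D_gt0 : forall t, 0 < D t.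

Definition row_value x (t : 'I_(size ord)) : R :=
  \sum_(k < p | comp k == nth 0%N ord t) B x k * sgn k.

Definition numbering_ok s : Prop :=
  [/\ input_ok s, labels_of comp bad tch sgn s,
      forall t, (t < size ord)%N -> iarr s a_num (nth 0%N ord t) = t
    & forall t : 'I_(size ord), rarr s r_W (ivar s i_wb + t)%N = D t].

Lemma numbering_ok_same c s s' : same_outside c s s' ->
  (all (fun z => z \notin writes c)
     [:: (0, i_wb); (2, a_comp); (2, a_bad); (2, a_tch); (2, a_num); (3, r_sgn);
         (3, r_W)]%N) = true ->
  (all (fun z => z \notin writes c) writes_input) = true ->
  numbering_ok s -> numbering_ok s'.
Proof.
move=> sm /= /and5P[w1 w2 w3 w4 /and4P[w5 w6 w7 _]] wi [inp [e1 e2 e3 e4] h3 h4].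
split.
- exact: input_ok_same sm wi inp.
- by split; rewrite ?(same_iarr sm w2) ?(same_iarr sm w3) ?(same_iarr sm w4) ?(same_rarr sm w6).
- by move=> t lt; rewrite (same_iarr sm w5) h3.
- by move=> t; rewrite (same_rarr sm w7) (same_ivar sm w1).
Qed.

Definition row_state (F : 'I_(size ord) -> R) (lo : nat) (sq : R) s : Prop :=
  row_stored F lo (ivar s i_nz) (iarr s a_cB) (rarr s r_B) /\
  row_stored (fun t => sq^-1 * F t * Num.sqrt (D t)) lo (ivar s i_nz)
    (iarr s a_cP) (rarr s r_P).

Definition prefix_kept (N : nat) s s' : Prop :=
  [/\ (N <= ivar s' i_nz)%N,
      forall y, (y < N)%N -> iarr s' a_cB y = iarr s a_cB y,
      forall y, (y < N)%N -> iarr s' a_cP y = iarr s a_cP y,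
      forall y, (y < N)%N -> rarr s' r_B y = rarr s r_B y
    & forall y, (y < N)%N -> rarr s' r_P y = rarr s r_P y].

(** The row and column factors of the product are positive, so both matrices have the same non-zero
    pattern and can be written at the same positions. *)
Lemma emitP c v F F' lo sq N s s0 (t0 : 'I_(size ord)) :
  row_state F lo sq s -> prefix_kept N s0 s ->
  numbering_ok s -> ivar s c = nth 0%N ord t0 -> F t0 = 0 ->
  rvar s v != 0 -> rvar s x_s = sq -> sq != 0 ->
  (forall t, F' t = if t == t0 then rvar s v else F t) ->
  wp (emit c v) (fun s' => row_state F' lo sq s' /\ prefix_kept N s0 s') s.
Proof.
move=> [rB rP] [lN k1 k2 k3 k4] [inp _ hnum hW] ec F0 v0 es sq0 eF.
rewrite /emit /weight_at; cbn [seqs].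
wp_step; rewrite ec hnum //.
wp_step; rewrite ec hnum //.
wp_step; wp_step; rewrite ec hnum // hW es.
wp_step; rewrite addn1.
have keep (T : Type) (f : nat -> T) (a : T) y : (y < ivar s i_nz)%N ->
    upd f (ivar s i_nz) a y = f y.
  by move=> lt; rewrite /upd; case: eqP => // e; move: lt; rewrite e ltnn.
split; last first.
  split; rewrite ?read_write /= //; first exact: leqW;
    by move=> y lt; rewrite keep; auto; apply: leq_trans lt lN.
split; rewrite ?read_write /=.
  by apply: (row_stored_rcons rB F0 v0 eF); rewrite ?upd_eq //; apply: keep.
apply: (row_stored_rcons rP (j0 := t0) (v := sq^-1 * rvar s v * Num.sqrt (D t0))).
- by rewrite F0 mulr0 mul0r.
- by rewrite !mulf_neq0 ?invr_neq0 // gt_eqF // sqrtr_gt0.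
- by move=> t; rewrite eF; case: eqP => [->|].
- exact: keep.
- by rewrite upd_eq.
- exact: keep.
- by rewrite upd_eq mulrC mulrA.
Qed.

Lemma comp_in_order k : bad (comp k) = 0%N -> exists t : 'I_(size ord),
  comp k = nth 0%N ord t /\ (forall t' : 'I_(size ord), (comp k == nth 0%N ord t') = (t' == t)).
Proof.
move=> b0; have := mem_result_order lab (comp k).
rewrite (lab_lt lab) (lab_idem lab) b0 !eqxx /= => ck.
have lt : (index (comp k) ord < size ord)%N by rewrite index_mem.
exists (Ordinal lt); split=> [|t']; first by rewrite /= nth_index.
rewrite -[X in X == _](nth_index 0%N ck) nth_uniq ?uniq_result_order //.
by rewrite -val_eqE eq_sym.
Qed.

Lemma comp_notin_order k (t : 'I_(size ord)) : bad (comp k) != 0%N ->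
  (comp k == nth 0%N ord t) = false.
Proof.
move=> b0; apply/eqP => e; have := mem_result_order lab (comp k).
by rewrite (negbTE b0) !andbF e mem_nth.
Qed.

Lemma row_value1 x k t : (forall l, B x l != 0 -> l = k) ->
  row_value x t = if comp k == nth 0%N ord t then B x k * sgn k else 0.
Proof.
move=> u; rewrite /row_value big_mkcond (bigD1 k) //= big1 ?addr0 // => l lk.
case: ifP => // _; suff -> : B x l = 0 by rewrite mul0r.
by apply/eqP; apply: contraNT lk => /u->.
Qed.

Lemma row_value2 x k l t : k != l -> (forall j, B x j != 0 -> j = k \/ j = l) ->
  row_value x t = (if comp k == nth 0%N ord t then B x k * sgn k else 0) +
                  (if comp l == nth 0%N ord t then B x l * sgn l else 0).
Proof.
move=> kl u; rewrite /row_value big_mkcond (bigD1 k) //= (bigD1 l) 1?eq_sym //=.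
rewrite big1 ?addr0 // => j /andP[jk jl].
case: ifP => // _; suff -> : B x j = 0 by rewrite mul0r.
by apply/eqP; apply: contraTT isT => /u[] e; move: jk jl; rewrite e eqxx.
Qed.

Lemma eq_row_state F F' lo sq s : (forall t, F' t = F t) ->
  row_state F lo sq s -> row_state F' lo sq s.
Proof.
move=> e [h1 h2]; split; [apply: eq_row_stored h1|apply: eq_row_stored h2] => // t.
by rewrite e.
Qed.

Lemma emit_goodP c v F F' lo sq N s s0 k :
  row_state F lo sq s -> prefix_kept N s0 s ->
  numbering_ok s -> ivar s c = comp k -> rvar s x_s = sq -> sq != 0 ->
  (forall t : 'I_(size ord), comp k == nth 0%N ord t -> F t = 0) ->
  (forall t : 'I_(size ord), F' t = if comp k == nth 0%N ord t then rvar s v else F t) ->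
  wp (emit_good c v) (fun s' => row_state F' lo sq s' /\ prefix_kept N s0 s') s.
Proof.
move=> rs pk nok ec es sq0 F0 eF.
have [_ [_ eb _ _] _ _] := nok.
rewrite /emit_good /rnonzero; wp_step; rewrite ec eb leqn0 -eq_le.
case: (boolP (bad (comp k) == 0%N)) => [/eqP b0|nb] /=; last first.
  by wp_step; split=> //; apply: eq_row_state rs => t; rewrite eF comp_notin_order.
have [t0 [e0 et]] := comp_in_order b0.
case: (boolP (rvar s v == 0)) => [/eqP v0|v0] /=.
  wp_step; split=> //; apply: eq_row_state rs => t; rewrite eF.
  by case: ifP => // /F0 ->.
apply: emitP rs pk nok _ _ v0 es sq0 _; first by rewrite ec e0.
  by apply: F0; rewrite et.
by move=> t; rewrite eF et.
Qed.

Lemma emit_entriesP sq N s s0 x :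
  numbering_ok s -> row_state (fun=> 0) N sq s -> prefix_kept N s0 s ->
  rvar s x_s = sq -> sq != 0 ->
  (exists k, [/\ ivar s i_f = ivar s i_g, ivar s i_c1 = comp k,
      rvar s x_v1 = B x k * sgn k & forall l, B x l != 0 -> l = k]) \/
  (exists k l, [/\ ivar s i_f <> ivar s i_g, k != l,
      (ivar s i_c1 = comp k /\ ivar s i_c2 = comp l),
      (rvar s x_v1 = B x k * sgn k /\ rvar s x_v2 = B x l * sgn l)
    & forall j, B x j != 0 -> j = k \/ j = l]) ->
  wp emit_entries
    (fun s' => row_state (row_value x) N sq s' /\ prefix_kept N s0 s') s.
Proof.
move=> nok rs pk es sq0 H; rewrite /emit_entries /ieq; wp_step; rewrite -eqn_leq.
case: H => [[k [fg ec ev u]]|[k [l [fg kl [ec1 ec2] [ev1 ev2] u]]]].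
  rewrite fg eqxx; wp_step; apply: (emit_goodP rs pk nok ec es sq0) => // t.
  by rewrite ev; apply: row_value1.
rewrite (introF eqP fg); wp_step; rewrite ec1 ec2 -eqn_leq.
case: eqP => ekl.
  rewrite wp_rset; cbn [reval]; rewrite ev1 ev2.
  set s1 := set_rvar _ _ _.
  have rs1 : row_state (fun=> 0) N sq s1.
    by case: rs => h1 h2; split; rewrite ?read_write.
  have pk1 : prefix_kept N s0 s1 by case: pk => *; split; rewrite ?read_write.
  have nok1 : numbering_ok s1.
    case: nok => -[[? ? ? ?] [? ? ?] [? ? ?]] [? ? ? ?] h3 h4.
    by split=> [||t lt|t]; rewrite ?read_write ?h3 ?h4 //; split; try split;
      rewrite ?read_write.
  apply: (emit_goodP rs1 pk1 nok1 (k := k)); rewrite ?read_write //= => t.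
  by rewrite (row_value2 _ kl u) -ekl; case: ifP => //; rewrite addr0.
(* The row after only its second entry has been written. The labels differ, so the remaining entry
   goes to a column where [F1] is zero. *)
pose F1 (t : 'I_(size ord)) := if comp l == nth 0%N ord t then rvar s x_v2 else 0.
have := emit_goodP (F' := F1) (v := x_v2) rs pk nok ec2 es sq0 (fun _ _ => erefl) (fun _ => erefl).
move/wp_same; apply: wp_sub => s1 [[rs1 pk1] sm].
have nok1 := numbering_ok_same sm erefl erefl nok.
apply: (emit_goodP (k := k) rs1 pk1 nok1) => //.
- by rewrite (same_ivar sm).
- by rewrite (same_rvar sm).
- move=> t /eqP e; rewrite /F1; case: eqP => // e'; case: ekl.
  by rewrite e e'.
move=> t; rewrite (same_rvar sm) // ev1 (row_value2 _ kl u) /F1 ev2.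
case: eqP => [e|_]; last by rewrite add0r.
by case: eqP => [e'|_]; rewrite ?addr0 //; case: ekl; rewrite e e'.
Qed.

Lemma emit_rowP s x : numbering_ok s -> (ivar s i_j < size idx)%N ->
  x = nth x idx (ivar s i_j) -> 0 < wqs (ivar s i_off + ivar s i_j)%N ->
  wp emit_row (fun s' =>
    [/\ row_state (row_value x) (ivar s i_nz)
          (Num.sqrt (wqs (ivar s i_off + ivar s i_j)%N)) s',
        prefix_kept (ivar s i_nz) s s',
        iarr s' a_pB = upd (iarr s a_pB) (ivar s i_h + ivar s i_j)%N (ivar s i_nz)
      & iarr s' a_pP = upd (iarr s a_pP) (ivar s i_h + ivar s i_j)%N (ivar s i_nz)]) s.
Proof.
move=> nok ltj ex wq0.
have [[[_ _ _ _] [eptr ecol eidx] [eval _ ewq]] [ec eb _ es] hnum hW] := nok.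
set sq := Num.sqrt _.
have sq0 : sq != 0 by rewrite gt_eqF // sqrtr_gt0.
have row0 (F : 'I_(size ord) -> R) s1 : (forall t, F t = 0) -> row_state F (ivar s1 i_nz) sq s1.
  move=> F0; split; apply: row_stored0 => // t.
  by rewrite F0 mulr0 mul0r.
rewrite /emit_row /rentry; cbn [seqs].
wp_step; wp_step; wp_step; rewrite eidx (nth_map x) // -ex.
wp_step; rewrite ewq -/sq.
wp_step; rewrite eptr !addn1.
have fin s1 : ivar s1 i_nz = ivar s i_nz -> iarr s1 a_cB = iarr s a_cB ->
  iarr s1 a_cP = iarr s a_cP -> rarr s1 r_B = rarr s r_B -> rarr s1 r_P = rarr s r_P ->
  prefix_kept (ivar s i_nz) s s1.
  by move=> e1 e2 e3 e4 e5; split=> [|y _|y _|y _|y _]; rewrite ?e1 ?e2 ?e3 ?e4 ?e5.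
have clos S : ivar S i_nz = ivar s i_nz -> iarr S a_cB = iarr s a_cB ->
  iarr S a_cP = iarr s a_cP -> rarr S r_B = rarr s r_B -> rarr S r_P = rarr s r_P ->
  iarr S a_pB = upd (iarr s a_pB) (ivar s i_h + ivar s i_j)%N (ivar s i_nz) ->
  iarr S a_pP = upd (iarr s a_pP) (ivar s i_h + ivar s i_j)%N (ivar s i_nz) ->
  rvar S x_s = sq -> numbering_ok S ->
  (exists k, [/\ ivar S i_f = ivar S i_g, ivar S i_c1 = comp k,
      rvar S x_v1 = B x k * sgn k & forall l, B x l != 0 -> l = k]) \/
  (exists k l, [/\ ivar S i_f <> ivar S i_g, k != l,
      (ivar S i_c1 = comp k /\ ivar S i_c2 = comp l),
      (rvar S x_v1 = B x k * sgn k /\ rvar S x_v2 = B x l * sgn l)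
    & forall j, B x j != 0 -> j = k \/ j = l]) ->
  wp emit_entries (fun s' =>
    [/\ row_state (row_value x) (ivar s i_nz) sq s',
        prefix_kept (ivar s i_nz) s s',
        iarr s' a_pB = upd (iarr s a_pB) (ivar s i_h + ivar s i_j)%N (ivar s i_nz)
      & iarr s' a_pP = upd (iarr s a_pP) (ivar s i_h + ivar s i_j)%N (ivar s i_nz)]) S.
  move=> enz e1 e2 e3 e4 e5 e6 ex_s nokS H.
  have rs := row0 (fun=> 0) S (fun _ => erefl); rewrite enz in rs.
  have := emit_entriesP nokS rs (fin _ enz e1 e2 e3 e4) ex_s sq0 H.
  move/wp_same; apply: wp_sub => s1 [[rs1 pk1] sm]; split=> //.
    by rewrite (same_iarr (a := a_pB) sm).
  by rewrite (same_iarr (a := a_pP) sm).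
case: (csrP valid x) => [e1 x0|k e1 ck vk xk u|k l e1 kl [ck cl] [vk vl] [xk xl] u].
- rewrite e1 ltnn; wp_step; split; rewrite ?read_write //=.
    set S := set_rvar _ _ _.
    have -> : ivar s i_nz = ivar S i_nz by rewrite /S ?read_write.
    by apply: row0 => t; rewrite /row_value big1 // => k _; rewrite x0 mul0r.
- rewrite e1 leqnn.
  wp_step; rewrite eptr; wp_step; rewrite eptr addn1 e1 subn1 /=.
  wp_step; rewrite ecol ck; wp_step; rewrite ecol ck.
  wp_step; rewrite ec; wp_step; rewrite ec.
  wp_step; rewrite eval vk es; wp_step; rewrite eval vk es.
  apply: clos; rewrite ?read_write //=.
  by left; exists k.
rewrite e1 leqnSn.
wp_step; rewrite eptr; wp_step; rewrite eptr addn1 e1 subn1 /=.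
wp_step; rewrite ecol ck; wp_step; rewrite ecol cl.
wp_step; rewrite ec; wp_step; rewrite ec.
wp_step; rewrite eval vk es; wp_step; rewrite eval vl es.
apply: clos; rewrite ?read_write //=.
right; exists k, l; split=> //; lia.
Qed.
End Rows.

(** * Output of one pair and its product *)

Definition emit_rows : cmd := for_loop i_j i_nI emit_row.

Definition write_headers : cmd :=
  seqs [:: IPut a_pB (IAdd (IVar i_h) (IVar i_nI)) (IVar i_nz);
    IPut a_pP (IAdd (IVar i_h) (IVar i_nI)) (IVar i_nz);
    IPut a_ncols (IVar i_i) (IVar i_c);
    IPut a_hB (IVar i_i) (IVar i_h);
    IPut a_hP (IVar i_i) (IVar i_h);
    IPut a_hW (IVar i_i) (IVar i_wb);
    ISet i_h (IAdd (IAdd (IVar i_h) (IVar i_nI)) (IConst 1));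
    ISet i_wb (IAdd (IVar i_wb) (IVar i_c))].

Definition output : cmd := seqs [:: number_columns; emit_rows; write_headers].

(** The length of the column order equals the width of the result matrix only propositionally, so
    entries are matched by the numerical value of their index. *)
Lemma row_stored_cast (R : pzRingType) b b' (F : 'I_b -> R) (F' : 'I_b' -> R) lo hi col val :
  b = b' -> (forall (j : 'I_b) (j' : 'I_b'), j = j' :> nat -> F j = F' j') ->
  row_stored F lo hi col val -> row_stored F' lo hi col val.
Proof.
move=> e; subst b' => eF; apply: eq_row_stored => // j.
by rewrite (eF j j).
Qed.

Section Output.
Variables (R : rcfType) (n p m : nat) (B : 'M[R]_(n, p)) (idx : seq 'I_n).
Variables (ptr col : nat -> nat) (val wt wqs : nat -> R).
Hypothesis valid : valid_input B idx ptr col val.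
Variable w : 'rV[R]_p.
Hypothesis wtE : forall k : 'I_p, wt k = w 0 k.
Hypothesis w_gt0 : forall k : 'I_p, 0 < w 0 k.
Implicit Types (s : state R) (x : 'I_n) (j k l : 'I_p).

Local Notation input_ok := (input_ok p m idx ptr col val wt wqs).

Section Rows.
Variables (E : pred 'I_n) (comp bad tch : nat -> nat) (sgn : nat -> R).
Hypothesis lab : labelling B E comp bad tch sgn.
Local Notation ord := (result_order p comp bad tch).
Variable D : 'I_(size ord) -> R.
Hypothesis D_gt0 : forall t, 0 < D t.
Local Notation numbering_ok := (numbering_ok m idx ptr col val wt wqs sgn D).
Local Notation row_value := (row_value B sgn (p := p) (comp := comp) (bad := bad) (tch := tch)).

(** The pointer that closes the last finished row is stored only when the next row begins, or with
    the headers; until then its value is the current [i_nz]. *)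
Definition row_start (h b : nat) s (a : nat) : nat :=
  if (a < b)%N then iarr s a_pB (h + a)%N else ivar s i_nz.

Definition rows_done (s0 : state R) (b : nat) s : Prop :=
  let h := ivar s0 i_h in
  [/\ prefix_kept (ivar s0 i_nz) s0 s,
      (forall y, (y < h)%N -> iarr s a_pB y = iarr s0 a_pB y) /\
      (forall y, (y < h)%N -> iarr s a_pP y = iarr s0 a_pP y),
      forall a, (a < b)%N -> iarr s a_pP (h + a)%N = iarr s a_pB (h + a)%N,
      forall a, (a <= b)%N -> (row_start h b s a <= ivar s i_nz)%N
    & forall a x, (a < b)%N -> x = nth x idx a ->
        row_stored (row_value x) (row_start h b s a) (row_start h b s a.+1)
          (iarr s a_cB) (rarr s r_B) /\
        row_stored (fun t => (Num.sqrt (wqs (ivar s0 i_off + a)%N))^-1 *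
            row_value x t * Num.sqrt (D t))
          (row_start h b s a) (row_start h b s a.+1) (iarr s a_cP) (rarr s r_P)].

Lemma emit_rowsP s : numbering_ok s -> (ivar s i_nI <= size idx)%N ->
  (forall a, (a < ivar s i_nI)%N -> 0 < wqs (ivar s i_off + a)%N) ->
  run emit_rows s (500 * (ivar s i_nI).+1)
    (fun s' => rows_done s (ivar s i_nI) s' /\ same_outside emit_rows s s').
Proof.
move=> nok le wq0.
apply: (@run_weaken _ _ _ _ _ (fun s' => rows_done s (ivar s i_nI) s' /\
    same_outside emit_rows s s')); last by [].
  apply: (@run_for _ _ _ _ (rows_done s)) => //.
  move=> s2 b sm eb ltb [pk [kB kP] ePB leP0 rows].
  have nok2 := numbering_ok_same sm erefl erefl nok.
  have ltidx : (ivar s2 i_j < size idx)%N by rewrite eb; apply: leq_trans ltb le.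
  have eoff := same_ivar (x := i_off) sm erefl.
  have eh := same_ivar (x := i_h) sm erefl.
  have x : 'I_n by case: idx ltidx.
  pose xb := nth x idx b.
  have exb : xb = nth xb idx (ivar s2 i_j).
    by rewrite eb /xb; apply: set_nth_default; rewrite -eb.
  have wq2 : 0 < wqs (ivar s2 i_off + ivar s2 i_j)%N by rewrite eb eoff; apply: wq0.
  have := emit_rowP valid lab D_gt0 nok2 ltidx exb wq2.
  apply: wp_sub => s3 [[rB rP] pk3 eB eP].
  rewrite eb eoff eh in rB rP eB eP.
  set h := ivar s i_h in eB eP kB kP ePB leP0 rows.
  have rs a : (a <= b)%N -> row_start h b.+1 s3 a = row_start h b s2 a.
    rewrite /row_start ltnS => ab; rewrite ab eB /upd eqn_add2l.
    by case: (ltngtP a b) ab => // ->.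
  have rs1 : row_start h b.+1 s3 b.+1 = ivar s3 i_nz by rewrite /row_start ltnn.
  have rsb : row_start h b s2 b = ivar s2 i_nz by rewrite /row_start ltnn.
  have nz23 : (ivar s2 i_nz <= ivar s3 i_nz)%N by case: pk3.
  have nz02 : (ivar s i_nz <= ivar s2 i_nz)%N by case: pk.
  suff Hd : rows_done s b.+1 s3.
    case: Hd => -[? ? ? ? ?] [? ?] ? h1 h2.
    by split; rewrite /row_start ?read_write //; split; rewrite ?read_write.
  rewrite /rows_done -/h; split.
  + case: pk => _ p1 p2 p3 p4; case: pk3 => _ q1 q2 q3 q4.
    by split=> [|y lt|y lt|y lt|y lt]; first exact: leq_trans nz02 nz23;
      have lt' := leq_trans lt nz02; rewrite ?q1 ?q2 ?q3 ?q4 ?p1 ?p2 ?p3 ?p4.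
  + by split=> y lt; rewrite ?eB ?eP upd_neq ?kB ?kP //; lia.
  + move=> a; rewrite ltnS eB eP /upd eqn_add2l => ab.
    by case: eqP => // ne; apply: ePB; rewrite ltn_neqAle ab (introF eqP ne).
  + move=> a; rewrite leq_eqVlt => /orP[/eqP->|]; first by rewrite rs1.
    by rewrite ltnS => ab; rewrite rs //; apply: leq_trans (leP0 _ ab) nz23.
  + move=> a y; rewrite ltnS leq_eqVlt => /orP[/eqP->|ab] ey.
      have -> : y = xb by rewrite ey /xb; apply: set_nth_default; rewrite -eb.
      by rewrite rs1 rs // rsb.
    rewrite !rs //; last exact: ltnW.
    have [rB2 rP2] := rows a y ab ey.
    have lea e : (e < row_start h b s2 a.+1)%N -> (e < ivar s2 i_nz)%N.
      by move=> lt; apply: leq_trans lt (leP0 _ ab).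
    case: pk3 => _ q1 q2 q3 q4.
    by split; [apply: eq_row_stored rB2|apply: eq_row_stored rP2] => // e /lea lt; auto.
by rewrite [max_cost _]/=; lia.
Qed.

End Rows.

(** [H], [N] and [W] bound the memory occupied by the result in the pointer, entry and weight
    arrays. Later results write above these bounds, which is why the result survives. *)
Definition result_at s (i nI : nat) (wqf : nat -> R) (H N W : nat) : Prop :=
  exists (Cs : 'I_#|reg_components B (take nI idx)| -> {set 'I_p})
         (eps : 'I_#|reg_components B (take nI idx)| -> {ffun 'I_p -> bool}),
  [/\ is_choice Cs eps,
      outputs_pair s i (pers_boundary Cs eps) (diag_mx (pers_weights w Cs)),
      outputs_product s i
        (pers_product w Cs eps (\row_(a < size (take nI idx)) wqf a))
    & [/\ (iarr s a_hB i + nI < H)%N, (iarr s a_hP i + nI < H)%N,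
          forall x : nat, (x <= nI)%N -> (iarr s a_pB (iarr s a_hB i + x) <= N)%N,
          forall x : nat, (x <= nI)%N -> (iarr s a_pP (iarr s a_hP i + x) <= N)%N
        & (iarr s a_hW i + (#|zero_cols B (take nI idx)| +
             #|reg_components B (take nI idx)|) <= W)%N]].

Definition kept (i H N W : nat) s s' : Prop :=
  [/\ (forall y, (y < H)%N -> iarr s' a_pB y = iarr s a_pB y) /\
      (forall y, (y < H)%N -> iarr s' a_pP y = iarr s a_pP y),
      (forall y, (y < N)%N -> iarr s' a_cB y = iarr s a_cB y) /\
      (forall y, (y < N)%N -> iarr s' a_cP y = iarr s a_cP y),
      (forall y, (y < N)%N -> rarr s' r_B y = rarr s r_B y) /\
      (forall y, (y < N)%N -> rarr s' r_P y = rarr s r_P y),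
      (forall y, (y < W)%N -> rarr s' r_W y = rarr s r_W y)
    & [/\ forall i', i' != i -> iarr s' a_ncols i' = iarr s a_ncols i',
          forall i', i' != i -> iarr s' a_hB i' = iarr s a_hB i',
          forall i', i' != i -> iarr s' a_hP i' = iarr s a_hP i'
        & forall i', i' != i -> iarr s' a_hW i' = iarr s a_hW i']].

Lemma result_at_kept s s' i i' nI wqf H N W : i' != i -> (nI <= size idx)%N ->
  kept i H N W s s' ->
  result_at s i' nI wqf H N W -> result_at s' i' nI wqf H N W.
Proof.
move=> ne le [[k1 k2] [k3 k4] [k5 k6] k7 [k8 k9 k10 k11]].
have szI : size (take nI idx) = nI by rewrite size_takel.
case=> Cs [eps [ch [o1 o2 o3] op [f1 f2 f3 f4 f5]]]; exists Cs, eps; split=> //.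
- split; rewrite ?k8 //.
    apply: (eq_is_csr (N := N) _ _ _ _ o2) => [x|x|e|e]; rewrite ?szI; auto.
    by move=> xI; rewrite k9 // k1 //; lia.
  by move=> j; rewrite k11 // k7 //; apply: leq_trans f5; rewrite ltn_add2l.
- rewrite /outputs_product; apply: (eq_is_csr (N := N) _ _ _ _ op) => [x|x|e|e]; rewrite ?szI; auto.
  by move=> xI; rewrite k10 // k2 //; lia.
- rewrite k9 // k10 // k11 //; split=> // x xI.
    by rewrite k1 ?f3 //; lia.
  by rewrite k2 ?f4 //; lia.
Qed.

Lemma result_at_le s i nI wqf H N W H' N' W' : (H <= H')%N -> (N <= N')%N ->
  (W <= W')%N -> result_at s i nI wqf H N W -> result_at s i nI wqf H' N' W'.
Proof.
move=> hH hN hW [Cs [eps [ch o1 op [f1 f2 f3 f4 f5]]]]; exists Cs, eps; split=> //.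
by split=> [||x /f3|x /f4|]; lia.
Qed.

Lemma write_headersP s (i := ivar s i_i) (h := ivar s i_h) (nI := ivar s i_nI)
    (nz := ivar s i_nz) (wb := ivar s i_wb) :
  wp write_headers (fun s' =>
    [/\ iarr s' a_pB = upd (iarr s a_pB) (h + nI)%N nz /\
        iarr s' a_pP = upd (iarr s a_pP) (h + nI)%N nz,
        iarr s' a_ncols = upd (iarr s a_ncols) i (ivar s i_c),
        iarr s' a_hB = upd (iarr s a_hB) i h /\
        iarr s' a_hP = upd (iarr s a_hP) i h,
        iarr s' a_hW = upd (iarr s a_hW) i wb
      & ivar s' i_h = (h + nI + 1)%N /\ ivar s' i_wb = (wb + ivar s i_c)%N]) s.
Proof.
by [].
Qed.

Lemma outputP s i nI (h := ivar s i_h) (nz := ivar s i_nz) (wb := ivar s i_wb) :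
  input_ok s -> ivar s i_i = i -> ivar s i_nI = nI -> (nI <= size idx)%N ->
  labelling B (fun x => x \notin take nI idx)
    (iarr s a_comp) (iarr s a_bad) (iarr s a_tch) (rarr s r_sgn) ->
  (forall a, (a < nI)%N -> 0 < wqs (ivar s i_off + a)%N) ->
  run output s (2000 * (p + size idx).+1) (fun s' =>
    [/\ result_at s' i nI (fun a => wqs (ivar s i_off + a)%N)
          (ivar s' i_h) (ivar s' i_nz) (ivar s' i_wb),
        kept i h nz wb s s',
        [/\ (h <= ivar s' i_h)%N, (nz <= ivar s' i_nz)%N & (wb <= ivar s' i_wb)%N]
      & same_outside output s s']).
Proof.
move=> inp ei enI le lab wq0.
set comp := iarr s a_comp in lab *; set bad := iarr s a_bad in lab *.
set tch := iarr s a_tch in lab *; set sgn := rarr s r_sgn in lab *.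
set I := take nI idx in lab *.
pose ord := result_order p comp bad tch.
have szI : size I = nI by rewrite size_takel.
pose D (t : 'I_(size ord)) : R :=
  (inv_weight wt (fun k : 'I_p => comp k == nth 0%N ord t))^-1.
(* A class contains its root, so the sum of reciprocal weights has a positive term. *)
have D_gt0 t : 0 < D t.
  rewrite /D invr_gt0 /inv_weight.
  have := mem_nth 0%N (ltn_ord t); rewrite (mem_result_order lab) => /and3P[lt /eqP ec _].
  rewrite (bigD1 (Ordinal lt)) /=; last by rewrite ec.
  apply: ltr_wpDr; last by rewrite invr_gt0; have := w_gt0 (Ordinal lt); rewrite -wtE.
  by apply: sumr_ge0 => k _; rewrite wtE invr_ge0 ltW.
have labs : labels_of comp bad tch sgn s by [].
have H1 := number_columnsP lab inp labs.
apply: run_weaken (run_same (T := 500 * p.+1 + (500 * nI.+1 + 100)) (Q := fun s' =>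
   [/\ result_at s' i nI (fun a => wqs (ivar s i_off + a)%N)
          (ivar s' i_h) (ivar s' i_nz) (ivar s' i_wb),
        kept i h nz wb s s' &
        [/\ (h <= ivar s' i_h)%N, (nz <= ivar s' i_nz)%N & (wb <= ivar s' i_wb)%N]]) _) _ _;
  [|lia|by move=> s' [[? ? ?] ?]].
apply: (run_seq H1) => s1 {H1} [[ewb ec hnum hW hW0] sm1].
have nok1 : numbering_ok m idx ptr col val wt wqs sgn D s1.
  split=> //; first exact: input_ok_same sm1 erefl inp.
    by split; rewrite ?(same_iarr (a := a_comp) sm1) ?(same_iarr (a := a_bad) sm1)
      ?(same_iarr (a := a_tch) sm1) ?(same_rarr (a := r_sgn) sm1).
  by move=> t; rewrite ewb hW.
have nI1 : ivar s1 i_nI = nI by rewrite (same_ivar sm1).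
have off1 : ivar s1 i_off = ivar s i_off by rewrite (same_ivar sm1).
have h1 : ivar s1 i_h = h by rewrite (same_ivar sm1).
have nz1 : ivar s1 i_nz = nz by rewrite (same_ivar sm1).
have H2 := emit_rowsP lab D_gt0 nok1.
rewrite nI1 off1 in H2; apply: (run_seq (H2 le wq0)) => s2 {H2} [[pk kk ePB leP0 rows] sm2].
rewrite h1 nz1 off1 in pk kk ePB leP0 rows.
have cB : ivar s2 i_c = size ord by rewrite (same_ivar sm2) // ec.
have i2 : ivar s2 i_i = i by rewrite (same_ivar sm2) // (same_ivar sm1).
have h2 : ivar s2 i_h = h by rewrite (same_ivar sm2) // h1.
have wb2 : ivar s2 i_wb = wb by rewrite (same_ivar sm2) // ewb.
have nI2 : ivar s2 i_nI = nI by rewrite (same_ivar sm2).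
have := wp_same (write_headersP s2); rewrite i2 h2 wb2 nI2 cB.
move/run_wp => H3; apply: run_weaken H3 _ _; first by rewrite [max_cost _]/=.
move=> s3 [[[eB eP] en [ehB ehP] ehW [h3 wb3]] sm3].
have nz3 : ivar s3 i_nz = ivar s2 i_nz by rewrite (same_ivar sm3).
have cB3 : iarr s3 a_cB = iarr s2 a_cB by rewrite (same_iarr sm3).
have cP3 : iarr s3 a_cP = iarr s2 a_cP by rewrite (same_iarr sm3).
have rB3 : rarr s3 r_B = rarr s2 r_B by rewrite (same_rarr sm3).
have rP3 : rarr s3 r_P = rarr s2 r_P by rewrite (same_rarr sm3).
have W3 : rarr s3 r_W = rarr s1 r_W by rewrite (same_rarr sm3) // (same_rarr sm2).
have [pz p1 p2 p3 p4] := pk; have [kB kP] := kk.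
have cB1 : iarr s1 a_cB = iarr s a_cB by rewrite (same_iarr sm1).
have cP1 : iarr s1 a_cP = iarr s a_cP by rewrite (same_iarr sm1).
have rB1 : rarr s1 r_B = rarr s r_B by rewrite (same_rarr sm1).
have rP1 : rarr s1 r_P = rarr s r_P by rewrite (same_rarr sm1).
have pB1 : iarr s1 a_pB = iarr s a_pB by rewrite (same_iarr sm1).
have pP1 : iarr s1 a_pP = iarr s a_pP by rewrite (same_iarr sm1).
have s12 a : a \in [:: a_ncols; a_hB; a_hP; a_hW] -> iarr s2 a = iarr s a.
  by rewrite !inE => /or4P[] /eqP->; rewrite (same_iarr sm2) // (same_iarr sm1).
have hBi : iarr s3 a_hB i = h by rewrite ehB upd_eq.
have hPi : iarr s3 a_hP i = h by rewrite ehP upd_eq.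
have hWi : iarr s3 a_hW i = wb by rewrite ehW upd_eq.
have szo := size_result_order (valid_sign valid) (valid_row valid) lab.
have pB3 a : (a <= nI)%N -> iarr s3 a_pB (h + a)%N = row_start h nI s2 a.
  move=> aI; rewrite eB /upd eqn_add2l /row_start ltn_neqAle aI andbT.
  by case: eqP.
have pP3 a : (a <= nI)%N -> iarr s3 a_pP (h + a)%N = row_start h nI s2 a.
  move=> aI; rewrite eP /upd eqn_add2l; case: eqP => [->|ne].
    by rewrite /row_start ltnn.
  have lt : (a < nI)%N by rewrite ltn_neqAle aI (introF eqP ne).
  by rewrite ePB // /row_start lt.
have Dw (t : 'I_(size ord)) : rarr s3 r_W (wb + t)%N = D t by rewrite W3 hW.
have DE (t : 'I_(size ord)) (j : 'I_(#|zero_cols B I| + #|reg_components B I|)) :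
    t = j :> nat -> pers_weights w (result_Cs (B := B) (I := I) comp bad tch) 0 j = D t.
  move=> tj; rewrite (pers_weights_result lab).
  rewrite /D /inv_weight -tj; congr (_^-1); apply: eq_bigr => k _.
  by rewrite wtE.
have xE (a : 'I_(size I)) : tnth (in_tuple I) a = nth (tnth (in_tuple I) a) idx a.
  have aI : (a < nI)%N by apply: leq_trans (ltn_ord a) _; rewrite szI.
  by rewrite {1}(tnth_nth (tnth (in_tuple I) a)) /= nth_take.
split.
- exists (result_Cs (B := B) (I := I) comp bad tch), (fun=> lab_eps p sgn); split.
  + exact: (result_is_choice (valid_sign valid) (valid_row valid) lab).
  + split.
    * by rewrite en upd_eq szo.
    * apply/is_csrE => a; have aI : (a < nI)%N by apply: leq_trans (ltn_ord a) _; rewrite szI.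
      rewrite hBi !pB3 //; last exact: ltnW.
      have [rB _] := rows a _ aI (xE a).
      rewrite cB3 rB3; apply: row_stored_cast szo _ rB => t j tj.
      rewrite (pers_boundary_result lab).
      by rewrite /row_value -tj.
    * move=> j; rewrite hWi mxE eqxx mulr1n.
      by rewrite (DE (cast_ord (esym szo) j)) // -Dw.
  + apply/is_csrE => a; have aI : (a < nI)%N by apply: leq_trans (ltn_ord a) _; rewrite szI.
    rewrite hPi !pP3 //; last exact: ltnW.
    have [_ rP] := rows a _ aI (xE a).
    rewrite cP3 rP3; apply: row_stored_cast szo _ rP => t j tj.
    rewrite /pers_product mul_mx_diag mxE mul_diag_mx mxE.
    rewrite (pers_boundary_result lab) [map_mx Num.sqrt _ _ _]mxE (DE t) //.
    by rewrite [map_mx _ _ _ _]mxE mxE /row_value -tj.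
  + rewrite hBi hPi hWi h3 addn1 wb3 -szo nz3; split=> // x xI.
      by rewrite pB3 // leP0.
    by rewrite pP3 // leP0.
- split; rewrite ?en ?ehB ?ehP ?ehW.
  + split=> y lt; rewrite ?eB ?eP upd_neq ?kB ?kP ?pB1 ?pP1 //; lia.
  + by split=> y lt; rewrite ?cB3 ?cP3 ?p1 ?p2 ?cB1 ?cP1.
  + by split=> y lt; rewrite ?rB3 ?rP3 ?p3 ?p4 ?rB1 ?rP1.
  + by move=> y lt; rewrite W3 hW0.
  + by split=> i' ne; rewrite upd_neq // s12.
by rewrite h3 wb3 nz3; split; lia.
Qed.

End Output.

(** * The loop down the filtration *)

Definition total_offset : cmd :=
  seqs [:: ISet i_off (IConst 0); ISet i_nI (ISub (IVar i_N) (IVar i_m));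
    ISet i_i (IAdd (IVar i_m) (IConst 1));
    for_loop i_j i_i (Seq (ISet i_off (IAdd (IVar i_off) (IVar i_nI))) (incr i_nI))].

Definition prepare_output : cmd :=
  seqs [:: ISet i_i (ISub (IVar i_i) (IConst 1)); ISet i_nI (ISub (IVar i_nI) (IConst 1));
    ISet i_off (ISub (IVar i_off) (IVar i_nI))].

Definition main_step : cmd :=
  seqs [:: prepare_output; output; If (ILe (IConst 1) (IVar i_i)) relabel Skip].

Definition program : cmd :=
  seqs [:: mark_rows; init_labels; link_entries; search; total_offset;
    While (ILe (IConst 1) (IVar i_i)) main_step].

Section Main.
Variables (R : rcfType) (n p m : nat) (B : 'M[R]_(n, p)) (idx : seq 'I_n).
Variables (ptr col : nat -> nat) (val wt wqs : nat -> R).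
Hypothesis valid : valid_input B idx ptr col val.
Variable w : 'rV[R]_p.
Hypothesis wtE : forall k : 'I_p, wt k = w 0 k.
Hypothesis w_gt0 : forall k : 'I_p, 0 < w 0 k.
Hypothesis m_le : (m <= size idx)%N.
Implicit Types (s : state R) (x : 'I_n) (j k l : 'I_p).

Local Notation input_ok := (input_ok p m idx ptr col val wt wqs).

Definition nrows (i : nat) : nat := (size idx - m + i)%N.
Definition offset (i : nat) : nat := \sum_(i' < i) nrows i'.

Hypothesis wqs_gt0 : forall i a : nat, (i <= m)%N -> (a < nrows i)%N ->
  0 < wqs (offset i + a)%N.

Lemma offsetS i : offset i.+1 = (offset i + nrows i)%N.
Proof. exact: big_ord_recr. Qed.

(** The weights in [wq] are laid out upwards while the loop runs downwards. Indices cannot be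
    multiplied, so the offset is accumulated block by block. Stopping one past the last block lets
    every main step begin with the same decrements. *)
Lemma total_offsetP s : input_ok s ->
  run total_offset s (100 * m.+2)
    (fun s' => [/\ ivar s' i_off = offset m.+1, ivar s' i_nI = nrows m.+1,
                   ivar s' i_i = m.+1 & same_outside total_offset s s']).
Proof.
move=> inp; have [[_ _ eN em] _ _] := inp.
apply: (@run_weaken _ _ _ _ _ _ _ (run_same (T := 100 * m.+2) (Q := fun s' =>
  [/\ ivar s' i_off = offset m.+1, ivar s' i_nI = nrows m.+1 & ivar s' i_i = m.+1]) _)) => //;
  last by move=> s' [[]].
apply: (@run_weaken _ _ _ (2 + (4 + (4 + (50 * m.+2))))%N _ _ _ _ _ (fun s' Q => Q)); last by lia.
apply: run_seq; first by apply: (@run_wp _ (ISet _ _)); exact: erefl.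
move=> _ <-.
apply: run_seq; first by apply: (@run_wp _ (ISet _ _)); exact: erefl.
move=> _ <-.
apply: run_seq; first by apply: (@run_wp _ (ISet _ _)); exact: erefl.
move=> _ <-; set s1 := set_ivar _ _ _.
pose inv b (s' : state R) :=
  [/\ ivar s' i_off = offset b, ivar s' i_nI = nrows b & ivar s' i_i = m.+1].
have e1 : ivar s1 i_i = m.+1 by rewrite /s1; cbn [ieval]; rewrite ?read_write /= em addn1.
apply: (@run_weaken _ _ _ _ _ (fun s' => inv (ivar s1 i_i) s' /\
  same_outside (for_loop i_j i_i
    (Seq (ISet i_off (IAdd (IVar i_off) (IVar i_nI))) (incr i_nI))) s1 s')).
- apply: (@run_for _ _ _ _ inv) => //.
    rewrite /inv /s1; cbn [ieval]; rewrite ?read_write /= eN em addn1 /offset big_ord0 /nrows.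
    by rewrite addn0.
  move=> s2 b sm eb ltb [e2 e3 e4]; wp_step; wp_step.
  by rewrite /inv ?read_write /= e2 e3 e4 offsetS /nrows addn1 addnS.
- by rewrite e1 [max_cost _]/=; lia.
by move=> s' []; rewrite e1.
Qed.

(** The value of [i_i] is the number of results still to be written. The labelling runs one step
    ahead of the counters: it already belongs to the next result, and for [i_i] equal to 0 there is
    none. *)
Definition main_inv s : Prop :=
  [/\ input_ok s,
      (ivar s i_i <= m.+1)%N /\ ivar s i_nI = nrows (ivar s i_i),
      ivar s i_off = offset (ivar s i_i),
      (0 < ivar s i_i)%N ->
        labelling B (fun x => x \notin take (nrows (ivar s i_i).-1) idx)
          (iarr s a_comp) (iarr s a_bad) (iarr s a_tch) (rarr s r_sgn)
    & forall i, (ivar s i_i <= i <= m)%N ->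
        result_at B idx w s i (nrows i) (fun a => wqs (offset i + a)%N)
          (ivar s i_h) (ivar s i_nz) (ivar s i_wb)].

Lemma result_at_same c s s' i nI wqf H N W : same_outside c s s' ->
  (all (fun z => z \notin writes c)
     [:: (2, a_ncols); (2, a_hB); (2, a_pB); (2, a_cB); (2, a_hW); (2, a_hP);
         (2, a_pP); (2, a_cP); (3, r_B); (3, r_W); (3, r_P)]%N) = true ->
  result_at B idx w s i nI wqf H N W -> result_at B idx w s' i nI wqf H N W.
Proof.
move=> [_ _ h2 h3] /= /and5P[w1 w2 w3 w4 /and5P[w5 w6 w7 w8 /and4P[w9 w10 w11 _]]].
by rewrite /result_at /outputs_pair /outputs_product !h2 // !h3.
Qed.

Lemma main_stepP s : main_inv s -> (0 < ivar s i_i)%N ->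
  run main_step s (3000 * (p + size idx).+1)
    (fun s' => main_inv s' /\ (ivar s' i_i < ivar s i_i)%N).
Proof.
move=> [inp [lei enI] eoff lab res] gt0.
have [i ei] : exists i, ivar s i_i = i.+1 by exists (ivar s i_i).-1; lia.
rewrite ei /= in lei enI eoff lab res gt0.
have le : (nrows i <= size idx)%N by rewrite /nrows; lia.
have eI : nrows i.+1 = (nrows i).+1 by rewrite /nrows addnS.
pose s0 := set_ivar (set_ivar (set_ivar s i_i i) i_nI (nrows i)) i_off (offset i).
have H0 : wp prepare_output (fun s' => s' = s0) s.
  rewrite /prepare_output; cbn [seqs].
  wp_step; rewrite ei subn1 /=; wp_step; rewrite enI eI subn1 /=.
  by wp_step; rewrite eoff offsetS addnK.
apply: (@run_weaken _ _ _ (20 + (2000 * (p + size idx).+1 + (3 + 600 * p.+1).+1))%N _ _ _ _ _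
  (fun s' Q => Q)); last by lia.
apply: (run_seq (run_weaken (run_wp H0) _ (fun _ Q => Q))) => // _ ->.
have inp0 : input_ok s0.
  by case: inp => -[? ? ? ?] [? ? ?] [? ? ?]; split; split; rewrite ?read_write.
have nI0 : ivar s0 i_nI = nrows i by rewrite ?read_write.
have i0 : ivar s0 i_i = i by rewrite ?read_write.
have off0 : ivar s0 i_off = offset i by rewrite ?read_write.
have lab0 : labelling B (fun x => x \notin take (nrows i) idx)
   (iarr s0 a_comp) (iarr s0 a_bad) (iarr s0 a_tch) (rarr s0 r_sgn).
  by rewrite ?read_write; apply: lab.
have wq0 a : (a < nrows i)%N -> 0 < wqs (ivar s0 i_off + a)%N.
  by rewrite off0; apply: wqs_gt0; rewrite -ltnS.
apply: (run_seq (outputP valid wtE w_gt0 inp0 i0 nI0 le lab0 wq0)).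
move=> s1 [res1 kp [lh lz lw] sm1].
rewrite off0 in res1.
have inp1 : input_ok s1 := input_ok_same sm1 erefl inp0.
have i1 : ivar s1 i_i = i by rewrite (same_ivar sm1).
have nI1 : ivar s1 i_nI = nrows i by rewrite (same_ivar sm1).
have off1 : ivar s1 i_off = offset i by rewrite (same_ivar sm1).
have res2 i' : (i <= i' <= m)%N ->
  result_at B idx w s1 i' (nrows i') (fun a => wqs (offset i' + a)%N)
          (ivar s1 i_h) (ivar s1 i_nz) (ivar s1 i_wb).
  case/andP; rewrite leq_eqVlt => /orP[/eqP<- //|lt] lem.
  have ne : i' != i by rewrite gtn_eqF.
  apply: (result_at_le lh lz lw); apply: (result_at_kept ne _ kp).
    by rewrite /nrows; lia.
  have := res i'; rewrite lt lem => /(_ isT).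
  by rewrite ?read_write.
apply: run_if => /= hi; last first.
  apply: (@run_weaken _ _ _ 1); last by move=> s' Q; exact: Q.
    apply: run_wp; rewrite wp_skip; split; last by rewrite i1 ei.
    rewrite i1 in hi; split; rewrite ?i1 //; first by split=> //; apply: ltnW.
    by move=> ip; rewrite ip in hi.
  by lia.
rewrite i1 in hi.
have [x0 _] : exists x0 : 'I_n, True.
  have : (0 < size idx)%N by move: le; rewrite /nrows; lia.
  by case: (idx) => // x0; exists x0.
pose x := nth x0 idx (nrows i).-1.
have nIp : (0 < nrows i)%N by rewrite /nrows; lia.
have ltI : (0 < ivar s1 i_nI <= size idx)%N by rewrite nI1 nIp le.
have ex : x = nth x idx (ivar s1 i_nI).-1.
  by rewrite nI1; apply: set_nth_default; lia.
have lab1 : labelling B (fun x => x \notin take (nrows i) idx)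
   (iarr s1 a_comp) (iarr s1 a_bad) (iarr s1 a_tch) (rarr s1 r_sgn).
  by rewrite !(same_iarr sm1) // (same_rarr sm1).
apply: run_weaken (run_same (relabelP valid inp1 lab1 ltI ex)) _ _; first by lia.
move=> s2 [lab2 sm2].
have i2 : ivar s2 i_i = i by rewrite (same_ivar sm2).
split; last by rewrite i2 ei.
split; rewrite ?i2.
- exact: input_ok_same sm2 erefl inp1.
- by split; [apply: ltnW|rewrite (same_ivar sm2)].
- by rewrite (same_ivar sm2).
- move=> ip; apply: (labelling_ext lab2) => // y k _.
  have -> : take (nrows i) idx = rcons (take (nrows i).-1 idx) x.
    by rewrite -{1}(prednK nIp) (take_nth x0) //; lia.
  have eI1 : (nrows i).-1 = nrows i.-1 by rewrite /nrows; lia.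
  rewrite /add_row mem_rcons inE negb_or -eI1.
  case: eqP => [->|_]; last by rewrite orbF.
  rewrite orbT; symmetry.
  (* As [idx] has no repetitions, [x] does not occur in the shorter prefix, so it is outside that
     prefix as [add_row] requires. *)
  have un := valid_idx valid.
  rewrite -(cat_take_drop (nrows i).-1 idx) cat_uniq in un.
  case/and3P: un => _ /hasPn h _; apply: (h x).
  rewrite /x -[in nth _ idx _](addn0 (nrows i).-1) -nth_drop.
  by apply: mem_nth; rewrite size_drop subn_gt0 prednK.
- move=> i' hi'; have := result_at_same sm2 erefl (res2 i' hi').
  by rewrite !(same_ivar (s' := s2) sm2).
Qed.
Lemma programP s : input_ok s ->
  (forall i : nat, [/\ iarr s a_mark i = 0%N, iarr s a_first i = 0%N,
     iarr s a_bad i = 0%N, iarr s a_tch i = 0%N & iarr s a_vis i = 0%N]) ->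
  run program s
    (2000 * (n + p + size idx + m).+1 + 4000 * (m.+1 * (p + size idx).+1))
    (fun s' => forall i, (i <= m)%N -> exists H N W,
       result_at B idx w s' i (nrows i) (fun a => wqs (offset i + a)%N) H N W).
Proof.
move=> inp z.
have T0 : (100 * (size idx).+1 + (100 * p.+1 + (300 * n.+1 +
  (1000 * (n + p).+1 + (100 * m.+2 + (4000 * (m.+1 * (p + size idx).+1) + 10))))) <=
  2000 * (n + p + size idx + m).+1 + 4000 * (m.+1 * (p + size idx).+1))%N by lia.
apply: (run_weaken _ T0 (fun s' Q => Q)) => {T0}.
have z1 x : iarr s a_mark x = 0%N by case: (z x).
apply: (run_seq (run_weaken (mark_rowsP inp z1) _ (fun _ Q => Q))).
  by rewrite [max_cost _]/=; lia.
move=> s1 [mk1 sm1].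
have inp1 := input_ok_same sm1 erefl inp.
apply: (run_seq (run_weaken (init_labelsP inp1) _ (fun _ Q => Q))).
  by rewrite [max_cost _]/=; lia.
move=> s2 [ini2 sm2].
have inp2 := input_ok_same sm2 erefl inp1.
have z2 (k : nat) : iarr s2 a_first k = 0%N.
  by rewrite (same_iarr sm2) // (same_iarr sm1) //; case: (z k).
apply: (run_seq (link_entriesP valid inp2 z2)) => s3 [lnk3 sm3].
have inp3 := input_ok_same sm3 erefl inp2.
have mk3 : marked idx s3.
  by move=> x; rewrite (same_iarr sm3) // (same_iarr sm2) // mk1.
have ini3 j : iarr s3 a_comp j = j /\ rarr s3 r_sgn j = 1.
  by rewrite (same_iarr sm3) // (same_rarr sm3) //; apply: ini2.
have z3 j : [/\ iarr s3 a_bad j = 0%N, iarr s3 a_tch j = 0%N & iarr s3 a_vis j = 0%N].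
  by rewrite !(same_iarr sm3) // !(same_iarr sm2) // !(same_iarr sm1) //; case: (z j).
apply: (run_seq (searchP valid inp3 lnk3 mk3 ini3 z3)) => s4 [lab4 sm4].
have inp4 := input_ok_same sm4 erefl inp3.
apply: (run_seq (total_offsetP inp4)) => s5 [off5 nI5 i5 sm5].
have inp5 := input_ok_same sm5 erefl inp4.
have inv5 : main_inv s5.
  split=> //; rewrite i5 //.
  - move=> _; rewrite !(same_iarr sm5) // (same_rarr sm5) //=.
    by rewrite /nrows subnK // take_size.
  - by move=> i /andP[h1 h2]; move: (leq_trans h1 h2); rewrite ltnn.
apply: (run_weaken (run_while (mu := fun s' => ivar s' i_i) inv5
  (T := 3000 * (p + size idx).+1) _)).
- by move=> s6 _ inv6 gt0; apply: main_stepP.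
- rewrite i5 [bcost _]/=.
  have := leq_pmulr m.+1 (ltn0Sn (p + size idx)).
  have e (a b : nat) : ((3 + 3000 * a).+1 * b = 4 * b + 3000 * (b * a))%N.
    by rewrite -addn1; ring.
  by rewrite e; move: (m.+1 * (p + size idx).+1)%N => S; lia.
move=> s6 [[_ _ _ _ res] + _] i le; rewrite /= -eqn0Ngt => /eqP e0.
by exists (ivar s6 i_h), (ivar s6 i_nz), (ivar s6 i_wb); apply: res; rewrite e0.
Qed.
End Main.

Lemma nth_flatten_offset (T : Type) (x0 : T) (ss : seq (seq T)) i a :
  (a < size (nth [::] ss i))%N ->
  nth x0 (flatten ss) (\sum_(i' < i) size (nth [::] ss i') + a) =
  nth x0 (nth [::] ss i) a.
Proof.
elim: ss i => [|s ss IH] [|i] /=; rewrite ?nth_nil //.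
  by move=> lt; rewrite big_ord0 add0n nth_cat lt.
move=> lt; rewrite big_ord_recl /= nth_cat -addnA ltnNge leq_addr /= addKn.
exact: IH.
Qed.

(** * Entries of the boundary matrix *)

Section Boundary.
Variables (R : rcfType) (V : finType).
Implicit Types (L : {set {set V}}) (s t : {set V}).

Lemma omit_inj (u : seq V) i j : uniq u -> (i < size u)%N -> (j < size u)%N ->
  [set x in omit i u] = [set x in omit j u] -> i = j.
Proof.
move=> un li lj; case: (eqVneq i j) => // ij /setP.
have x0 : V by case: u li {un lj}.
move=> /(_ (nth x0 u i)); rewrite !inE.
have -> : (nth x0 u i \in omit i u) = false.
  apply/negbTE; move: un; rewrite -{1}(cat_take_drop i u) (drop_nth x0) //.
  by rewrite uniq_catC cat_cons /= => /andP[]; rewrite !mem_cat orbC.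
move=> /esym/negbT/negP[]; have := mem_nth x0 li.
rewrite -{2}(cat_take_drop j u) (drop_nth x0) // !mem_cat inE.
by rewrite nth_uniq // (negbTE ij).
Qed.

(** Omitting different positions omits different vertices ([omit_inj]), so the sum defining the
    coefficient has at most one term. *)
Lemma boundary_coef_face L (o : {set V} -> seq V) s t :
  is_orientation L o -> t \in L -> boundary_coef R o s t != 0 ->
  is_sign (boundary_coef R o s t) /\ s \subset t.
Proof.
move=> ori tL; have pe := ori t tL.
have un : uniq (o t) by rewrite (perm_uniq pe) enum_uniq.
rewrite /boundary_coef;
case: (pickP (fun i : 'I_(size (o t)) => [set x in omit i (o t)] == s)) => [i0 e0|no].
  rewrite (bigD1 i0) //= big1 ?addr0 => [_|i /andP[/eqP ei ne]]; last first.
    case/negP: ne; apply/eqP/val_inj; apply: (omit_inj un (ltn_ord i) (ltn_ord i0)).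
    exact: etrans ei (esym (eqP e0)).
  split; first by rewrite -signr_odd; case: odd; [right|left].
  rewrite -(eqP e0); apply/subsetP => x; rewrite inE /omit mem_cat.
  move=> h; have : x \in o t by case/orP: h => [/mem_take|/mem_drop].
  by rewrite (perm_mem pe) mem_enum.
by rewrite big_pred0 ?eqxx.
Qed.

End Boundary.

Theorem mainTheorem4 :
  exists (prog : cmd) (const : nat),
  forall (R : realType) (V : finType) (q m : nat)
    (L : {set {set V}}) (K : nat -> {set {set V}})
    (o : {set V} -> seq V)
    (rows cols : seq {set V})
    (wL : {set V} -> R) (wK : nat -> {set V} -> R)
    (idx : seq 'I_(size rows))
    (ptr col : seq nat) (val : seq R),
  is_complex L ->
  (forall i, (i <= m)%N -> is_complex (K i)) ->
  (forall i, (i < m)%N -> K i \subset K i.+1) ->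
  K m \subset L ->
  non_branching q L ->
  (forall i, (i < m)%N -> nsimplices q (K i.+1) = (nsimplices q (K i)).+1) ->
  is_orientation L o ->
  perm_eq rows (enum (simplices q L)) ->
  perm_eq cols (enum (simplices q.+1 L)) ->
  (forall s, s \in L -> 0 < wL s) ->
  (forall i s, (i <= m)%N -> s \in K i -> 0 < wK i s) ->
  (* The first n_q^{K_i} entries of [idx] are the indices of the q-simplices
     of K_i. *)
  size idx = nsimplices q (K m) ->
  (forall i, (i <= m)%N ->
     perm_eq [seq nth set0 rows (nat_of_ord x)
               | x <- take (nsimplices q (K i)) idx]
             (enum (simplices q (K i)))) ->
  let B := boundary_mx R o rows cols in
  is_csr_input B ptr col val ->
  let I i := take (nsimplices q (K i)) idx in
  let w := \row_(k < size cols) wL (nth set0 cols k) in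
  let wq i := \row_(a < size (I i))
                wK i (nth set0 rows (tnth (in_tuple (I i)) a)) in
  exists (fin : state R) (t : nat),
  [/\ exec prog
        (input_state (size rows) (size cols) m ptr col val
           [seq nat_of_ord x | x <- idx]
           [seq wL s | s <- cols]
           (flatten [seq [seq wK i (nth set0 rows (nat_of_ord x)) | x <- I i]
                      | i <- iota 0 m.+1]))
        fin t,
      (t <= const *
         maxn 1 ((nsimplices q L - nsimplices q (K m) + m)
                   * inv_ack (nsimplices q.+1 L)
                 + m.+1 * (nsimplices q.+1 L + nsimplices q (K m))))%N
    & forall i, (i <= m)%N ->
      exists (Cs : 'I_#|reg_components B (I i)| -> {set 'I_(size cols)})
             (eps : 'I_#|reg_components B (I i)|
                      -> {ffun 'I_(size cols) -> bool}),
      [/\ is_choice Cs eps,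
          outputs_pair fin i (pers_boundary Cs eps)
            (diag_mx (pers_weights w Cs))
        & outputs_product fin i (pers_product w Cs eps (wq i))]].
Proof.
exists program, (5 * 5000)%N => R V q m L K o rows cols wL wK idx ptr col val.
move=> Lc Kc Ksub KmL nb nK ori prows pcols wLpos wKpos szidx idxK B csr I w wq.
have urows : uniq rows by rewrite (perm_uniq prows) enum_uniq.
have ucols : uniq cols by rewrite (perm_uniq pcols) enum_uniq.
have szrows : size rows = nsimplices q L by rewrite (perm_size prows) -cardE.
have szcols : size cols = nsimplices q.+1 L by rewrite (perm_size pcols) -cardE.
have colsL (k : 'I_(size cols)) : nth set0 cols k \in simplices q.+1 L.
  by rewrite -[_ \in _]mem_enum -(perm_mem pcols) mem_nth.
have rowsL (x : 'I_(size rows)) : nth set0 rows x \in simplices q L.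
  by rewrite -[_ \in _]mem_enum -(perm_mem prows) mem_nth.
have simpL r s : s \in simplices r L -> s \in L by rewrite inE => /andP[].
have Kn i : (i <= m)%N -> (nsimplices q (K i) + (m - i) = size idx)%N.
  move=> im; rewrite -(subKn im); move: (m - i)%N (leq_subr i m) => d.
  rewrite szidx; elim: d => [|d IH] dm; first by rewrite subn0 subnn addn0.
  rewrite -IH; last exact: ltnW.
  have <- : (m - d.+1).+1 = (m - d)%N by lia.
  by rewrite nK; lia.
have m_le : (m <= size idx)%N by have := Kn 0%N isT; lia.
have Kr i : (i <= m)%N -> nsimplices q (K i) = nrows m idx i.
  by move=> im; have := Kn i im; rewrite /nrows; lia.
have idx_uniq : uniq idx.
  have := perm_uniq (idxK m (leqnn m)); rewrite enum_uniq -szidx take_size.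
  by move/map_uniq.
case: csr => szptr ptr0 szcol szval csr.
have B_face x k : B x k != 0 -> is_sign (B x k) /\ nth set0 rows x \subset nth set0 cols k.
  by rewrite mxE => /(boundary_coef_face ori (simpL _ _ (colsL k))).
have valid : valid_input B idx (nth 0%N ptr) (nth 0%N col) (nth 0 val).
  split=> //; first by move=> x k /B_face[].
  (* Distinct columns are distinct simplices, so the non-zero entries of a row inject into the
     simplices having the row simplex as a face. *)
  move=> x; apply: leq_trans (nb _ (rowsL x)).
  rewrite -(card_in_imset (f := fun k : 'I_(size cols) => nth set0 cols k)).
    apply: subset_leq_card; apply/subsetP => t /imsetP[k]; rewrite inE => /B_face[_ sub] ->.
    by rewrite inE colsL.
  by move=> k l _ _ /eqP; rewrite nth_uniq // => /eqP/val_inj.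
pose wt := nth 0 [seq wL s | s <- cols].
have wtE (k : 'I_(size cols)) : wt k = w 0 k by rewrite /wt (nth_map set0) // mxE.
have w_gt0 (k : 'I_(size cols)) : 0 < w 0 k.
  by rewrite mxE; apply: wLpos; apply: simpL (colsL k).
pose ss := [seq [seq wK i (nth set0 rows (nat_of_ord x)) | x <- I i] | i <- iota 0 m.+1].
have nss i : (i <= m)%N -> nth [::] ss i = [seq wK i (nth set0 rows (nat_of_ord x)) | x <- I i].
  by move=> im; rewrite (nth_map 0%N) ?size_iota // nth_iota.
have szI i : (i <= m)%N -> size (I i) = nrows m idx i.
  by move=> im; rewrite /I Kr // size_takel // /nrows; lia.
have wqsE i a (x0 : 'I_(size rows)) : (i <= m)%N -> (a < nrows m idx i)%N ->
    nth 0 (flatten ss) (offset m idx i + a)%N = wK i (nth set0 rows (nth x0 (I i) a)).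
  move=> im lt.
  have -> : offset m idx i = (\sum_(i' < i) size (nth [::] ss i'))%N.
    apply: eq_bigr => i' _; rewrite nss ?size_map ?szI //;
      by apply: ltnW; apply: leq_trans (ltn_ord i') im.
  rewrite nth_flatten_offset; last by rewrite nss // size_map szI.
  by rewrite nss // (nth_map x0) // szI.
have wqs_gt0 i a : (i <= m)%N -> (a < nrows m idx i)%N ->
    0 < nth 0 (flatten ss) (offset m idx i + a)%N.
  move=> im lt; have [x0 _] : exists x0 : 'I_(size rows), True.
    by have := szI i im; case: (I i) => [|x0 ? _]; [move=> /= e; rewrite -e in lt|exists x0].
  rewrite (wqsE i a x0) //; apply: wKpos => //.
  suff : nth set0 rows (nth x0 (I i) a) \in simplices q (K i) by rewrite inE => /andP[].
  rewrite -[_ \in _]mem_enum -(perm_mem (idxK i im)).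
  by apply/mapP; exists (nth x0 (I i) a) => //; apply: mem_nth; rewrite szI.
have inp : input_ok (size cols) m idx (nth 0%N ptr) (nth 0%N col) (nth 0 val) wt
    (nth 0 (flatten ss)) (input_state (size rows) (size cols) m ptr col val
      [seq nat_of_ord x | x <- idx] [seq wL s | s <- cols] (flatten ss)).
  by split; split=> //=; rewrite size_map.
have [|fin [t [ex le res]]] := programP valid wtE w_gt0 m_le wqs_gt0 inp.
  by move=> i /=; rewrite !nth_nil.
exists fin, t; split=> //.
- apply: leq_trans le _.
  have al_gt0 : (0 < inv_ack (nsimplices q.+1 L))%N.
    by rewrite /inv_ack; case: ex_minnP => k /andP[].
  rewrite -szcols in al_gt0; rewrite -szrows -szcols -szidx.
  (* This makes the truncated difference of the bound a true one, so that n_q^L splits into its two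
     charged parts. The accounting gives at most 2000 (Y + 2 Z + 1) + 4000 (Y + Z + 1) for the two
     summands Y and Z, hence at most 14000 times the maximum; the chosen constant leaves slack. *)
  have nN : (size idx <= size rows)%N.
    by rewrite -[leqRHS]card_ord -(card_uniqP idx_uniq) max_card.
  set al := inv_ack _ in al_gt0 *.
  have h1 : (size rows - size idx + m <= (size rows - size idx + m) * al)%N.
    exact: leq_pmulr.
  have h2 : (size cols + size idx <= m.+1 * (size cols + size idx))%N.
    exact: leq_pmull.
  rewrite [(m.+1 * _.+1)%N]mulnS;
  move: (_ * al)%N (m.+1 * (size cols + size idx))%N h1 h2 => Y Z h1 h2.
  move: (maxn 1 (Y + Z))%N (leq_maxl 1 (Y + Z)) (leq_maxr 1 (Y + Z)) => M M1 MX.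
  lia.
move=> i im; have [H [N [W [Cs [eps [ch op opr _]]]]]] := res i im.
rewrite /wq /I (Kr i im); exists Cs, eps; split; [exact: ch|exact: op|].
move: opr; congr (outputs_product _ _ (pers_product _ _ _ _)).
apply/rowP => a; rewrite !mxE.
have lt : (a < nrows m idx i)%N.
  by have := ltn_ord a; rewrite {2}size_takel // /nrows; lia.
rewrite (wqsE i a (tnth (in_tuple _) a) im lt); congr (wK i (nth set0 rows _)).
by rewrite [in RHS](tnth_nth (tnth (in_tuple _) a)) /I (Kr i im).
Qed.
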